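(* Let $H$ be a catacondensed hexagonal system possessing a tail $T(t_1,t_2,t_3)$ with respect to a hexagon $h$, and let $H_1^T,H_2^T,H_3^T,H_4^T$ be the associated subgraphs (all as defined in the context). Then: (1) if $t_2=-1$, then $$Af(H,x)=x\,Af(H_2^T,x)+x\,Af(H_3^T,x)+\alpha_T;$$ (2) if $t_2\ge 0$, then $$Af(H,x)=x^2Af(H_1^T,x)+\bigl(3x^2+2(t_1+t_2)x^3+t_1t_2x^4\bigr)Af(H_2^T,x)-x^3Af(H_3^T,x)+\beta_T,$$ where $\alpha_T=0$ if $t_1=-1$, and $\alpha_T=x\,Af(H_1^T,x)+t_1x^2Af(H_2^T,x)-x^2Af(H_3^T,x)$ if $t_1\ge 0$; and $\beta_T=x\,Af(H_2^T,x)-x^2Af(H_4^T,x)$ if $t_3=0$, and $\beta_T=x^2Af(H_3^T,x)$ if $t_3\ge 1$.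
   Context: Perfect matchings and anti-forcing. For a graph $G$ with a perfect matching $M$, an anti-forcing set of $M$ is a set $S\subseteq E(G)\setminus M$ such that $G-S$ (delete the edges of $S$) has $M$ as its unique perfect matching; the anti-forcing number $af(G,M)$ is the minimum size of an anti-forcing set of $M$. The anti-forcing polynomial is $Af(G,x)=\sum_{M\in\mathcal M(G)}x^{af(G,M)}$, where $\mathcal M(G)$ is the set of perfect matchings of $G$. The empty graph (no vertices) has exactly one perfect matching (the empty one), with anti-forcing number $0$, so its anti-forcing polynomial is $1$. Hexagonal systems. A hexagonal system is a 2-connected finite plane graph in which every interior face is bounded by a regular hexagon of side length one; these faces are its hexagons. Two hexagons are neighboring if they share an edge. $H$ is catacondensed if no three of its hexagons share a common vertex. A hexagon is terminal if it has exactly one neighboring hexagon (or if $H$ consists of a single hexagon), branched if it has three neighboring hexagons, a kink if it has exactly two neighboring hexagons and contains two adjacent vertices of degree two in $H$, and linear if it has exactly two neighboring hexagons and is not a kink. A linear hexagonal chain of $H$ is a sequence of distinct hexagons $C_1,\dots,C_k$ ($k\ge1$) of $H$, consecutive ones neighboring, whose centers all lie on one straight line; it is maximal if it is not contained in a longer linear hexagonal chain of $H$; its length is $k$; we say it starts at $C_1$ and ends at $C_k$. Its vertical edges are the edges of its hexagons intersecting the straight line through the centers. A kink $h$ is an end kink if some maximal linear hexagonal chain of $H$ starts at $h$ and ends at a terminal hexagon. A branched hexagon $h$ is an end branched hexagon if two maximal linear hexagonal chains of $H$ starting at $h$ end at terminal hexagons. Tail. A tail $T(t_1,t_2,t_3)$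 with respect to $h$ is a subgraph $T_1\cup T_2\cup T_3$ of $H$ defined in one of three ways: (a) if $H$ is itself a linear hexagonal chain and $h$ is a terminal hexagon of it, then $T_1=H$, $T_2=T_3=h$, $t_1+2$ ($t_1\ge -1$) is the length of $T_1$ and $t_2=t_3=-1$; (b) if $h$ is an end kink, then $T_2=h$, and $T_1,T_3$ are the two maximal linear hexagonal chains starting at $h$, with $T_1$ ending at a terminal hexagon; $t_2=-1$ and $t_1+2,t_3+2$ ($t_1,t_3\ge0$) are the lengths of $T_1,T_3$; (c) if $h$ is an end branched hexagon, then $T_1,T_2,T_3$ are the three maximal linear hexagonal chains starting at $h$, with $T_1,T_2$ ending at terminal hexagons, and $t_1+2,t_2+2,t_3+2$ ($t_1,t_2,t_3\ge 0$) are their lengths. Associated subgraphs. ''Deleting'' a set of hexagons from $H$ means taking the subgraph of $H$ formed by the union of the boundaries of the remaining hexagons (the empty graph if none remain). $H_1^T$ is obtained from $H$ by deleting all hexagons of $T_1\cup T_2$ except $h$; $H_2^T$ by deleting all hexagons of $T_1\cup T_2$; $H_3^T$ by deleting all hexagons of $T_1\cup T_2\cup T_3$. When $h$ is an end branched hexagon, let $K$ be the last hexagon of $T_3$ (the one where $T_3$ ends), $v$ the vertical edge of $T_3$ in $K$ not shared with the preceding hexagon of $T_3$, and $u_1,u_2$ the two edges of $K$ sharing an endpoint with $v$; for $i=1,2$, if $u_i$ is shared by $K$ and another hexagon $K_i$, let $L_i$ be the maximal linear hexagonal chain of $H$ containing $K$ and $K_i$. Then $H_4^T$ is obtained from $H_3^T$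 by further deleting all hexagons of those $L_i$ that exist. *)

(* Defs.v *)
From HB Require Import structures.
From mathcomp Require Import all_boot all_order all_algebra.
From mathcomp Require Import finmap.
Set Implicit Arguments. Unset Strict Implicit. Unset Printing Implicit Defensive.
Import Order.TTheory GRing.Theory Num.Theory.
Local Open Scope fset_scope.
Local Open Scope ring_scope.

(* A hexagon (cell) of the regular hexagonal tiling of the plane by unit      *)
(* hexagons is named by axial coordinates (q, r) : int * int; its center is   *)
(* q * (sqrt 3, 0) + r * (sqrt 3 / 2, 3 / 2), an injective LINEAR map of Z^2, *)
(* so collinearity of centers is collinearity of axial coordinates.           *)
(* Two cells are neighbors (share an edge) iff their difference is one of the *)
(* six unit directions below (listed in cyclic order).                        *)
(* A lattice EDGE is the 2-set {c, d} of the two cells sharing it; a lattice  *)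
(* VERTEX is the 3-set of the three pairwise neighboring cells around it.     *)
(* An edge e is incident to a vertex t iff e `<=` t.                          *)

Definition cell := (int * int)%type.

Definition addc (c u : cell) : cell := (c.1 + u.1, c.2 + u.2).
Definition subc (c u : cell) : cell := (c.1 - u.1, c.2 - u.2).

Definition c0 : cell := (0, 0).

Definition dirs : seq cell :=
  [:: (1, 0); (0, 1); (-1, 1); (-1, 0); (0, -1); (1, -1)].

Definition adjc (c d : cell) : bool := subc d c \in dirs.

Definition hexedges (c : cell) : {fset {fset cell}} :=
  [fset [fset c; addc c u] | u in dirs].

Definition hexverts (c : cell) : {fset {fset cell}} :=
  [fset [fset c; addc c (nth c0 dirs i); addc c (nth c0 dirs ((i.+1) %% 6)%N)]
     | i in iota 0 6].

Definition gverts (S : {fset cell}) : {fset {fset cell}} :=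
  \bigcup_(c <- S) hexverts c.
Definition gedges (S : {fset cell}) : {fset {fset cell}} :=
  \bigcup_(c <- S) hexedges c.

Definition is_pm (V E M : {fset {fset cell}}) : bool :=
  (M `<=` E) && all (fun v => #|` [fset e in M | e `<=` v] | == 1%N) V.

Definition is_antiforcing (V E M A : {fset {fset cell}}) : bool :=
  (A `<=` E `\` M) && is_pm V (E `\` A) M &&
  all (fun M' => is_pm V (E `\` A) M' ==> (M' == M)) (fpowerset (E `\` A)).

(* af(G, M): minimum size of an anti-forcing set of M (E \ M is always one). *)
Definition af (V E M : {fset {fset cell}}) : nat :=
  \big[minn/#|` E|]_(A <- fpowerset (E `\` M) | is_antiforcing V E M A) #|` A|.

Definition perfect_matchings (V E : {fset {fset cell}}) : {fset {fset {fset cell}}} :=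
  [fset M in fpowerset E | is_pm V E M].

Definition Afpoly (V E : {fset {fset cell}}) : {poly int} :=
  \sum_(M <- perfect_matchings V E) 'X^(af V E M).

Definition Af (S : {fset cell}) : {poly int} := Afpoly (gverts S) (gedges S).

Definition vadj (E : {fset {fset cell}}) (a b : {fset cell}) : bool :=
  (a != b) && has (fun e => (e `<=` a) && (e `<=` b)) E.

Definition gconnected (V E : {fset {fset cell}}) : Prop :=
  forall a b, a \in V -> b \in V ->
    exists p : seq {fset cell},
      [&& path (vadj E) a p, last a p == b & all (fun w => w \in V) p].

Definition two_connected (V E : {fset {fset cell}}) : Prop :=
  (3 <= #|` V|)%N /\ gconnected V E /\
  forall x, x \in V ->
    gconnected (V `\ x) [fset e in E | ~~ (e `<=` x)].

(* Every bounded face of the plane graph of S is one of the hexagons of S.    *)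
(* The faces of the graph other than the hexagons of S are the connected      *)
(* components (under edge-neighborhood) of the cells NOT in S; the unbounded  *)
(* face is the unique unbounded one. So: every cell outside S can be joined,  *)
(* avoiding S, to cells arbitrarily far away.                                  *)
Definition no_holes (S : {fset cell}) : Prop :=
  forall c, c \notin S -> forall N : nat,
    exists p : seq cell,
      [&& path adjc c p, all (fun d => d \notin S) p &
          (N <= `|(last c p).1| + `|(last c p).2|)%N].

Definition hexagonal_system (S : {fset cell}) : Prop :=
  S != fset0 /\ two_connected (gverts S) (gedges S) /\ no_holes S.

Definition catacondensed (S : {fset cell}) : Prop :=
  forall c1 c2 c3 v, c1 \in S -> c2 \in S -> c3 \in S ->
    c1 != c2 -> c1 != c3 -> c2 != c3 ->
    v \in hexverts c1 -> v \in hexverts c2 -> v \in hexverts c3 -> False.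

Definition nbrs (S : {fset cell}) (h : cell) : {fset cell} :=
  [fset d in S | adjc h d].

Definition terminal (S : {fset cell}) (h : cell) : bool :=
  (h \in S) && ((#|` nbrs S h| == 1%N) || (S == [fset h])).

Definition branched (S : {fset cell}) (h : cell) : bool :=
  (h \in S) && (#|` nbrs S h| == 3%N).

Definition degree (S : {fset cell}) (v : {fset cell}) : nat :=
  #|` [fset e in gedges S | e `<=` v] |.

Definition kink (S : {fset cell}) (h : cell) : bool :=
  [&& h \in S, #|` nbrs S h| == 2%N &
   has (fun v => has (fun w =>
      [&& vadj (gedges S) v w, degree S v == 2%N & degree S w == 2%N])
      (hexverts h)) (hexverts h)].

Definition cross (a b : cell) : int := a.1 * b.2 - a.2 * b.1.

Definition collinear (s : seq cell) : bool :=
  all (fun x => all (fun y => all (fun z =>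
     cross (subc y x) (subc z x) == 0) s) s) s.

Definition linchain (S : {fset cell}) (s : seq cell) : bool :=
  match s with
  | [::] => false
  | x :: s' => [&& uniq s, all (fun c => c \in S) s, path adjc x s' & collinear s]
  end.

Definition maxchain (S : {fset cell}) (s : seq cell) : Prop :=
  linchain S s /\
  forall s', linchain S s' -> {subset s <= s'} -> (size s' <= size s)%N.

Definition starts_at (s : seq cell) (h : cell) : bool := head h s == h.
Definition ends_at (s : seq cell) (k : cell) : bool := last k s == k.
Definition chain_start (s : seq cell) : cell := head c0 s.
Definition chain_end (s : seq cell) : cell := last c0 s.

Definition end_kink (S : {fset cell}) (h : cell) : Prop :=
  kink S h /\ exists s, [/\ maxchain S s, head h s = h & terminal S (chain_end s)].

Definition end_branched (S : {fset cell}) (h : cell) : Prop :=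
  branched S h /\ exists s1 s2, [/\ s1 <> s2,
     [/\ maxchain S s1, head h s1 = h & terminal S (chain_end s1)] &
     [/\ maxchain S s2, head h s2 = h & terminal S (chain_end s2)]].

Definition is_tail (S : {fset cell}) (h : cell) (T1 T2 T3 : seq cell)
    (t1 t2 t3 : int) : Prop :=
  [/\ [/\ linchain S T1, S = [fset c in T1] & terminal S h],
      T2 = [:: h], T3 = [:: h] &
      [/\ t1 >= -1, (size T1)%:Z = t1 + 2, t2 = -1 & t3 = -1]]
  \/
  [/\ end_kink S h, T2 = [:: h],
      [/\ maxchain S T1, head h T1 = h & terminal S (chain_end T1)],
      [/\ maxchain S T3, head h T3 = h & T3 <> T1] &
      [/\ t2 = -1, 0 <= t1, 0 <= t3, (size T1)%:Z = t1 + 2 & (size T3)%:Z = t3 + 2]]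
  \/
  [/\ end_branched S h,
      [/\ maxchain S T1, head h T1 = h & terminal S (chain_end T1)],
      [/\ maxchain S T2, head h T2 = h & terminal S (chain_end T2)],
      [/\ maxchain S T3, head h T3 = h, T1 <> T2, T1 <> T3 & T2 <> T3] &
      [/\ 0 <= t1, 0 <= t2, 0 <= t3 &
          [/\ (size T1)%:Z = t1 + 2, (size T2)%:Z = t2 + 2 & (size T3)%:Z = t3 + 2]]].

Definition hexset (s : seq cell) : {fset cell} := [fset c in s].

Definition H1T (S : {fset cell}) (h : cell) (T1 T2 T3 : seq cell) : {fset cell} :=
  S `\` ((hexset T1 `|` hexset T2) `\ h).
Definition H2T (S : {fset cell}) (T1 T2 T3 : seq cell) : {fset cell} :=
  S `\` (hexset T1 `|` hexset T2).
Definition H3T (S : {fset cell}) (T1 T2 T3 : seq cell) : {fset cell} :=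
  S `\` (hexset T1 `|` hexset T2 `|` hexset T3).

(* Vertical edges of a chain s (of length >= 2) in its hexagon c: the edges of *)
(* c crossed by the line through the centers, i.e. those between c and c +- d, *)
(* d the step of the chain.                                                    *)
Definition chain_step (s : seq cell) : cell := subc (nth c0 s 1) (nth c0 s 0).
Definition vertical_edges (s : seq cell) (c : cell) : {fset {fset cell}} :=
  [fset [fset c; addc c (chain_step s)]; [fset c; subc c (chain_step s)]].

Definition u_shared (S : {fset cell}) (T3 : seq cell) (u : {fset cell}) (K' : cell) : Prop :=
  let K := chain_end T3 in
  let prev := nth c0 T3 (size T3 - 2) in
  exists v, [/\ v \in vertical_edges T3 K, v \in hexedges K, prev \notin v,
    [/\ u \in hexedges K, u != v &
        has (fun t => (u `<=` t) && (v `<=` t)) (hexverts K)] &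
    [/\ K' \in S, K' != K & u \in hexedges K']].

Definition is_H4 (S : {fset cell}) (T1 T2 T3 : seq cell) (H4 : {fset cell}) : Prop :=
  let K := chain_end T3 in
  exists Ls : seq (seq cell),
    [/\ (forall l, l \in Ls -> exists u K',
            [/\ u_shared S T3 u K', maxchain S l, K \in l & K' \in l]),
        (forall u K', u_shared S T3 u K' ->
            exists2 l, l \in Ls & [/\ maxchain S l, K \in l & K' \in l]) &
        H4 = H3T S T1 T2 T3 `\` \bigcup_(l <- Ls) hexset l].

(* Main.v *)
(* An anti-forcing set of a perfect matching M is a set meeting M' \ M for every *)
(* other perfect matching M', so af(H, M) is a transversal number [tau] which   *)
(* depends only on the family of all perfect matchings. In a catacondensed      *)
(* system without holes the three alternate edges of a non-linear hexagon that  *)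
(* face no neighbor are all in a perfect matching or all outside. Attaching such a *)
(* hexagon thus changes the family of perfect matchings by an explicit operation, *)
(* [flip], whose effect on [tau] is computed directly. Along a linear tail a    *)
(* matching is determined by its unique vertical edge, and each of the two      *)
(* directions in which that edge can be moved costs one anti-forcing edge,      *)
(* independently of the rest. At the branched hexagon h there is one further    *)
(* kind of matching, the [star], using the three edges of h which face no       *)
(* neighbor; its anti-forcing number depends on whether the matching can be     *)
(* changed along T3 without changing H3, which is the case iff t3 >= 1.         *)
Require Import Defs.
From HB Require Import structures.
From mathcomp Require Import all_boot all_order all_algebra.
From mathcomp Require Import finmap.
From mathcomp Require Import zify ring.
Set Implicit Arguments. Unset Strict Implicit. Unset Printing Implicit Defensive.
Import Order.TTheory GRing.Theory Num.Theory.
Local Open Scope fset_scope.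
Local Open Scope ring_scope.

(** * Transversal numbers of set families *)

(** An anti-forcing set of [M] is a transversal of the differences M' \ M, where M' runs over the
    other perfect matchings. So [Af S] depends only on the set family [pms S] ([af_tau],
    [Af_afsum]), and the counting can be done for abstract antichains.

    Geometry enters through [pms_flip]. Let the hexagon K have neighbours only across edges of one
    parity. A height function attached to a matching vanishes outside the system, and this forces
    the three edges of K of the other parity to be all in the matching or all outside it
    ([odds_all_or_none]). Hence the matchings of S are obtained from those of S without K by one
    explicit operation, [flip], even when K joins several pieces.

    Under a flip, a member that can be switched costs one more edge ([tau_flip0]). Its switched copy
    costs one more than in the subfamily of switchable members ([tau_flip1]). A member that cannot
    be switched keeps its cost as soon as the gluing edge has a twin ([tau_flip0_twin]). Summing,
    every hexagon of a straight row after the first adds the same amount, X^2 times the sum of the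
    members using the first gluing edge ([afsum_ladder]).

    For a tail, take the family of H2 as base. Attaching h gives H1. The members that use the edges
    glued to h are forced along T3, so they contribute the polynomial of H3 ([Af_chain]). One row
    attached to h then yields formula (1) ([afsum_single_tail]). Two rows yield every term of (2)
    except the contribution of the star matchings ([afsum_two_steps], [afsum_double_tail]).

    If t3 >= 1, a star can be changed inside T3 near h independently of everything else and costs
    two more than in the forced family, giving X^2 Af(H3) ([tau_star_far]). If t3 = 0, it costs one
    more than its base matching of H2 ([tau_star_near]). The base matchings are those of H2 avoiding
    the far edge of K; those using that edge are forced along L_1 and L_2, whence X Af(H2) - X^2
    Af(H4). The remaining work turns maximal linear chains into walks in a fixed lattice direction
    ([maxchain_walk], [branch_of_chain], [H4_eq]). *)

Lemma bigminn_le (I : eqType) (r : seq I) (p : pred I) (f : I -> nat) d i :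
  i \in r -> p i -> (\big[minn/d]_(j <- r | p j) f j <= f i)%N.
Proof.
elim: r => // j r IH; rewrite inE big_cons => /orP[/eqP<- ->|ir pi].
  exact: geq_minl.
by case: (p j); rewrite ?geq_min ?IH ?orbT.
Qed.

(** The bound [f i <= d] makes the default harmless: if the minimum equals [d], then [i] itself
    attains it. *)
Lemma bigminn_witness (I : eqType) (r : seq I) (p : pred I) (f : I -> nat) d i :
    i \in r -> p i -> (f i <= d)%N ->
  exists2 j, (j \in r) && p j & \big[minn/d]_(j <- r | p j) f j = f j.
Proof.
move=> ir pi fi.
have [E|[j jr E]] : \big[minn/d]_(j <- r | p j) f j = d \/
    exists2 j, (j \in r) && p j & \big[minn/d]_(j <- r | p j) f j = f j.
- elim: {i ir pi fi}r => [|j r IH]; first by left; rewrite big_nil.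
  have keep : (exists2 k, (k \in r) && p k & \big[minn/d]_(j <- r | p j) f j = f k) ->
      exists2 k, (k \in j :: r) && p k & \big[minn/d]_(j <- r | p j) f j = f k.
    by case=> k /andP[kr pk] E; exists k; rewrite // inE kr orbT.
  rewrite big_cons; case pj: (p j); last by case: IH => [|/keep]; [left|right].
  case: (leqP (f j) (\big[minn/d]_(j <- r | p j) f j)) => _.
    by right; exists j; rewrite // inE eqxx.
  by case: IH => [|/keep]; [left|right].
- exists i; first by rewrite ir.
  apply/eqP; rewrite eqn_leq E fi andbT -E; exact: bigminn_le.
- by exists j.
Qed.

Section Families.
Variable T : choiceType.
Implicit Types (F G : {fset {fset T}}) (M N A Q U O : {fset T}) (e f g x : T).

(** [A] is a transversal of the differences M' \ M. Elements of [A] lying in [M] are allowed and do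
    nothing, which spares a side condition whenever edges are added or exchanged. *)
Definition hits F M A : Prop :=
  forall M', M' \in F -> M' != M -> exists2 e, e \in A & (e \in M') && (e \notin M).

Definition hitsb F M A : bool :=
  all (fun M' => (M' != M) ==> has (fun e => (e \in M') && (e \notin M)) A) F.

Lemma hitsP F M A : reflect (hits F M A) (hitsb F M A).
Proof.
apply: (iffP allP) => H M' M'F.
  by move=> nM; move: (H _ M'F); rewrite nM => /hasP.
by apply/implyP => nM; apply/hasP; exact: H.
Qed.

Definition support F : {fset T} := \bigcup_(M <- F) M.

Lemma in_support F M e : M \in F -> e \in M -> e \in support F.
Proof. by move=> MF eM; apply/bigfcupP; exists M; rewrite ?MF. Qed.

Definition tau F M : nat :=
  \big[minn/#|` support F|]_(A <- fpowerset (support F) | hitsb F M A) #|` A|.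

(** In an antichain every difference M' \ M is nonempty, so the support is a transversal and the
    default value in [tau] is a genuine bound. *)
Definition clutter F := forall M N, M \in F -> N \in F -> M `<=` N -> M = N.

Lemma tau_le F M A : hits F M A -> (tau F M <= #|` A|)%N.
Proof.
move=> hA; have hA' : hits F M (A `&` support F).
  move=> M' M'F nM; have [e eA /andP[eM' eM]] := hA M' M'F nM.
  by exists e; rewrite ?inE ?eA ?eM' //= (in_support M'F eM').
apply: leq_trans (fsubset_leq_card (fsubsetIl A (support F))).
by apply: bigminn_le; [rewrite fpowersetE fsubsetIr | apply/hitsP].
Qed.

Lemma tau_ex F M : clutter F -> M \in F -> exists2 A, hits F M A & #|` A| = tau F M.
Proof.
move=> cF MF; have hs : hits F M (support F).
  move=> M' M'F nM; have /fsubsetPn[e eM' eM] : ~~ (M' `<=` M).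
    by apply: contraNN nM => /(cF _ _ M'F MF)->.
  by exists e; rewrite ?eM' //; apply: in_support eM'.
have [|A /andP[_ /hitsP hA] E] := @bigminn_witness _ (fpowerset (support F))
   (hitsb F M) (fun A => #|` A|) #|` support F| (support F) _ (introT (hitsP _ _ _) hs) (leqnn _).
  by rewrite fpowersetE.
by exists A.
Qed.

Lemma tau_eq F M n : (exists2 A, hits F M A & (#|` A| <= n)%N) ->
  (forall A, hits F M A -> (n <= #|` A|)%N) -> clutter F -> M \in F -> tau F M = n.
Proof.
move=> [A hA An] low cF MF; apply/eqP; rewrite eqn_leq (leq_trans (tau_le hA)) //.
by have [B hB <-] := tau_ex cF MF; apply: low.
Qed.

Definition afsum F : {poly int} := \sum_(M <- F) 'X^(tau F M).

Definition restr F Q := [fset N in F | Q `<=` N].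

Lemma in_restr F Q N : (N \in restr F Q) = (N \in F) && (Q `<=` N).
Proof. by rewrite !inE. Qed.

Lemma clutter_sub F G : G `<=` F -> clutter F -> clutter G.
Proof. by move=> /fsubsetP GF cF M N /GF MF /GF NF; apply: cF. Qed.

Lemma restr_sub F Q : restr F Q `<=` F.
Proof. by apply/fsubsetP => N; rewrite in_restr => /andP[]. Qed.

Lemma clutter_restr F Q : clutter F -> clutter (restr F Q).
Proof. exact/clutter_sub/restr_sub. Qed.

Lemma restr0 F : restr F fset0 = F.
Proof. by apply/fsetP => N; rewrite in_restr fsub0set andbT. Qed.

Lemma restrU F Q U : restr F (Q `|` U) = restr (restr F Q) U.
Proof. by apply/fsetP => N; rewrite !in_restr fsubUset andbA. Qed.

(* Perfect matchings after gluing a hexagon along the edges [Q]: either none of *)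
(* the edges [O] of the hexagon is used, hence all its other new edges [U]      *)
(* are, or all of [O] is used and the edges [Q] have to be given up.            *)
Definition flip F Q U O : {fset {fset T}} :=
  [fset N `|` U | N in F] `|` [fset (N `\` Q) `|` O | N in restr F Q].

Lemma flipP F Q U O M : reflect
  ((exists2 N, N \in F & M = N `|` U) \/
   (exists2 N, (N \in F) && (Q `<=` N) & M = (N `\` Q) `|` O))
  (M \in flip F Q U O).
Proof.
apply: (iffP (fsetUP _ _ _)) => -[] => [/imfsetP[N NF ->]|/imfsetP[N NF ->]|[N NF ->]|[N NF ->]].
- by left; exists N.
- by right; exists N; rewrite // -in_restr.
- by left; apply/imfsetP; exists N.
- by right; apply/imfsetP; exists N; rewrite //= in_restr.
Qed.

Lemma flip0 F Q U O N : N \in F -> N `|` U \in flip F Q U O.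
Proof. by move=> NF; apply/flipP; left; exists N. Qed.

Lemma flip1 F Q U O N : N \in F -> Q `<=` N -> (N `\` Q) `|` O \in flip F Q U O.
Proof. by move=> NF QN; apply/flipP; right; exists N; rewrite ?NF. Qed.

(** [U] and [O] consist of new edges. They are nonempty so that switched and unswitched members can
    be told apart by an edge in both directions, which keeps the flip an antichain. *)
Definition fresh F Q U O : Prop :=
  [/\ clutter F, forall N e, N \in F -> e \in N -> (e \notin U) && (e \notin O),
      forall e, e \in U -> e \notin O,
      forall e, e \in Q -> (e \notin U) && (e \notin O) & U != fset0 /\ O != fset0].

Section Flip.
Variables (F : {fset {fset T}}) (Q U O : {fset T}).
Hypothesis fr : fresh F Q U O.
Let G := flip F Q U O.

Let cF : clutter F. Proof. by case: fr. Qed.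
Let NU N e : N \in F -> e \in N -> (e \in U) = false.
Proof. by case: fr => _ H _ _ _ NF /(H _ _ NF)/andP[/negbTE]. Qed.
Let NO N e : N \in F -> e \in N -> (e \in O) = false.
Proof. by case: fr => _ H _ _ _ NF /(H _ _ NF)/andP[_ /negbTE]. Qed.
Let UO e : e \in U -> (e \in O) = false.
Proof. by case: fr => _ _ H _ _ /H/negbTE. Qed.

Lemma flip0_inj N N' : N \in F -> N' \in F -> N `|` U = N' `|` U -> N = N'.
Proof.
move=> NF N'F /fsetP E; apply: cF => //; apply/fsubsetP => e eN.
by have := E e; rewrite !inE eN (NU NF eN) /= orbF => /esym.
Qed.

Lemma flip1_inj N N' : N \in F -> N' \in F -> Q `<=` N -> Q `<=` N' ->
  (N `\` Q) `|` O = (N' `\` Q) `|` O -> N = N'.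
Proof.
move=> NF N'F QN QN' /fsetP E; apply: cF => //; apply/fsubsetP => e eN.
have := E e; rewrite !inE eN (NO NF eN) !orbF /=.
by case: (boolP (e \in Q)) => [/(fsubsetP QN')//|_ /= <-].
Qed.

Lemma flip_neq N N' : N \in F -> N `|` U != (N' `\` Q) `|` O.
Proof.
move=> NF; case: fr => _ _ _ _ [_ /fset0Pn[o oO]]; apply/eqP => /fsetP/(_ o).
rewrite !inE oO orbT => /orP[oN|oU]; first by have := NO NF oN; rewrite oO.
by have := UO oU; rewrite oO.
Qed.

Lemma flip_clutter : clutter G.
Proof.
case: fr => _ _ _ _ [/fset0Pn[u uU] /fset0Pn[o oO]].
move=> M M' /flipP[[N NF ->]|[N /andP[NF QN] ->]];
  move=> /flipP[[N' N'F ->]|[N' /andP[N'F QN'] ->]] /fsubsetP sub.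
- congr (_ `|` _); apply: cF => //; apply/fsubsetP => e eN.
  by have := sub e; rewrite !inE eN (NU NF eN) !orbF => /(_ isT).
- have := sub u; rewrite !inE uU (UO uU) orbT orbF => /(_ isT)/andP[_ uN'].
  by have := NU N'F uN'; rewrite uU.
- have := sub o; rewrite !inE oO orbT => /(_ isT)/orP[oN|oU].
    by have := NO N'F oN; rewrite oO.
  by have := UO oU; rewrite oO.
- congr (_ `\` _ `|` _); apply: cF => //; apply/fsubsetP => e eN.
  have := sub e; rewrite !inE eN (NO NF eN) !orbF andbT.
  by case: (boolP (e \in Q)) => [/(fsubsetP QN')//|_ /(_ isT)].
Qed.

(** One edge of [O] hits all switched members at once. Conversely the switched copy of [N] itself
    can only be hit by an edge of [O], and such an edge is useless among the members of [F]. *)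
Lemma tau_flip0 N : N \in F -> Q `<=` N -> tau G (N `|` U) = (tau F N).+1.
Proof.
move=> NF QN; apply: tau_eq; [|move=> A hA|exact: flip_clutter|exact: flip0].
- case: fr => _ _ _ _ [_ /fset0Pn[o oO]]; have [A hA <-] := tau_ex cF NF.
  exists (o |` A); last by rewrite cardfsU1; case: (o \in A).
  move=> M' /flipP[[N' N'F ->]|[N' /andP[N'F QN'] ->]] nM.
    have [|e eA /andP[eN' eN]] := hA _ N'F; first by apply: contraNN nM => /eqP->.
    by exists e; rewrite !inE ?eA ?orbT // eN' (negbTE eN) (NU N'F eN').
  exists o; rewrite !inE ?eqxx // oO orbT /=; apply/negP => /orP[oN|oU].
    by have := NO NF oN; rewrite oO.
  by have := UO oU; rewrite oO.
- have [|o oA /andP[]] := hA _ (flip1 U O NF QN); first by rewrite eq_sym flip_neq.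
  rewrite !inE => oM; rewrite negb_or => /andP[oN _]; rewrite (negbTE oN) andbF /= in oM.
  have /tau_le : hits F N (A `\ o).
    move=> N' N'F nN; have [|e eA] := hA _ (flip0 Q U O N'F).
      by apply: contraNN nN => /eqP/(flip0_inj N'F NF)->.
    rewrite !inE negb_or => /andP[/orP[eN' /andP[eN _]|->]]; last by rewrite andbF.
    exists e; rewrite ?eN' ?eN // !inE eA andbT; apply: contraTneq oM => <-.
    by rewrite (NO N'F eN').
  by rewrite (cardfsD1 o A) oA.
Qed.

(** One edge of [U] hits all unswitched members, and the others come from [restr F Q]. Conversely
    the unswitched copy of [N] can only be hit in [Q] or [U]. Edges of [Q] lie in all members of
    [restr F Q] and edges of [U] in none, so neither helps there. *)
Lemma tau_flip1 N : N \in F -> Q `<=` N ->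
  tau G (N `\` Q `|` O) = (tau (restr F Q) N).+1.
Proof.
move=> NF QN; apply: tau_eq; [|move=> A hA|exact: flip_clutter|exact: flip1].
- case: fr => _ _ _ _ [/fset0Pn[u uU] _].
  have [|A hA <-] := tau_ex (clutter_restr (Q := Q) cF) (M := N); first by rewrite in_restr NF.
  exists (u |` A); last by rewrite cardfsU1; case: (u \in A).
  move=> M' /flipP[[N' N'F ->]|[N' /andP[N'F QN'] ->]] nM.
    exists u; rewrite !inE ?eqxx // uU orbT (UO uU) orbF /=.
    by apply/negP => /andP[_ uN]; have := NU NF uN; rewrite uU.
  have [||e eA /andP[eN' eN]] := hA N'; first by rewrite in_restr N'F.
    by apply: contraNN nM => /eqP->.
  exists e; rewrite !inE ?eA ?orbT // eN' (negbTE eN) (NO N'F eN') andbF !orbF !andbT.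
  by apply: contraNN eN; apply: (fsubsetP QN).
- have [|o oA /andP[]] := hA _ (flip0 Q U O NF); first exact: flip_neq.
  rewrite !inE => oM; rewrite negb_or => /andP[oN _].
  have oQU : (o \in Q) || (o \in U).
    by case/orP: oM oN => [->|->]; rewrite ?andbT ?negbK ?orbT // => ->.
  have /tau_le : hits (restr F Q) N (A `\ o).
    move=> N'; rewrite in_restr => /andP[N'F QN'] nN; have [|e eA] := hA _ (flip1 U O N'F QN').
      by apply: contraNN nN => /eqP/(flip1_inj N'F NF QN' QN)->.
    rewrite !inE negb_or => /andP[/orP[/andP[eQ eN'] /andP[eN _]|->]]; last by rewrite andbF.
    rewrite eQ /= in eN.
    exists e; rewrite ?eN' ?eN // !inE eA andbT; apply: contraTneq oQU => <-.
    by rewrite (negbTE eQ) (NU N'F eN').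
  by rewrite (cardfsD1 o A) oA.
Qed.

(* An edge [g] occurring in the same members as the single switched edge [f]    *)
(* can replace it in a hitting set, and survives in the switched members.      *)
Lemma tau_flip0_twin N f g : Q = [fset f] -> N \in F -> f \notin N -> g != f ->
  (forall N', N' \in F -> (g \in N') = (f \in N')) -> tau G (N `|` U) = tau F N.
Proof.
move=> EQ NF fN gf twin; apply: tau_eq; [|move=> A hA|exact: flip_clutter|exact: flip0].
- have [A hA cA] := tau_ex cF NF.
  exists ([fset (if e == f then g else e) | e in A]); last first.
    by rewrite -cA; exact: leq_imfset_card.
  have key N' : N' \in F -> N' != N ->
      exists2 e, e \in [fset (if e == f then g else e) | e in A] &
        [&& e \in N', e \notin N & e != f].
    move=> N'F nN; have [e eA /andP[eN' eN]] := hA _ N'F nN.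
    exists (if e == f then g else e); first by apply/imfsetP; exists e.
    case: eqP => [ef|/eqP ef]; last by rewrite eN' eN.
    by rewrite (twin _ N'F) (twin _ NF) -ef eN' eN ef.
  move=> M' /flipP[[N' N'F ->]|[N' /andP[N'F QN'] ->]] nM.
    have [|e eA /and3P[eN' eN _]] := key _ N'F; first by apply: contraNN nM => /eqP->.
    by exists e; rewrite // !inE eN' (negbTE eN) (NU N'F eN').
  have [|e eA /and3P[eN' eN ef]] := key _ N'F.
    by apply: contraNN fN => /eqP<-; apply: (fsubsetP QN'); rewrite EQ inE.
  by exists e; rewrite // !inE eN' (negbTE eN) (NU N'F eN') EQ inE ef.
- apply: tau_le => N' N'F nN; have [|e eA] := hA _ (flip0 Q U O N'F).
    by apply: contraNN nN => /eqP/(flip0_inj N'F NF)->.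
  rewrite !inE negb_or => /andP[/orP[eN' /andP[eN _]|->]]; last by rewrite andbF.
  by exists e; rewrite ?eN' ?eN.
Qed.

End Flip.

(** [tau] sees only differences of members, so a map that preserves these preserves [tau]. *)
Lemma tau_image (phi : {fset T} -> {fset T}) F : clutter F ->
    (forall N N' e, N \in F -> N' \in F ->
      (e \in phi N') && (e \notin phi N) = (e \in N') && (e \notin N)) ->
  [/\ clutter (phi @` F), {in F &, injective phi} &
      forall N, N \in F -> tau (phi @` F) (phi N) = tau F N].
Proof.
move=> cF diff.
have mono N N' : N \in F -> N' \in F -> phi N `<=` phi N' -> N = N'.
  move=> NF N'F /fsubsetP sub; apply: cF => //; apply/fsubsetP => e eN.
  apply: contraT => eN'; have := diff _ _ e N'F NF; rewrite eN eN' => /andP[/sub->].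
  by [].
have inj : {in F &, injective phi}.
  by move=> N N' NF N'F E; apply: mono => //; rewrite E fsubset_refl.
have cG : clutter (phi @` F).
  move=> ? ? /imfsetP[N NF ->] /imfsetP[N' N'F ->] sub; congr phi; exact: mono.
split=> // N NF; apply: tau_eq; [|move=> A hA|by []|by apply/imfsetP; exists N].
- have [A hA cA] := tau_ex cF NF; exists A; last by rewrite cA.
  move=> ? /imfsetP[N' N'F ->] nN; have [|e eA E] := hA _ N'F.
    by apply: contraNN nN => /eqP->.
  by exists e; rewrite // diff.
- apply: tau_le => N' N'F nN; have [||e eA] := hA (phi N'); first by apply/imfsetP; exists N'.
    by apply: contraNN nN => /eqP/(inj _ _ N'F NF)->.
  by rewrite diff //; exists e.
Qed.

Lemma afsum_image (phi : {fset T} -> {fset T}) F : clutter F ->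
    (forall N N' e, N \in F -> N' \in F ->
      (e \in phi N') && (e \notin phi N) = (e \in N') && (e \notin N)) ->
  afsum (phi @` F) = afsum F.
Proof.
move=> cF diff; have [_ inj tauE] := tau_image cF diff.
by rewrite /afsum big_imfset //=; apply: eq_big_seq => N NF; rewrite tauE.
Qed.

Lemma afsum_translate F W : clutter F -> (forall N e, N \in F -> e \in N -> e \notin W) ->
  afsum [fset N `|` W | N in F] = afsum F.
Proof.
move=> cF dis; apply: afsum_image => // N N' e NF N'F; rewrite !inE.
case: (boolP (e \in N')) => [/(dis _ _ N'F)/negbTE->|_] /=; first by rewrite orbF.
by case: (e \in W); rewrite ?orbT ?andbF.
Qed.

(** * Generating sums under a flip *)

Section FlipSum.
Variables (F : {fset {fset T}}) (Q U O : {fset T}).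
Hypothesis fr : fresh F Q U O.
Let G := flip F Q U O.

Lemma sum_flip (w : {fset T} -> {poly int}) :
  \sum_(M <- G) w M =
  \sum_(N <- F) w (N `|` U) + \sum_(N <- restr F Q) w (N `\` Q `|` O).
Proof.
rewrite (perm_big ([seq N `|` U | N <- F] ++ [seq N `\` Q `|` O | N <- restr F Q])).
  by rewrite big_cat !big_map.
apply: uniq_perm; first exact: fset_uniq.
- rewrite cat_uniq; apply/and3P; split.
  + by rewrite map_inj_in_uniq ?fset_uniq // => N N'; apply: flip0_inj fr _ _.
  + apply/hasPn => ? /mapP[N' N'F ->]; apply/mapP => -[N NF E].
    by move: (flip_neq fr N' NF); rewrite E eqxx.
  + rewrite map_inj_in_uniq ?fset_uniq // => N N'; rewrite !in_restr.
    by move=> /andP[NF QN] /andP[N'F QN']; apply: (flip1_inj fr).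
- move=> M; rewrite mem_cat; apply/flipP/orP => -[].
  + by case=> N NF ->; left; apply/mapP; exists N.
  + by case=> N NF ->; right; apply/mapP; exists N; rewrite ?in_restr.
  + by case/mapP=> N NF ->; left; exists N.
  + by case/mapP=> N; rewrite in_restr => NF ->; right; exists N.
Qed.

Lemma sum_flip1 :
  \sum_(N <- restr F Q) 'X^(tau G (N `\` Q `|` O)) = 'X * afsum (restr F Q) :> {poly int}.
Proof.
rewrite /afsum big_distrr; apply: eq_big_seq => N; rewrite in_restr => /andP[NF QN].
by rewrite (tau_flip1 fr) // exprS.
Qed.

Lemma afsum_flip : afsum G =
  \sum_(N <- F | ~~ (Q `<=` N)) 'X^(tau G (N `|` U))
  + 'X * \sum_(N <- F | Q `<=` N) 'X^(tau F N) + 'X * afsum (restr F Q).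
Proof.
rewrite {1}/afsum sum_flip sum_flip1 (bigID [pred N : {fset T} | Q `<=` N]) /=.
congr (_ + _); rewrite addrC; congr (_ + _); rewrite big_distrr.
rewrite big_seq_cond [RHS]big_seq_cond; apply: eq_bigr => N /andP[NF QN].
by rewrite (tau_flip0 fr) // exprS.
Qed.

Lemma afsum_flip_all : (forall N, N \in F -> Q `<=` N) -> afsum G = 2 * 'X * afsum F.
Proof.
move=> all; rewrite afsum_flip big_seq_cond big_pred0 ?add0r; last first.
  by move=> N; case NF: (N \in F) => //=; rewrite all.
have -> : restr F Q = F.
  by apply/fsetP => N; rewrite in_restr; case NF: (N \in F) => //=; rewrite all.
suff -> : \sum_(N <- F | Q `<=` N) 'X^(tau F N) = afsum F by ring.
rewrite /afsum big_seq_cond [RHS]big_seq; apply: eq_bigl => N.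
by case NF: (N \in F) => //=; rewrite all.
Qed.

(** Only members through [f] become dearer, by one edge, which explains the factor 'X - 1; the last
    term collects the switched copies. *)
Lemma afsum_flip_twin f g : Q = [fset f] -> g != f ->
    (forall N', N' \in F -> (g \in N') = (f \in N')) ->
  afsum G = afsum F + ('X - 1) * \sum_(N <- F | f \in N) 'X^(tau F N)
            + 'X * afsum (restr F [fset f]).
Proof.
move=> EQ gf twin; rewrite afsum_flip EQ.
have -> : \sum_(N <- F | ~~ ([fset f] `<=` N)) 'X^(tau G (N `|` U)) =
          \sum_(N <- F | f \notin N) 'X^(tau F N) :> {poly int}.
  rewrite big_seq_cond [RHS]big_seq_cond; apply: eq_big => N; first by rewrite fsub1set.
  by rewrite fsub1set => /andP[NF fN]; rewrite (tau_flip0_twin fr EQ NF fN gf).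
have -> : \sum_(N <- F | [fset f] `<=` N) 'X^(tau F N) =
          \sum_(N <- F | f \in N) 'X^(tau F N) :> {poly int}.
  by apply: eq_bigl => N; rewrite fsub1set.
have -> : afsum F = \sum_(N <- F | f \in N) 'X^(tau F N) +
          \sum_(N <- F | f \notin N) 'X^(tau F N) by rewrite /afsum (bigID [pred N : {fset T} | f \in N]).
ring.
Qed.

Lemma restr_flip_odd o : o \in O ->
  restr G [fset o] = [fset N `\` Q `|` O | N in restr F Q].
Proof.
move=> oO; have [_ NUO UO _ _] := fr.
apply/fsetP => M; rewrite in_restr fsub1set; apply/andP/imfsetP => /=.
- case=> /flipP[[N NF ->]|[N NF ->] _]; last by exists N; rewrite // in_restr.
  rewrite inE => /orP[/(NUO _ _ NF)/andP[_]|/UO]; by rewrite oO.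
- case=> N; rewrite in_restr => /andP[NF QN] ->; split; first exact: flip1.
  by rewrite inE oO orbT.
Qed.

Lemma restr_flip_even u : u \in U -> restr G [fset u] = [fset N `|` U | N in F].
Proof.
move=> uU; have [_ NUO UO _ _] := fr.
apply/fsetP => M; rewrite in_restr fsub1set; apply/andP/imfsetP => /=.
- case=> /flipP[[N NF ->] _|[N /andP[NF _] ->]]; first by exists N.
  by rewrite !inE (negbTE (UO _ uU)) orbF => /andP[_ /(NUO _ _ NF)]; rewrite uU.
- by case=> N NF ->; split; [exact: flip0 | rewrite inE uU orbT].
Qed.

(** Prescribing one edge of [O] forces the switch, and switched members have the same differences as
    the members of [restr F Q] they come from. *)
Lemma afsum_flip_odd o : o \in O -> afsum (restr G [fset o]) = afsum (restr F Q).
Proof.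
move=> oO; rewrite restr_flip_odd //; have [cF NUO UO QUO _] := fr.
apply: afsum_image; first exact: clutter_restr.
move=> N N' e; rewrite !in_restr => /andP[NF QN] /andP[N'F QN']; rewrite !inE.
have [eQ|eQ] /= := boolP (e \in Q).
  by rewrite (fsubsetP QN _ eQ) andbF; case: (e \in O).
case: (boolP (e \in N')) => [/(NUO _ _ N'F)/andP[_ /negbTE->]|_] /=; first by rewrite orbF.
by case: (e \in O); rewrite ?orbT ?andbF.
Qed.

Lemma afsum_flip_even u : u \in U -> afsum (restr G [fset u]) = afsum F.
Proof.
move=> uU; rewrite restr_flip_even //; have [cF NUO UO QUO _] := fr.
by apply: afsum_translate => // N e NF /(NUO _ _ NF)/andP[].
Qed.

Lemma flip_even_twin u u' N : u \in U -> u' \in U -> N \in G -> (u \in N) = (u' \in N).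
Proof.
have [_ NUO UO _ _] := fr.
move=> uU uU' /flipP[[M MF ->]|[M /andP[MF _] ->]]; first by rewrite !inE uU uU' !orbT.
rewrite !inE (negbTE (UO _ uU)) (negbTE (UO _ uU')) !orbF.
have aux x : x \in U -> x \in M = false.
  by move=> xU; apply/negP => /(NUO _ _ MF); rewrite xU.
by rewrite !aux ?andbF.
Qed.

Lemma sum_flip_odd o : o \in O ->
  \sum_(M <- G | o \in M) 'X^(tau G M) = 'X * afsum (restr F Q) :> {poly int}.
Proof.
move=> oO; rewrite -sum_flip1.
transitivity (\sum_(M <- restr G [fset o]) 'X^(tau G M) : {poly int}).
  rewrite -big_filter; apply: perm_big; apply: uniq_perm; rewrite ?filter_uniq ?fset_uniq //.
  by move=> M; rewrite mem_filter in_restr fsub1set andbC.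
rewrite restr_flip_odd // big_imfset //= => N N'; rewrite !in_restr.
by move=> /andP[NF QN] /andP[N'F QN']; apply: (flip1_inj fr).
Qed.

Lemma restr_flip_other e : e \notin Q -> e \notin U -> e \notin O ->
  restr G [fset e] = flip (restr F [fset e]) Q U O.
Proof.
move=> eQ eU eO; apply/fsetP => M; rewrite in_restr fsub1set.
apply/andP/flipP => [[/flipP[[N NF ->]|[N /andP[NF QN] ->]]]|[[N + ->]|[N + ->]]].
- by rewrite !inE (negbTE eU) orbF => eN; left; exists N; rewrite // in_restr NF fsub1set.
- rewrite !inE (negbTE eO) orbF => /andP[_ eN]; right; exists N => //.
  by rewrite QN in_restr NF fsub1set eN.
- rewrite in_restr fsub1set => /andP[NF eN]; split; first exact: flip0.
  by rewrite inE eN.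
- rewrite in_restr fsub1set => /andP[/andP[NF eN] QN]; split; first exact: flip1.
  by rewrite !inE eN eQ.
Qed.

Lemma fresh_restr e : fresh (restr F [fset e]) Q U O.
Proof.
have [cF NUO UO QUO ne] := fr; split=> //; first exact: clutter_restr.
by move=> N e'; rewrite in_restr => /andP[/NUO + _]; apply.
Qed.

End FlipSum.

(** * Straight rows of hexagons *)

(* [ladder F e m G]: [G] arises from [F] by appending, one after the other, [m] *)
(* hexagons in a straight line across the edge [e].                            *)
Inductive ladder : {fset {fset T}} -> T -> nat -> {fset {fset T}} -> Prop :=
| Ladder0 F e : ladder F e 0 F
| LadderS F e U O e' g m G : fresh F [fset e] U O -> e' \in O -> g \in O -> g != e' ->
    ladder (flip F [fset e] U O) e' m G -> ladder F e m.+1 G.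

(** With R = [afsum (restr F [fset e])], the members of [G] through [e'] sum to X R, while [restr G
    [fset e']] taken as a family of its own sums to R. So the increment in [afsum_flip_twin] is (X -
    1) X R + X R = X^2 R. *)
Lemma afsum_flip_twice F e U O e' g U' O' :
    fresh F [fset e] U O -> e' \in O -> g \in O -> g != e' ->
    let G := flip F [fset e] U O in fresh G [fset e'] U' O' ->
  afsum (flip G [fset e'] U' O') = afsum G + 'X^2 * afsum (restr F [fset e]).
Proof.
move=> fr eO gO ge G fr'.
rewrite (afsum_flip_twin fr' erefl ge) => [|N].
  by rewrite (sum_flip_odd fr) // (afsum_flip_odd fr) //; ring.
have [_ NUO UO _ _] := fr.
move=> /flipP[[M MF ->]|[M _ ->]]; last by rewrite !inE gO eO !orbT.
rewrite !inE; have aux o : o \in O -> (o \in M) || (o \in U) = false.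
  by move=> oO; apply/negP => /orP[/(NUO _ _ MF)/andP[_]|/UO]; rewrite oO.
by rewrite !aux.
Qed.

(** The increment is constant along the row, because by [afsum_flip_odd] the sum over the restricted
    family is unchanged when passing from [e] to the next gluing edge. *)
Lemma afsum_ladder_step F e U O e' g m G :
    fresh F [fset e] U O -> e' \in O -> g \in O -> g != e' ->
    ladder (flip F [fset e] U O) e' m G ->
  afsum G = afsum (flip F [fset e] U O) + m%:R * 'X^2 * afsum (restr F [fset e]).
Proof.
elim: m F e U O e' g => [|m IH] F e U O e' g fr eO gO ge lad.
  by inversion lad; subst; rewrite mul0r mul0r addr0.
inversion lad as [|F1 e1 U' O' e2 g' m1 G1 fr' eO' gO' ge' lad']; subst.
rewrite (IH _ _ _ _ _ _ fr' eO' gO' ge' lad') (afsum_flip_twice fr eO gO ge fr').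
by rewrite (afsum_flip_odd fr) // -natr1; ring.
Qed.

Lemma afsum_ladder F e m G : ladder F e m.+1 G ->
  exists U O, fresh F [fset e] U O /\
    afsum G = afsum (flip F [fset e] U O) + m%:R * 'X^2 * afsum (restr F [fset e]).
Proof.
move=> lad; inversion lad as [|F1 e1 U O e' g m1 G1 fr eO gO ge lad']; subst.
by exists U, O; split=> //; exact: afsum_ladder_step fr eO gO ge lad'.
Qed.

Lemma afsum0 : afsum fset0 = 0.
Proof. by rewrite /afsum big_seq_fset0. Qed.

Lemma flip_fset0 Q U O : flip fset0 Q U O = fset0.
Proof.
apply/fsetP => M; rewrite inE; apply/negP => /flipP[[N]|[N]]; by rewrite inE.
Qed.

Lemma ladder_fset0 e m G : ladder fset0 e m G -> G = fset0.
Proof.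
elim: m e => [|m IH] e lad; inversion lad; subst => //.
by match goal with H : ladder (flip _ _ _ _) _ _ _ |- _ => rewrite flip_fset0 in H; exact: IH H end.
Qed.

(** The member [N] through [x] serves only to show that [x] is an old edge, hence outside the sets
    [U] and [O] of every later flip. *)
Lemma ladder_restr F e m G x N : ladder F e m G -> N \in F -> x \in N -> x != e ->
  ladder (restr F [fset x]) e m (restr G [fset x]).
Proof.
elim: m F e N => [|m IH] F e N lad NF xN xe; inversion lad as [|F1 e1 U O e' g m1 G1 fr eO gO ge lad'];
  subst; first by left.
have [_ NUO _ _ _] := fr; have /andP[xU xO] := NUO _ _ NF xN.
apply: (LadderS (U := U) (O := O) (e' := e') (g := g)) => //; first exact: fresh_restr.
rewrite -restr_flip_other ?inE //; apply: IH lad' (flip0 _ _ _ NF) _ _; first by rewrite inE xN.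
by apply: contraNneq xO => ->.
Qed.

Lemma afsum_ladder_all F e m G : ladder F e m.+1 G -> (forall N, N \in F -> e \in N) ->
  afsum G = (2 * 'X + m%:R * 'X^2) * afsum F.
Proof.
move=> /afsum_ladder[U [O [fr ->]]] eF.
rewrite (afsum_flip_all fr) => [|N /eF]; last by rewrite fsub1set.
suff -> : restr F [fset e] = F by ring.
apply/fsetP => N; rewrite in_restr fsub1set; by case NF: (N \in F); rewrite //= eF.
Qed.

(** * One row attached to a hexagon *)

Section Tail.
Variables (F : {fset {fset T}}) (Q U1 O1 : {fset T}) (x0 x2 : T).
Hypotheses (fr1 : fresh F Q U1 O1) (x0U : x0 \in U1) (x2U : x2 \in U1) (x02 : x0 != x2).
Let F1 := flip F Q U1 O1.

Let twin N : N \in F1 -> (x0 \in N) = (x2 \in N).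
Proof. exact: (flip_even_twin fr1 x0U x2U). Qed.

Let sum_x0 : \sum_(N <- F1 | x0 \in N) 'X^(tau F1 N) = afsum F1 - 'X * afsum (restr F Q).
Proof.
have [_ NUO UO _ [_ /fset0Pn[o oO]]] := fr1.
rewrite -(sum_flip_odd fr1 oO) {1}/afsum [X in _ = X - _](bigID [pred N : {fset T} | x0 \in N]) /=.
rewrite [X in _ + X - _](_ : _ = \sum_(M <- F1 | o \in M) 'X^(tau F1 M)) ?addrK //.
rewrite big_seq_cond [RHS]big_seq_cond; apply: eq_bigl => M.
case MF: (M \in F1) => //=; move/flipP: MF => [[N NF ->]|[N /andP[NF QN] ->]].
  rewrite !inE x0U orbT /=; apply/esym/negP => /orP[/(NUO _ _ NF)|/UO]; by rewrite oO ?andbF.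
rewrite !inE oO orbT (negbTE (UO _ x0U)) orbF; apply/negP => /andP[_ /(NUO _ _ NF)].
by rewrite x0U.
Qed.

(** [x0] and [x2] are two unglued even edges of the hexagon, hence twins. The members through [x0]
    are exactly the unswitched ones, so their sum is everything minus the switched part. *)
Lemma afsum_single_step U O : fresh F1 [fset x0] U O ->
  afsum (flip F1 [fset x0] U O) =
  'X * afsum F1 + ('X - 'X^2) * afsum (restr F Q) + 'X * afsum F.
Proof.
move=> fr; rewrite (afsum_flip_twin fr (f := x0) (g := x2)) //; last first.
- by move=> N /twin.
- by rewrite eq_sym.
by rewrite sum_x0 (afsum_flip_even fr1) //; ring.
Qed.

Lemma afsum_single_tail m G : ladder F1 x0 m.+1 G ->
  afsum G = 'X * afsum F + 'X * afsum (restr F Q) +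
            ('X * afsum F1 + m%:R * 'X^2 * afsum F - 'X^2 * afsum (restr F Q)).
Proof.
move=> /afsum_ladder[U [O [fr ->]]]; rewrite afsum_single_step //.
by rewrite (afsum_flip_even fr1) //; ring.
Qed.

(** Prescribing [x2] also prescribes its twin [x0], the edge at which the row starts, so every base
    member can be switched into the row. *)
Lemma afsum_ladder_side m G : ladder F1 x0 m.+1 G ->
  afsum (restr G [fset x2]) = (2 * 'X + m%:R * 'X^2) * afsum F.
Proof.
(* [ladder_restr] asks for a member through [x2], so the empty family is treated apart. *)
move=> lad; have [F0|[N NF]] := fset_0Vmem F.
  have G0 : G = fset0.
    by move: lad; rewrite /F1 [X in flip X]F0 flip_fset0; exact: ladder_fset0.
  rewrite (_ : restr G _ = fset0) ?F0 ?afsum0 ?mulr0 //.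
  by apply/fsetP => M; rewrite in_restr G0 inE.
have x2N : x2 \in N `|` U1 by rewrite inE x2U orbT.
rewrite (afsum_ladder_all (ladder_restr lad (flip0 _ _ _ NF) x2N _)) 1?eq_sym //.
  by rewrite (afsum_flip_even fr1).
by move=> M; rewrite in_restr fsub1set => /andP[/twin->].
Qed.

End Tail.

(** * Two rows attached to a branched hexagon *)

Section TwoTails.
Variables (F : {fset {fset T}}) (U1 O1 U2 O2 U3 O3 : {fset T}) (x0 x2 x4 : T).
Hypotheses (fr1 : fresh F [fset x4] U1 O1).
Hypotheses (x0U : x0 \in U1) (x2U : x2 \in U1) (x02 : x0 != x2).
Let F1 := flip F [fset x4] U1 O1.
Hypothesis fr3 : fresh F1 [fset x2] U3 O3.
Let V := flip F1 [fset x2] U3 O3.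
Hypothesis fr2 : fresh V [fset x0] U2 O2.
Let W := flip V [fset x0] U2 O2.

(* The matchings using the three edges [O1] of the branched hexagon which face  *)
(* none of its neighbors. *)
Definition star N := (N `\` [fset x4] `|` O1) `|` U3 `|` U2.

Section Star.
Variable N : {fset T}.
Hypotheses (NF : N \in F) (x4N : x4 \in N).

Let NF1 : N `|` U1 \in F1. Proof. exact: flip0. Qed.
Let SF1 : N `\` [fset x4] `|` O1 \in F1. Proof. by apply: flip1; rewrite ?fsub1set. Qed.
Let NV : N `|` U1 `|` U3 \in V. Proof. exact: flip0. Qed.
Let SV : N `\` [fset x4] `|` O1 `|` U3 \in V. Proof. exact: flip0. Qed.
Let NV' : (N `|` U1) `\` [fset x2] `|` O3 \in V.
Proof. by apply: flip1; rewrite ?fsub1set // inE x2U orbT. Qed.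

Let F_fresh N' e : N' \in F -> e \in N' ->
  [/\ e \notin U1, e \notin O1 & [/\ e \notin U2, e \notin O2, e \notin U3 & e \notin O3]].
Proof.
move=> N'F eN; have [_ /(_ _ _ N'F eN)/andP[-> ->] _ _ _] := fr1.
have [_ /(_ (N' `|` U1) e (flip0 _ _ _ N'F)) H3 _ _ _] := fr3.
have [_ /(_ (N' `|` U1 `|` U3) e (flip0 _ _ _ (flip0 _ _ _ N'F))) H2 _ _ _] := fr2.
by move: H3 H2; rewrite !inE eN => /(_ isT)/andP[-> ->] /(_ isT)/andP[-> ->].
Qed.

Let U1_fresh e : e \in U1 ->
  [/\ e \notin O1, e \notin U2, e \notin O2, e \notin U3 & e \notin O3].
Proof.
move=> eU; have [_ _ /(_ _ eU)-> _ _] := fr1.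
have [_ /(_ _ e NF1) H3 _ _ _] := fr3; have [_ /(_ _ e NV) H2 _ _ _] := fr2.
by move: H3 H2; rewrite !inE eU orbT => /(_ isT)/andP[-> ->] /(_ isT)/andP[-> ->].
Qed.

Let O1_fresh e : e \in O1 -> [/\ e \notin U2, e \notin O2, e \notin U3 & e \notin O3].
Proof.
move=> eO; have [_ /(_ _ e SF1) H3 _ _ _] := fr3; have [_ /(_ _ e SV) H2 _ _ _] := fr2.
by move: H3 H2; rewrite !inE eO !orbT => /(_ isT)/andP[-> ->] /(_ isT)/andP[-> ->].
Qed.

Let U3_fresh e : e \in U3 -> [/\ e \notin O3, e \notin U2 & e \notin O2].
Proof.
move=> eU; have [_ _ /(_ _ eU)-> _ _] := fr3; have [_ /(_ _ e SV) H2 _ _ _] := fr2.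
by move: H2; rewrite !inE eU !orbT => /(_ isT)/andP[-> ->].
Qed.

Let O3_fresh e : e \in O3 -> [/\ e \notin U2 & e \notin O2].
Proof.
move=> eO; have [_ /(_ _ e NV') H2 _ _ _] := fr2.
by move: H2; rewrite !inE eO !orbT => /(_ isT)/andP[-> ->].
Qed.

Let U2_fresh e : e \in U2 -> e \notin O2.
Proof. by have [_ _ H _ _] := fr2; apply: H. Qed.

Lemma star_in : star N \in W. Proof. exact: flip0. Qed.

(** A member that is not a star contains a member of [F], and it also contains [x0] or all of [O2],
    none of which meets a star. Thus two edges suffice to separate a star from all non-stars. *)
Lemma star_cases N' : N' \in W -> 
  (exists2 N1, N1 \in restr F [fset x4] & N' = star N1) \/
  (exists2 N1, N1 \in F & N1 `<=` N' /\ (x0 \in N' \/ O2 `<=` N')).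
Proof.
move=> /flipP[[M MV ->]|[M /andP[MV]]].
  move/flipP: MV => [[M1 + ->]|[M1 /andP[]]].
    move=> /flipP[[M2 M2F ->]|[M2 /andP[M2F x4M] ->]].
      right; exists M2; rewrite // !inE x0U !orbT; split; last by left.
      by apply/fsubsetP => e eM; rewrite !inE eM.
    by left; exists M2; rewrite ?in_restr ?M2F.
  move=> /flipP[[M2 M2F ->]|[M2 /andP[M2F x4M] ->]].
    move=> _ ->; right; exists M2; rewrite // !inE x0U x02 /= !orbT; split; last by left.
    apply/fsubsetP => e eM; rewrite !inE eM /=.
    have [/negP nU _ _] := F_fresh M2F eM.
    by rewrite (_ : e != x2) //; apply/eqP => ex; apply: nU; rewrite ex.
  rewrite fsub1set !inE; have [/negbTE-> _ _ _ _] := U1_fresh x2U.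
  by rewrite orbF => /andP[_ x2M]; have [] := F_fresh M2F x2M; rewrite x2U.
rewrite fsub1set => x0M ->.
suff [M2 M2F subM] : exists2 M2, M2 \in F & M2 `<=` M.
  right; exists M2 => //; split; last by right; apply/fsubsetP => e eO; rewrite inE eO orbT.
  apply/fsubsetP => e eM; rewrite !inE (fsubsetP subM) // andbT.
  have [/negP nU _ _] := F_fresh M2F eM.
  by rewrite (_ : e != x0) //; apply/eqP => ex; apply: nU; rewrite ex.
have sub1 M1 : M1 \in F1 -> x0 \in M1 -> exists2 M2, M2 \in F & (M2 `<=` M1).
  move=> /flipP[[M2 M2F ->] _|[M2 /andP[M2F x4M] ->]].
    by exists M2; rewrite // fsubsetUl.
  rewrite !inE; have [/negbTE-> _ _ _ _] := U1_fresh x0U.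
  by rewrite orbF => /andP[_ x0M2]; have [] := F_fresh M2F x0M2; rewrite x0U.
have [_ _ _ /negbTE x0U3 /negbTE x0O3] := U1_fresh x0U.
move: x0M; move/flipP: MV => [[M1 M1F ->]|[M1 /andP[M1F _] ->]]; rewrite !inE.
  rewrite x0U3 orbF => /(sub1 _ M1F)[M2 M2F sub]; exists M2 => //.
  exact: fsubset_trans sub (fsubsetUl _ _).
rewrite x0O3 orbF => /andP[_ /(sub1 _ M1F)[M2 M2F sub]]; exists M2 => //.
apply/fsubsetP => e eM; rewrite !inE (fsubsetP sub) // andbT.
have [/negP nU _ _] := F_fresh M2F eM.
by rewrite (_ : e != x2) //; apply/eqP => ex; apply: nU; rewrite ex.
Qed.

Let in_starF N' e : N' \in F -> e \in N' -> (e \in star N) = (e \in N) && (e != x4).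
Proof.
move=> N'F eN'; have [_ /negbTE eO [/negbTE e2 _ /negbTE e3 _]] := F_fresh N'F eN'.
by rewrite !inE eO e2 e3 !orbF andbC.
Qed.

Let star_x0 : x0 \notin star N.
Proof.
have [/negbTE eO /negbTE e2 _ /negbTE e3 _] := U1_fresh x0U.
rewrite !inE eO e2 e3 !orbF; apply/negP => /andP[_ /(F_fresh NF)[]]; by rewrite x0U.
Qed.

Let star_O e : (e \in O2) || (e \in O3) -> e \notin star N.
Proof.
move=> eO; have nN : e \in N = false.
  by apply/negP => /(F_fresh NF)[_ _ [_ /negbTE e2 _ /negbTE e3]]; rewrite e2 e3 in eO.
have nO1 : e \in O1 = false.
  by apply/negP => /O1_fresh[_ /negbTE e2 _ /negbTE e3]; rewrite e2 e3 in eO.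
have nU3 : e \in U3 = false.
  by apply/negP => /U3_fresh[/negbTE e3 _ /negbTE e2]; rewrite e2 e3 in eO.
have nU2 : e \in U2 = false.
  apply/negP => e2; case/orP: eO => [|/O3_fresh[]]; last by rewrite e2.
  by rewrite (negbTE (U2_fresh e2)).
by rewrite !inE nN nO1 nU3 nU2 andbF.
Qed.

Let star_diff N' e : N' \in F -> x4 \in N' ->
  e \in star N' -> e \notin star N -> (e \in N') && (e \notin N).
Proof.
rewrite !inE -!orbA => _ _ /or4P[/andP[ex ->]|->|->|->]; rewrite ?orbT //=.
by rewrite ex !negb_or /= => /andP[].
Qed.

Let star_neq N' : N' \in F -> N' != N -> star N' != star N.
Proof.
move=> N'F nN; apply: contraNN nN => /eqP E; apply/eqP; have [cF _ _ _ _] := fr1.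
apply: cF => //; apply/fsubsetP => e eN'; apply: contraT => eN.
have ex : e != x4 by apply: contraNneq eN => ->.
have : e \in star N' by rewrite !inE eN' ex.
by rewrite E (in_starF N'F eN') (negbTE eN).
Qed.

Let hits_restr A : hits W (star N) A -> hits (restr F [fset x4]) N A.
Proof.
move=> hA N'; rewrite in_restr fsub1set => /andP[N'F x4N'] nN.
have sN' : star N' \in W by apply/flip0/flip0/flip1; rewrite ?fsub1set.
have [e eA /andP[eN' eN]] := hA _ sN' (star_neq N'F nN).
by exists e; last exact: star_diff.
Qed.

Hypothesis U1E : U1 = [fset x0; x2].

(** The ordinary member built on the same [N] exceeds the star only in [x4] and the edges of
    [U1]. *)
Let hit_hexagon A : hits W (star N) A -> exists2 a, a \in A & (a == x4) || (a \in U1).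
Proof.
move=> hA; have [||a aA /andP[]] := hA (N `|` U1 `|` U3 `|` U2); first exact: flip0.
  by apply: contraNneq star_x0 => <-; rewrite !inE x0U !orbT.
rewrite !inE !negb_or -!orbA => aM /andP[/andP[/andP[aN _] aU3] aU2].
exists a => //; move: aM aN; rewrite (negbTE aU3) (negbTE aU2) !orbF.
by case: (a \in N) => //=; case: (a == x4).
Qed.

(** When both rows are switched, all of [U1] is given up. What distinguishes this member from the
    star is then [O2], [O3] or a change inside [F]. *)
Let hit_far A N' : hits W (star N) A -> N' \in F -> x4 \notin N' ->
  exists2 a, a \in A & (a \in N') && (a \notin N) || ((a \in O2) || (a \in O3)).
Proof.
move=> hA N'F x4N'; have [_ _ _ _ [_ /fset0Pn[o oO]]] := fr2.
have x2N' : x2 \in N' `|` U1 by rewrite inE x2U orbT.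
have MV : (N' `|` U1) `\` [fset x2] `|` O3 \in V.
  by apply: flip1; rewrite ?fsub1set //; exact: flip0.
have MW : ((N' `|` U1) `\` [fset x2] `|` O3) `\` [fset x0] `|` O2 \in W.
  by apply: flip1 MV _; rewrite fsub1set !inE x0U x02 orbT.
have [|a aA /andP[aM aS]] := hA _ MW.
  by apply: contraNneq (star_O (e := o) _) => [<-|]; rewrite ?inE oO ?orbT.
exists a => //; move: aM aS; rewrite U1E !inE -!orbA.
case: (a \in O2); first by rewrite !orbT.
case: (a \in O3); first by rewrite !orbT.
rewrite !orbF !negb_or; case: eqP => //= _; case: eqP => //= _; rewrite orbF => aN'.
have ax : a != x4 by apply: contraNneq x4N' => <-.
by rewrite aN' ax => /andP[].
Qed.

(** [N'] avoids [x4] and offers no edge outside [N] that occurs in a member through [x4]. So the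
    element hitting around the hexagon and the one given by [hit_far] for [N'] are both useless
    inside [restr F [fset x4]]. Two extra edges are therefore necessary, and [x0] with one edge of
    [O2] suffice. *)
Lemma tau_star_far N' : N' \in F -> x4 \notin N' ->
    (forall N1 e, N1 \in F -> x4 \in N1 -> e \in N1 -> e \in N' -> e \in N) ->
  tau W (star N) = (tau (restr F [fset x4]) N).+2.
Proof.
move=> N'F x4N' far; have [cF _ _ _ _] := fr1.
have NR : N \in restr F [fset x4] by rewrite in_restr NF fsub1set.
apply: tau_eq star_in => [|A hA|]; last exact: flip_clutter.
- have [_ _ _ _ [_ /fset0Pn[o oO]]] := fr2.
  have [A hA <-] := tau_ex (clutter_restr (Q := [fset x4]) cF) NR.
  exists (x0 |` (o |` A)); last first.
    by rewrite !cardfsU1 addnA addnC -addn2 leq_add2l; case: (_ \notin _); case: (_ \notin _).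
  move=> M /star_cases[[N1 N1R ->]|[N1 N1F [_ [x0M|OM]]]] nM.
  + have [|e eA /andP[e1 e2]] := hA _ N1R; first by apply: contraNneq nM => ->.
    move: N1R; rewrite in_restr fsub1set => /andP[N1F x41].
    exists e; first by rewrite !inE eA !orbT.
      apply/andP; split.
      by rewrite !inE e1 (_ : e != x4) //; apply: contraNneq e2 => ->.
    by rewrite (in_starF N1F e1) (negbTE e2).
  + by exists x0; [exact: fset1U1 | rewrite x0M star_x0].
  + exists o; first by rewrite !inE eqxx orbT.
    by rewrite (fsubsetP OM) // star_O // oO.
- have [a1 a1A a1E] := hit_hexagon hA; have [a2 a2A a2E] := hit_far hA N'F x4N'.
  have a1F N1 : N1 \in F -> a1 \in N1 -> a1 = x4.
    by case/orP: a1E => [/eqP->//|aU] N1F /(F_fresh N1F)[]; rewrite aU.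
  have a12 : a2 != a1.
    apply/eqP => E; rewrite E in a2E; case/orP: a2E => [/andP[aN' _]|].
      by rewrite -(a1F _ N'F aN') aN' in x4N'.
    case/orP: a1E => [/eqP->|/U1_fresh[_ _ /negbTE-> _ /negbTE->]//].
    by have [_ _ [_ /negbTE-> _ /negbTE->]] := F_fresh NF x4N.
  (* Neither [a1] nor [a2] lies in a difference between [N] and a member through [x4]. *)
  have /tau_le : hits (restr F [fset x4]) N (A `\ a1 `\ a2).
    move=> N1 N1R nN; have [e eA /andP[e1 e2]] := hits_restr hA N1R nN.
    move: N1R; rewrite in_restr fsub1set => /andP[N1F x41].
    exists e; rewrite ?e1 ?e2 // !inE eA andbT; apply/andP; split.
      apply: contraNneq e2 => E; rewrite E in e1 *; case/orP: a2E => [/andP[aN' _]|].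
        exact: far N1F x41 e1 aN'.
      by have [_ _ [_ /negbTE-> _ /negbTE->]] := F_fresh N1F e1.
    by apply: contraNneq e2 => E; rewrite E in e1 *; rewrite (a1F _ N1F e1).
  by rewrite (cardfsD1 a1 A) a1A (cardfsD1 a2 (A `\ a1)) !inE a12 a2A.
Qed.

(** Here [v] marks the members avoiding [x4]. A transversal for [N] in the whole of [F], together
    with [x4], handles stars and non-stars alike, and the element around the hexagon shows that one
    extra edge is needed. *)
Lemma tau_star_near v : (forall N', N' \in F -> (v \in N') = (x4 \notin N')) ->
  tau W (star N) = (tau F N).+1.
Proof.
move=> vx; have [cF _ _ _ _] := fr1.
have x4S : x4 \notin star N by rewrite (in_starF NF x4N) eqxx andbF.
apply: tau_eq star_in => [|A hA|]; last exact: flip_clutter.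
- have [A hA <-] := tau_ex cF NF.
  exists (x4 |` A); last by rewrite cardfsU1; case: (_ \in _).
  move=> M /star_cases[[N1 + ->]|[N1 N1F [sub _]]] nM.
    rewrite in_restr fsub1set => /andP[N1F x41].
    have [|e eA /andP[e1 e2]] := hA _ N1F; first by apply: contraNneq nM => ->.
    exists e; first by rewrite !inE eA !orbT.
      apply/andP; split.
      by rewrite !inE e1 (_ : e != x4) //; apply: contraNneq e2 => ->.
    by rewrite (in_starF N1F e1) (negbTE e2).
  have [E|nN] := eqVneq N1 N.
    by exists x4; [exact: fset1U1 | rewrite x4S (fsubsetP sub) // E].
  have [e eA /andP[e1 e2]] := hA _ N1F nN.
  by exists e; [rewrite !inE eA orbT | rewrite (fsubsetP sub) // (in_starF N1F e1) (negbTE e2)].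
- have [a1 a1A a1E] := hit_hexagon hA.
  have a1F N1 : N1 \in F -> a1 \in N1 -> a1 = x4.
    by case/orP: a1E => [/eqP->//|aU] N1F /(F_fresh N1F)[]; rewrite aU.
  have near N1 e : N1 \in F -> e \in N1 -> e \notin N -> e != a1.
    move=> N1F e1 e2; apply: contraNneq e2 => E; rewrite E in e1 *.
    by rewrite (a1F _ N1F e1).
  have x4in N1 : N1 \in F -> N1 != N -> x4 \in N1 ->
      exists2 e, e \in A `\ a1 & (e \in N1) && (e \notin N).
    move=> N1F nN x41; have [|e eA /andP[e1 e2]] := hits_restr hA _ nN.
      by rewrite in_restr N1F fsub1set.
    by exists e; rewrite ?e1 ?e2 // !inE eA (near _ _ N1F e1 e2).
  have [/hasP[a2 a2A a2O]|/hasPn none] := boolP (has (fun a => (a \in O2) || (a \in O3)) A).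
    have a12 : a2 != a1.
      apply: contraTneq a2O => ->.
      case/orP: a1E => [/eqP->|/U1_fresh[_ _ /negbTE-> _ /negbTE->]//].
      by have [_ _ [_ /negbTE-> _ /negbTE->]] := F_fresh NF x4N.
    have /tau_le cv : hits F N (v |` (A `\ a1 `\ a2)).
      move=> N1 N1F nN; have [x41|x41] := boolP (x4 \in N1).
        have [e eA /andP[e1 e2]] := x4in _ N1F nN x41.
        exists e; rewrite ?e1 ?e2 //; rewrite in_fset1U in_fsetD1 eA andbT.
        apply/orP; right; apply: contraTneq a2O => <-.
        by have [_ _ [_ /negbTE-> _ /negbTE->]] := F_fresh N1F e1.
      by exists v; [exact: fset1U1 | rewrite vx // x41 vx // x4N].
    rewrite (cardfsD1 a1 A) a1A (cardfsD1 a2 (A `\ a1)) !inE a12 a2A.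
    by apply: leq_trans cv _; rewrite cardfsU1; case: (_ \in _).
  have /tau_le : hits F N (A `\ a1).
    move=> N1 N1F nN; have [x41|x41] := boolP (x4 \in N1); first exact: x4in.
    have [e eA] := hit_far hA N1F x41.
    rewrite (negbTE (none _ eA)) orbF => /andP[e1 e2].
    by exists e; rewrite ?e1 ?e2 // !inE eA (near _ _ N1F e1 e2).
  by rewrite (cardfsD1 a1 A) a1A.
Qed.

End Star.

Hypotheses (x0U3 : x0 \notin U3) (x0O3 : x0 \notin O3).

Let twin N : N \in F1 -> (x0 \in N) = (x2 \in N).
Proof. exact: (flip_even_twin fr1 x0U x2U). Qed.

Let sum_star (w : {fset T} -> {poly int}) : \sum_(M <- V | x0 \notin M) w M =
  \sum_(N <- restr F [fset x4]) w (N `\` [fset x4] `|` O1 `|` U3).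
Proof.
have [_ NUO UO _ _] := fr1.
have x0N N : N \in F -> x0 \in N = false.
  by move=> NF; apply/negP => /(NUO _ _ NF); rewrite x0U.
rewrite big_mkcond (sum_flip fr3) (sum_flip fr1) /=.
rewrite (_ : \sum_(N <- F) _ = 0) ?add0r.
  rewrite [X in _ + X](_ : _ = 0) ?addr0; last first.
    rewrite big_seq big1 // => N; rewrite in_restr fsub1set => /andP[NF1 x2N].
    suff -> : x0 \in N `\` [fset x2] `|` O3 by [].
    rewrite !inE x02 /=; move: x2N; move/flipP: NF1 => [[M MF ->]|[M /andP[MF _] ->]].
      by rewrite !inE x0U !orbT.
    rewrite !inE (negbTE (UO _ x2U)) orbF => /andP[_ /(NUO _ _ MF)]; by rewrite x2U.
  rewrite big_seq [RHS]big_seq; apply: eq_bigr => N; rewrite in_restr => /andP[NF _].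
  by rewrite !inE (x0N _ NF) (negbTE x0U3) (negbTE (UO _ x0U)) andbF.
by rewrite big1 // => N _; rewrite !inE x0U !orbT.
Qed.

Lemma afsum_restr_step : afsum (restr V [fset x0]) = 2 * 'X * afsum F.
Proof.
rewrite restr_flip_other ?inE // (afsum_flip_all (fresh_restr fr3 x0)).
  by rewrite (afsum_flip_even fr1).
by move=> N; rewrite in_restr !fsub1set => /andP[/twin->].
Qed.

(** Members of [V] without [x0] become the stars of [W]. Those with [x0] sum to [afsum V - 'X *
    afsum (restr F [fset x4])] and pay one more edge, and their switched copies add ['X * afsum
    (restr V [fset x0])]. *)
Lemma afsum_two_steps : afsum W =
  \sum_(N <- restr F [fset x4]) 'X^(tau W (star N)) + 'X^2 * afsum F1
  + 3 * 'X^2 * afsum F - 'X^3 * afsum (restr F [fset x4]).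
Proof.
have [_ NUO UO _ _] := fr1.
have VE : afsum V = 'X * afsum F1 + ('X - 'X^2) * afsum (restr F [fset x4]) + 'X * afsum F.
  by apply: (afsum_single_step fr1 x2U x0U); rewrite // eq_sym.
have starV : \sum_(N <- V | x0 \notin N) 'X^(tau V N) = 'X * afsum (restr F [fset x4]) :> {poly int}.
  rewrite (sum_star (fun N => 'X^(tau V N))) -(sum_flip1 fr1).
  rewrite big_seq [RHS]big_seq; apply: eq_bigr => N; rewrite in_restr => /andP[NF x4N].
  rewrite (tau_flip0_twin fr3 (f := x2) (g := x0)) //.
  - exact: flip1.
  - rewrite !inE (negbTE (UO _ x2U)) orbF.
    by apply/negP => /andP[_ /(NUO _ _ NF)]; rewrite x2U.
rewrite /W (afsum_flip fr2) -/W afsum_restr_step.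
have -> : \sum_(N <- V | ~~ ([fset x0] `<=` N)) 'X^(tau W (N `|` U2)) =
          \sum_(N <- restr F [fset x4]) 'X^(tau W (star N)) :> {poly int}.
  by under eq_bigl do rewrite fsub1set; rewrite (sum_star (fun N => 'X^(tau W (N `|` U2)))).
have -> : \sum_(N <- V | [fset x0] `<=` N) 'X^(tau V N) =
          afsum V - 'X * afsum (restr F [fset x4]) :> {poly int}.
  under eq_bigl do rewrite fsub1set.
  by rewrite -starV {1}/afsum [in RHS](bigID [pred N : {fset T} | x0 \in N]) /= addrK.
rewrite VE; ring.
Qed.

Hypothesis U1E : U1 = [fset x0; x2].

Lemma star_sum_far :
    (forall N, N \in F -> x4 \in N -> exists N', [/\ N' \in F, x4 \notin N' &
      forall N1 e, N1 \in F -> x4 \in N1 -> e \in N1 -> e \in N' -> e \in N]) ->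
  \sum_(N <- restr F [fset x4]) 'X^(tau W (star N)) =
  'X^2 * afsum (restr F [fset x4]) :> {poly int}.
Proof.
move=> far; rewrite /afsum big_distrr; apply: eq_big_seq => N; rewrite in_restr fsub1set.
move=> /andP[NF x4N]; have [N' [N'F x4N' sub]] := far _ NF x4N.
by rewrite (tau_star_far NF x4N U1E N'F x4N' sub) /= -exprD.
Qed.

(** The costs are taken in all of [F], not in the restricted family, so the sum is [afsum F] minus
    the part through [v]. *)
Lemma star_sum_near v : (forall N, N \in F -> (v \in N) = (x4 \notin N)) ->
  \sum_(N <- restr F [fset x4]) 'X^(tau W (star N)) =
  'X * afsum F - 'X * \sum_(N <- F | v \in N) 'X^(tau F N) :> {poly int}.
Proof.
move=> near; rewrite -mulrBr {1}/afsum [in RHS](bigID [pred N : {fset T} | v \in N]) /=.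
rewrite addrAC subrr add0r; transitivity ('X * \sum_(N <- restr F [fset x4]) 'X^(tau F N) : {poly int}).
  rewrite big_distrr; apply: eq_big_seq => N; rewrite in_restr fsub1set => /andP[NF x4N].
  by rewrite (tau_star_near NF x4N U1E near) exprS.
congr (_ * _); rewrite -[RHS]big_filter; apply: perm_big.
apply: uniq_perm; rewrite ?filter_uniq ?fset_uniq // => N.
rewrite mem_filter in_restr fsub1set andbC; case NF: (N \in F); rewrite ?andbF //.
by rewrite near // negbK.
Qed.

End TwoTails.

(* [F1] is the system with both tails cut off at the branched hexagon; [V] has  *)
(* the first hexagon of the second tail, [Y] the whole first tail, [X] both,    *)
(* and [G] both whole tails.                                                   *)
Lemma afsum_double_tail F U1 O1 U3 O3 x0 x2 x4 e g m1 m2 X Y G :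
    fresh F [fset x4] U1 O1 -> x0 \in U1 -> x2 \in U1 -> x0 != x2 ->
    let F1 := flip F [fset x4] U1 O1 in
    fresh F1 [fset x2] U3 O3 -> x0 \notin U3 -> x0 \notin O3 ->
    let V := flip F1 [fset x2] U3 O3 in
    ladder V x0 m1.+1 X -> ladder F1 x0 m1.+1 Y ->
    fresh Y [fset x2] U3 O3 -> X = flip Y [fset x2] U3 O3 ->
    e \in O3 -> g \in O3 -> g != e -> ladder X e m2 G ->
  forall beta : {poly int},
    (forall U2 O2, fresh V [fset x0] U2 O2 -> \sum_(N <- restr F [fset x4])
       'X^(tau (flip V [fset x0] U2 O2) (star O1 U2 U3 x4 N)) = beta) ->
  afsum G = beta + 'X^2 * afsum F1
      + (3 * 'X^2 + 2 * (m1 + m2)%:R * 'X^3 + (m1 * m2)%:R * 'X^4) * afsum F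
      - 'X^3 * afsum (restr F [fset x4]).
Proof.
move=> fr1 x0U x2U x02 F1 fr3 x0U3 x0O3 V ladX ladY frY XE eO gO ge ladG beta betaE.
have [U2 [O2 [fr2 XW]]] := afsum_ladder ladX; rewrite -(betaE _ _ fr2).
(* The second row beyond its first hexagon adds [m2] equal increments, computed where the first row
   is already complete. Expanding them produces the mixed term in [m1 * m2]. *)
have -> : afsum G = afsum X + m2%:R * 'X^2 * afsum (restr Y [fset x2]).
  by rewrite XE in ladG *; exact: afsum_ladder_step frY eO gO ge ladG.
rewrite (afsum_ladder_side fr1 x0U x2U x02 ladY) XW.
rewrite (afsum_two_steps fr1 x0U x2U x02 fr3 fr2 x0U3 x0O3) -/F1 -/V.
rewrite (afsum_restr_step fr1) // -/F1; rewrite natrM natrD; ring.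
Qed.

(** Take for N' the member from which [N] is switched: the two differ only on the hexagon, and the
    edges of [Q] and [U] that [N] lacks occur in no member through [o]. *)
Lemma flip_far F Q U O o : fresh F Q U O -> o \in O ->
  forall N, N \in flip F Q U O -> o \in N -> exists N', [/\ N' \in flip F Q U O, o \notin N' &
    forall N1 e, N1 \in flip F Q U O -> o \in N1 -> e \in N1 -> e \in N' -> e \in N].
Proof.
move=> fr oO; have [_ NUO UO QUO _] := fr.
have odd N : N \in flip F Q U O -> o \in N ->
    exists2 M, (M \in F) && (Q `<=` M) & N = M `\` Q `|` O.
  move=> /flipP[[M MF ->]|[M MF ->] _]; last by exists M.
  by rewrite inE => /orP[/(NUO _ _ MF)|/UO]; rewrite oO ?andbF.
move=> N NF oN; have [M /andP[MF QM] ->] := odd _ NF oN.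
exists (M `|` U); split; first exact: flip0.
  by rewrite inE; apply/negP => /orP[/(NUO _ _ MF)|/UO]; rewrite oO ?andbF.
move=> N1 e N1F oN1; have [M1 /andP[M1F QM1] ->] := odd _ N1F oN1.
rewrite !inE; case: (e \in O); rewrite ?orbT // !orbF.
case/andP=> eQ /(NUO _ _ M1F)/andP[/negbTE-> _]; by rewrite orbF eQ.
Qed.

Lemma flip_even_or_odd F Q U O u o : fresh F Q U O -> u \in U -> o \in O ->
  forall N, N \in flip F Q U O -> (o \in N) = (u \notin N).
Proof.
move=> [_ NUO UO QUO _] uU oO N /flipP[[M MF ->]|[M /andP[MF QM] ->]].
  rewrite !inE uU orbT; apply/negP => /orP[/(NUO _ _ MF)|/UO]; by rewrite oO ?andbF.
rewrite !inE oO orbT; apply/esym/negP => /orP[/andP[_ /(NUO _ _ MF)]|]; first by rewrite uU.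
by apply/negP; apply: UO.
Qed.

End Families.

(** * The hexagonal lattice *)

(** Directions are indexed by all naturals read modulo 6: adding 1 rotates by sixty degrees, adding
    3 reverses, and parity is well defined. *)
Definition dir (i : nat) : cell := nth c0 dirs (i %% 6).
Definition nb (c : cell) (i : nat) : cell := addc c (dir i).
Definition edge (c : cell) (i : nat) : {fset cell} := [fset c; nb c i].
Definition vert (c : cell) (i : nat) : {fset cell} := [fset c; nb c i; nb c i.+1].

Lemma cell_eq (c d : cell) : c.1 = d.1 -> c.2 = d.2 -> c = d.
Proof. by case: c d => [? ?] [? ?] /= -> ->. Qed.

Lemma dir_mod i : dir (i %% 6) = dir i.
Proof. by rewrite /dir modn_mod. Qed.

Lemma nb_mod c i j : i = j %[mod 6] -> nb c i = nb c j.
Proof. by rewrite /nb /dir => ->. Qed.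

Lemma odd_mod6 i : odd (i %% 6) = odd i.
Proof. by rewrite [in RHS](divn_eq i 6) oddD oddM andbF. Qed.

Lemma dir_add i k : dir (i + k) = dir (i %% 6 + k).
Proof. by rewrite /dir modnDml. Qed.

Lemma dir_opp i : dir (i + 3) = subc c0 (dir i).
Proof. by rewrite dir_add -[in RHS]dir_mod; case: (i %% 6)%N (ltn_pmod i (isT : 0 < 6)%N) => [|[|[|[|[|[|]]]]]]. Qed.

Lemma dir_next i : addc (dir i) (dir (i + 2)) = dir (i + 1).
Proof.
rewrite !(dir_add i) -[X in addc X _]dir_mod.
by case: (i %% 6)%N (ltn_pmod i (isT : 0 < 6)%N) => [|[|[|[|[|[|]]]]]].
Qed.

Lemma dir_inj i j : dir i = dir j -> i = j %[mod 6].
Proof.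
rewrite -[dir i]dir_mod -[dir j]dir_mod.
move: (ltn_pmod i (isT : 0 < 6)%N) (ltn_pmod j (isT : 0 < 6)%N).
by case: (i %% 6)%N => [|[|[|[|[|[|]]]]]] //; case: (j %% 6)%N => [|[|[|[|[|[|]]]]]].
Qed.

Lemma dir_neq0 i : dir i != c0.
Proof.
by rewrite -dir_mod; case: (i %% 6)%N (ltn_pmod i (isT : 0 < 6)%N) => [|[|[|[|[|[|]]]]]].
Qed.

Lemma addcA c d e : addc c (addc d e) = addc (addc c d) e.
Proof. by apply: cell_eq; rewrite /= addrA. Qed.

Lemma addcI c d e : addc c d = addc c e -> d = e.
Proof. by move=> [/addrI E1 /addrI E2]; apply: cell_eq. Qed.

Lemma addc0 c : addc c c0 = c.
Proof. by apply: cell_eq; rewrite /= addr0. Qed.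

Lemma nb_inj c i j : nb c i = nb c j -> i = j %[mod 6].
Proof. by move/addcI/dir_inj. Qed.

Lemma nb_neq c i : nb c i != c.
Proof. by apply: contraNneq (dir_neq0 i) => E; apply/eqP/(@addcI c); rewrite addc0. Qed.

Lemma nb_eq c i j : (nb c i == nb c j) = (i == j %[mod 6]).
Proof. by apply/eqP/eqP => [/nb_inj|/nb_mod->]. Qed.

Lemma nb_opp c i : nb (nb c i) (i + 3) = c.
Proof.
rewrite /nb -addcA dir_opp -[RHS]addc0; congr addc.
by apply: cell_eq; rewrite /= sub0r subrr.
Qed.

Lemma nb_opp' c i : nb (nb c (i + 3)) i = c.
Proof. by rewrite -[RHS](nb_opp c (i + 3)); apply: nb_mod; rewrite -addnA modnDr. Qed.

Lemma nb_next c i : nb (nb c i) (i + 2) = nb c (i + 1).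
Proof. by rewrite /nb -addcA dir_next. Qed.

Lemma adjcP c d : reflect (exists i, d = nb c i) (adjc c d).
Proof.
have sub_nb i : subc (nb c i) c = dir i.
  by apply: cell_eq; rewrite /= addrAC subrr add0r.
apply: (iffP idP) => [|[i ->]]; last by rewrite /adjc sub_nb mem_nth ?ltn_pmod.
move=> cd; exists (index (subc d c) dirs); rewrite /nb /dir modn_small ?index_mem //.
by rewrite nth_index //; apply: cell_eq; rewrite /= addrCA subrr addr0.
Qed.

Lemma adjc_nb c i : adjc c (nb c i).
Proof. by apply/adjcP; exists i. Qed.

Lemma edge_mod c i j : i = j %[mod 6] -> edge c i = edge c j.
Proof. by move=> E; rewrite /edge (nb_mod c E). Qed.

Lemma vert_mod c i j : i = j %[mod 6] -> vert c i = vert c j.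
Proof.
move=> E; rewrite /vert (nb_mod c E) (@nb_mod c i.+1 j.+1) //.
by rewrite -[i.+1]addn1 -[j.+1]addn1 -modnDml E modnDml.
Qed.

Lemma edge_opp c i : edge (nb c i) (i + 3) = edge c i.
Proof. by rewrite /edge nb_opp fsetUC. Qed.

Lemma in_hexedges c e : reflect (exists i, e = edge c i) (e \in hexedges c).
Proof.
apply: (iffP idP) => [/imfsetP[u /= uD ->]|[i ->]].
  by exists (index u dirs); rewrite /edge /nb /dir modn_small ?index_mem ?nth_index.
by apply/imfsetP; exists (dir i); rewrite //= mem_nth ?ltn_pmod.
Qed.

Lemma in_hexverts c v : reflect (exists i, v = vert c i) (v \in hexverts c).
Proof.
apply: (iffP idP) => [/imfsetP[i iI ->]|[i ->]].
  have : i \in iota 0 6 by exact: iI.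
  by rewrite mem_iota => /modn_small i6; exists i; rewrite /vert /nb /dir i6.
have iI : (i %% 6)%N \in iota 0 6 by rewrite mem_iota ltn_pmod.
apply/imfsetP; exists (i %% 6)%N; first exact: iI.
rewrite -[LHS](vert_mod c (modn_mod i 6)) /vert /nb /dir modn_mod.
by congr [fset _; _; _]; rewrite -addn1 modnDml addn1.
Qed.

Lemma in_gedges S e : reflect (exists2 c, c \in S & exists i, e = edge c i) (e \in gedges S).
Proof.
apply: (iffP (bigfcupP _ _ _ _)) => [[c /andP[cS _] /in_hexedges]|[c cS /in_hexedges]].
  by exists c.
by exists c; rewrite ?cS.
Qed.

Lemma in_gverts S v : reflect (exists2 c, c \in S & exists i, v = vert c i) (v \in gverts S).
Proof.
apply: (iffP (bigfcupP _ _ _ _)) => [[c /andP[cS _] /in_hexverts]|[c cS /in_hexverts]].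
  by exists c.
by exists c; rewrite ?cS.
Qed.

Lemma edge_sub c i (v : {fset cell}) : (edge c i `<=` v) = (c \in v) && (nb c i \in v).
Proof. by rewrite fsubUset !fsub1set. Qed.

Lemma gedges_edge S c i : (edge c i \in gedges S) = (c \in S) || (nb c i \in S).
Proof.
apply/in_gedges/orP => [[d dS [j E]]|[cS|nS]]; last first.
- by exists (nb c i) => //; exists (i + 3)%N; rewrite edge_opp.
- by exists c => //; exists i.
have : d \in edge c i by rewrite E !inE eqxx.
by rewrite !inE => /orP[]/eqP<-; [left|right].
Qed.

Lemma vert_rot c i : vert (nb c i) (i + 2) = vert c i.
Proof.
rewrite /vert nb_next -addnS nb_opp addn1; apply/fsetP => d; rewrite !inE.
by case: (d == c); case: (d == nb c i); rewrite ?orbT ?orbF.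
Qed.

Lemma vert_rot2 c i : vert (nb c i.+1) (i + 4) = vert c i.
Proof.
rewrite -[in RHS]vert_rot -[RHS]vert_rot nb_next addn1 -addnA; exact: vert_mod.
Qed.

Lemma in_vert c i d : d \in vert c i -> exists j, vert c i = vert d j.
Proof.
rewrite !inE -orbA => /or3P[]/eqP->.
- by exists i.
- by exists (i + 2)%N; rewrite vert_rot.
- by exists (i + 4)%N; rewrite vert_rot2.
Qed.

Lemma gverts_vert S c i :
  (vert c i \in gverts S) = [|| c \in S, nb c i \in S | nb c i.+1 \in S].
Proof.
apply/in_gverts/idP => [[d dS [j E]]|].
  have : d \in vert c i by rewrite E !inE eqxx.
  by rewrite !inE -orbA => /or3P[]/eqP<-; rewrite dS ?orbT.
case/or3P=> dS.
- by exists c => //; exists i.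
- by exists (nb c i) => //; exists (i + 2)%N; rewrite vert_rot.
- by exists (nb c i.+1) => //; exists (i + 4)%N; rewrite vert_rot2.
Qed.

Lemma gvertsP S v : reflect (exists c i, v = vert c i /\ c \in S) (v \in gverts S).
Proof.
apply: (iffP (in_gverts _ _)) => [[c cS [i ->]]|[c [i [-> cS]]]]; first by exists c, i.
by exists c => //; exists i.
Qed.

Lemma nb_in_vert c i j : (nb c j \in vert c i) = (j == i %[mod 6]) || (j == i.+1 %[mod 6]).
Proof. by rewrite !inE !nb_eq (negbTE (nb_neq c j)). Qed.

Lemma edge_sub_vert c i j : (edge c j `<=` vert c i) = (j == i %[mod 6]) || (j == i.+1 %[mod 6]).
Proof. by rewrite edge_sub nb_in_vert !inE eqxx. Qed.

Lemma edge_inj c i j : edge c i = edge c j -> i = j %[mod 6].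
Proof.
move=> E; have : nb c i \in edge c j by rewrite -E !inE eqxx orbT.
by rewrite !inE (negbTE (nb_neq c i)) nb_eq => /eqP.
Qed.

Lemma edge_eq c i j : (edge c i == edge c j) = (i == j %[mod 6]).
Proof. by apply/eqP/eqP => [/edge_inj|/edge_mod]. Qed.

(** * Perfect matchings as a set family *)

Definition pms S := perfect_matchings (gverts S) (gedges S).

Definition covers (M : {fset {fset cell}}) (v : {fset cell}) : Prop :=
  exists2 e, (e \in M) && (e `<=` v) & forall e', e' \in M -> e' `<=` v -> e' = e.

Lemma coversP M v : reflect (covers M v) (#|` [fset e in M | e `<=` v] | == 1%N).
Proof.
apply: (iffP (cardfs1P _)) => [[e /fsetP E]|[e /andP[eM ev] uni]].
  have := E e; rewrite !inE eqxx => /andP[eM ev]; exists e; first by rewrite eM.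
  by move=> e' eM' ev'; have := E e'; rewrite !inE eM' ev' => /esym/eqP.
exists e; apply/fsetP => e'; rewrite !inE; apply/andP/eqP => [[]|->//].
exact: uni.
Qed.

Lemma is_pmP V E M :
  reflect (M `<=` E /\ forall v, v \in V -> covers M v) (is_pm V E M).
Proof.
apply: (iffP andP) => -[ME cov]; split=> //.
  by move=> v /(allP cov)/coversP.
by apply/allP => v /cov/coversP.
Qed.

Lemma pmsP S M :
  reflect (M `<=` gedges S /\ forall v, v \in gverts S -> covers M v) (M \in pms S).
Proof.
apply: (iffP idP); rewrite /pms /perfect_matchings !inE fpowersetE.
  by move=> /andP[_ /is_pmP].
by move=> H; have [ME _] := H; rewrite ME; apply/is_pmP.
Qed.

Lemma gedges_gverts S e : e \in gedges S -> exists2 v, v \in gverts S & e `<=` v.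
Proof.
move=> /in_gedges[c cS [i ->]]; exists (vert c i); first by rewrite gverts_vert cS.
by rewrite edge_sub_vert eqxx.
Qed.

Lemma pms_clutter S : clutter (pms S).
Proof.
move=> M N /pmsP[ME covM] /pmsP[NE covN] sub; apply/eqP; rewrite eqEfsubset sub /=.
apply/fsubsetP => e eN; have [v vS ev] := gedges_gverts (fsubsetP NE _ eN).
have [e1 /andP[e1M e1v] _] := covM _ vS; have [e2 _ uni] := covN _ vS.
by rewrite (uni _ eN ev) -(uni _ (fsubsetP sub _ e1M) e1v).
Qed.

Lemma antiforcing_hits S M A : M \in pms S -> A `<=` gedges S `\` M ->
  reflect (hits (pms S) M A) (is_antiforcing (gverts S) (gedges S) M A).
Proof.
move=> /pmsP[ME covM] AS; have AM e : e \in A -> e \notin M.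
  by move=> /(fsubsetP AS); rewrite !inE => /andP[].
have MA : M `<=` gedges S `\` A.
  apply/fsubsetP => e eM; rewrite !inE (fsubsetP ME _ eM) andbT.
  by apply: contraL eM; apply: AM.
apply: (iffP andP) => [[_ /allP H] M' /pmsP[ME' covM'] nM|H].
  have /fsubsetPn[e eM' eA] : ~~ (M' `<=` gedges S `\` A).
    apply: contraNN nM => sub; have := H M'; rewrite fpowersetE => /(_ sub)/implyP; apply.
    exact/is_pmP.
  move: eA; rewrite !inE (fsubsetP ME' _ eM') andbT negbK => eA.
  by exists e; rewrite ?eM' ?AM.
split; first by rewrite AS; apply/is_pmP.
apply/allP => M'; rewrite fpowersetE => sub; apply/implyP => /is_pmP[_ cov].
apply: contraT => nM; have [|e eA /andP[eM' _]] := H M' _ nM.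
  by apply/pmsP; split=> //; apply: fsubset_trans sub (fsubsetDl _ _).
by have := fsubsetP sub _ eM'; rewrite !inE eA.
Qed.

(** A transversal may leave the edge set or meet [M]. Intersecting it with [gedges S] minus [M]
    makes it an admissible anti-forcing set and loses nothing. *)
Lemma af_tau S M : M \in pms S -> af (gverts S) (gedges S) M = tau (pms S) M.
Proof.
move=> MS; have [ME covM] := pmsP _ _ MS; have cS := @pms_clutter S.
apply/esym/tau_eq => // [|A hA]; last first.
  have sub : A `&` (gedges S `\` M) `<=` gedges S `\` M by exact: fsubsetIr.
  apply: leq_trans (fsubset_leq_card (fsubsetIl A (gedges S `\` M))).
  apply: bigminn_le; rewrite ?fpowersetE //; apply/antiforcing_hits => // M' M'S nM.
  have [e eA /andP[eM' eM]] := hA _ M'S nM; exists e; rewrite ?eM' ?eM //.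
  by have [/fsubsetP sub' _] := pmsP _ _ M'S; rewrite !inE eA eM sub'.
have hE : hits (pms S) M (gedges S `\` M).
  move=> M' M'S nM; have /fsubsetPn[e eM' eM] : ~~ (M' `<=` M).
    by apply: contraNN nM => /(cS _ _ M'S MS)->.
  exists e; rewrite ?eM' ?eM //; have [/fsubsetP sub' _] := pmsP _ _ M'S.
  by rewrite !inE eM sub'.
rewrite /af; have [|||A /andP[]] := @bigminn_witness _ (fpowerset (gedges S `\` M))
   (is_antiforcing (gverts S) (gedges S) M) (fun A => #|` A|) #|` gedges S| (gedges S `\` M).
- by rewrite fpowersetE.
- exact/antiforcing_hits.
- by apply: fsubset_leq_card; exact: fsubsetDl.
rewrite fpowersetE => sub /(antiforcing_hits MS sub) hA ->.
by exists A.
Qed.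

Lemma Af_afsum S : Af S = afsum (pms S).
Proof. by rewrite /Af /Afpoly big_seq [RHS]big_seq; apply: eq_bigr => M /af_tau->. Qed.

(** * The height function of a perfect matching *)

Lemma modS_neq i : (i == i.+1 %[mod 6]) = false.
Proof. by rewrite -[i.+1]addn1 -{1}[i]addn0 eqn_modDl. Qed.

Lemma cata_nb S c i : catacondensed S -> c \in S -> nb c i \in S -> nb c i.+1 \notin S.
Proof.
move=> cata cS nS; apply/negP => nS'.
have inv d j : vert d j = vert c i -> vert c i \in hexverts d.
  by move=> <-; apply/in_hexverts; exists j.
apply: (cata c (nb c i) (nb c i.+1) (vert c i)) => //.
- by rewrite eq_sym nb_neq.
- by rewrite eq_sym nb_neq.
- by rewrite nb_eq modS_neq.
- exact: inv.
- by apply: inv (i + 2)%N _; rewrite vert_rot.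
- by apply: inv (i + 4)%N _; rewrite vert_rot2.
Qed.

Lemma cata_nb' S c i : catacondensed S -> c \in S -> nb c i \in S -> nb c (i + 5) \notin S.
Proof.
move=> cata cS nS; apply: contraL nS => nS; have := cata_nb cata cS nS.
by rewrite (@nb_mod c (i + 5).+1 i) // -addnS modnDr.
Qed.

Lemma cata_sub S S' : S' `<=` S -> catacondensed S -> catacondensed S'.
Proof. by move=> /fsubsetP sub cata c1 c2 c3 v /sub ? /sub ? /sub ?; apply: cata. Qed.

(** From a deleted cell one step leads outside [S], since three cells around a vertex are never all
    in [S]; from there the old escape path serves. *)
Lemma no_holes_sub S S' : S' `<=` S -> catacondensed S -> no_holes S -> no_holes S'.
Proof.
move=> /fsubsetP sub cata nh c cS' N.
have out d : d \notin S -> d \notin S' by apply: contraNN; apply: sub.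
have [cS|cS] := boolP (c \in S); last first.
  have [p /and3P[pp pS pN]] := nh c cS N; exists p; rewrite pp pN andbT /=.
  by apply: sub_all pS.
have [i iS] : exists i, nb c i \notin S.
  have [n0|n0] := boolP (nb c 0 \in S); last by exists 0%N.
  by exists 1%N; apply: cata_nb n0.
have [p /and3P[pp pS pN]] := nh _ iS N; exists (nb c i :: p).
by rewrite /= adjc_nb pp pN out //= andbT; apply: sub_all pS.
Qed.

Lemma sub_vert c i S e : e \in gedges S -> e `<=` vert c i ->
  e \in [:: edge c i; edge c i.+1; edge (nb c i) (i + 2)].
Proof.
move=> /in_gedges[d dS [j ->]] sub.
have : d \in vert c i by move: sub; rewrite edge_sub => /andP[].
move: sub; rewrite !inE -orbA => + /or3P[]/eqP E; rewrite {}E.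
- by rewrite edge_sub_vert => /orP[]/eqP/(edge_mod c)->; rewrite eqxx ?orbT.
- rewrite -vert_rot edge_sub_vert => /orP[]/eqP/(edge_mod (nb c i))->; first by rewrite eqxx !orbT.
  by rewrite -addnS edge_opp eqxx.
- rewrite -vert_rot2 edge_sub_vert => /orP[]/eqP/(edge_mod (nb c i.+1))->.
    by rewrite (_ : i + 4 = i.+1 + 3)%N ?edge_opp ?eqxx ?orbT // addSnnS.
  have E : (i + 5 = i + 2 + 3)%N by rewrite -addnA.
  rewrite -addnS E -[i.+1]addn1 -nb_next edge_opp.
  by rewrite eqxx !orbT.
Qed.

Section Height.
Variables (S : {fset cell}) (M : {fset {fset cell}}).
Hypotheses (cata : catacondensed S) (nh : no_holes S) (MS : M \in pms S).

(* Half of the boundary edges form a fractional perfect matching of a          *)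
(* catacondensed system, so the difference [wt] with [M] sums to zero around    *)
(* every lattice vertex; with alternating signs it is the gradient of a         *)
(* function [height] on the cells, constant outside [S].                       *)
Definition wt (c : cell) (i : nat) : int :=
  (edge c i \in M).*2%:Z - ((c \in S) (+) (nb c i \in S))%:Z.

Lemma wt_opp c i : wt (nb c i) (i + 3) = wt c i.
Proof. by rewrite /wt edge_opp nb_opp addbC. Qed.

Lemma wt_out c i : c \notin S -> nb c i \notin S -> wt c i = 0.
Proof.
move=> cS nS; rewrite /wt (negbTE cS) (negbTE nS) subr0.
have [/fsubsetP sub _] := pmsP _ _ MS.
have /negbTE-> // : edge c i \notin M.
by apply/negP => /sub; rewrite gedges_edge (negbTE cS) (negbTE nS).
Qed.

(** Around a vertex of the graph one or two of the three cells lie in [S]. Either way two of the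
    three edges are boundary edges, and they cancel the weight 2 of the single matching edge. *)
Lemma wt_tri c i : wt c i + wt c i.+1 + wt (nb c i) (i + 2) = 0.
Proof.
have [/fsubsetP sub cov] := pmsP _ _ MS.
have cell0 : [|| c \notin S, nb c i \notin S | nb c i.+1 \notin S].
  have [cS|//] := boolP (c \in S); have [nS|//] := boolP (nb c i \in S).
  exact: cata_nb nS.
rewrite /wt nb_next addn1.
have [vS|] := boolP (vert c i \in gverts S); last first.
  rewrite gverts_vert !negb_or => /and3P[cS nS nS'].
  have no d j : d \notin S -> nb d j \notin S -> edge d j \in M = false.
    by move=> dS djS; apply/negP => /sub; rewrite gedges_edge (negbTE dS) (negbTE djS).
  by rewrite !no ?nb_next ?addn1 // (negbTE cS) (negbTE nS) (negbTE nS').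
have [e /andP[eM ev] uni] := cov _ vS.
have d12 : edge c i != edge c i.+1.
  by rewrite edge_eq modS_neq.
have d13 : edge c i != edge (nb c i) (i + 2).
  by rewrite -(edge_opp c i) edge_eq eqn_modDl.
have d23 : edge c i.+1 != edge (nb c i) (i + 2).
  apply/eqP => E; have : c \in edge (nb c i) (i + 2) by rewrite -E !inE eqxx.
  by rewrite /edge nb_next addn1 !inE !(eq_sym c) !(negbTE (nb_neq _ _)).
have inv : [&& edge c i `<=` vert c i, edge c i.+1 `<=` vert c i &
           edge (nb c i) (i + 2) `<=` vert c i].
  by rewrite -{3}(vert_rot c i) !edge_sub_vert !eqxx !orbT.
have {}inv e' : e' \in [:: edge c i; edge c i.+1; edge (nb c i) (i + 2)] -> (e' \in M) = (e' == e).
  move=> e3; apply/idP/eqP => [eM'|->//]; apply: uni => //.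
  by move: e3 inv; rewrite !inE => /or3P[]/eqP-> /and3P[].
have := sub_vert (sub _ eM) ev; rewrite !inv ?inE ?eqxx ?orbT // => /or3P[]/eqP->;
  move: d12 d13 d23 cell0 vS; rewrite gverts_vert;
  rewrite ?eqxx => /negbTE d12 /negbTE d13 /negbTE d23;
  rewrite ?(eq_sym (edge c i.+1) (edge c i)) ?(eq_sym (edge (nb c i) (i+2))) ?d12 ?d13 ?d23;
  by case: (c \in S); case: (nb c i \in S); case: (nb c i.+1 \in S).
Qed.

(** The vertex equations at the two triangles of a rhombus combine to this discrete closedness,
    which makes the difference of two neighbouring row sums telescope. *)
Lemma wt_strip c : wt c 1 - wt (nb c 0) 1 = wt (nb c 1) 0 - wt c 0.
Proof.
have t1 := wt_tri c 0; have t2 := wt_tri (nb c 0) 1.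
have E : nb (nb c 0) 1 = nb (nb c 1) 0.
  by apply: cell_eq; rewrite /= addrAC.
rewrite E (wt_opp _ 0) in t2; rewrite add0n in t1.
lia.
Qed.

Definition ray0 (c : cell) (k : nat) : cell := (c.1 + k%:Z, c.2).

Lemma ray0S c k : nb (ray0 c k) 0 = ray0 c k.+1.
Proof. by apply: cell_eq; rewrite /= ?addr0 // -addrA -PoszD addn1. Qed.

Lemma ray0_nb c k : ray0 (nb c 0) k = ray0 c k.+1.
Proof. by rewrite -ray0S; apply: cell_eq; rewrite /= // addrAC. Qed.

Lemma ray0_nb1 c k : ray0 (nb c 1) k = nb (ray0 c k) 1.
Proof. by apply: cell_eq; rewrite /= // addrAC. Qed.

Lemma cell_bound : exists B : nat, forall c, c \in S -> (`|c.1| < B)%N && (`|c.2| < B)%N.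
Proof.
exists (\max_(c <- S) (`|c.1| + `|c.2|)%N).+1 => c cS.
have := @leq_bigmax_seq _ (enum_fset S) predT (fun c : cell => (`|c.1| + `|c.2|)%N) c cS isT.
by move=> H; rewrite !ltnS !(leq_trans _ H) ?leq_addr ?leq_addl.
Qed.

Section Bounded.
Variable B : nat.
Hypothesis bounded : forall c, c \in S -> (`|c.1| < B)%N && (`|c.2| < B)%N.

(** The potential obtained by integrating [wt] along the row out to infinity; after [B + |c.1|]
    steps the ray has left [S] for good. *)
Definition height (c : cell) : int := - \sum_(k < B + `|c.1|) wt (ray0 c k) 0.

Lemma ray0_far c k : (B + `|c.1| <= k)%N -> ray0 c k \notin S.
Proof.
case: c => [x y] /= kB; apply/negP => /bounded/andP[+ _]; rewrite /ray0 /=; lia.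
Qed.

Lemma heightE c n : (B + `|c.1| <= n)%N -> height c = - \sum_(k < n) wt (ray0 c k) 0.
Proof.
move=> cn; rewrite /height -[in RHS](subnKC cn) [in RHS]big_split_ord /=; congr (- _).
rewrite [X in _ = _ + X]big1 ?addr0 // => k _.
by rewrite wt_out ?ray0S ?ray0_far // -?addnS ?leq_addr.
Qed.

Lemma height_nb0 c : height (nb c 0) - height c = wt c 0.
Proof.
set n := (B + `|c.1| + `|(nb c 0).1|)%N.
rewrite (@heightE (nb c 0) n) ?(@heightE c n.+1); [|rewrite /n; lia..].
rewrite big_ord_recl opprK addrCA [X in _ + X](_ : _ = 0).
  by rewrite addr0; congr wt; apply: cell_eq; rewrite /= ?addr0.
by rewrite addrC -sumrB big1 // => k _; rewrite ray0_nb subrr.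
Qed.

Lemma height_nb1 c : height (nb c 1) - height c = - wt c 1.
Proof.
have E1 : (nb c 1).1 = c.1 by rewrite /= addr0.
set n := (B + `|c.1|)%N.
rewrite (@heightE (nb c 1) n) ?(@heightE c n) ?E1 //.
have tele m : \sum_(k < m) (wt (nb (ray0 c k) 1) 0 - wt (ray0 c k) 0) = wt c 1 - wt (ray0 c m) 1.
  elim: m => [|m IH].
    by rewrite big_ord0 (_ : ray0 c 0 = c) ?subrr //; apply: cell_eq; rewrite /= ?addr0.
  by rewrite big_ord_recr /= IH -wt_strip ray0S; ring.
have {}tele : \sum_(k < n) wt (ray0 (nb c 1) k) 0 - \sum_(k < n) wt (ray0 c k) 0 = wt c 1.
  rewrite -sumrB; under eq_bigr do rewrite ray0_nb1.
  rewrite tele [X in _ - X]wt_out ?subr0 ?ray0_far //.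
  by rewrite -ray0_nb1 ray0_far // E1.
by rewrite -tele; ring.
Qed.

(** Directions 0 and 1 are computed from the definition, direction 2 follows from the vertex
    equation, and the opposite ones from [wt_opp], reversal changing both the parity and the
    sign. *)
Lemma height_nb c i : height (nb c i) - height c = (-1) ^+ odd i * wt c i.
Proof.
have h2 d : height (nb d 2) - height d = wt d 2.
  rewrite -[d](nb_opp d 3); set c' := nb d 3.
  rewrite (nb_mod _ (_ : (3 + 3 = 0 %[mod 6])%N)) //.
  have -> : nb (nb c' 0) 2 = nb c' 1 by rewrite (nb_next c' 0).
  have := wt_tri c' 0; have := height_nb0 c'; have := height_nb1 c'.
  rewrite add0n; lia.
have h3 j : (forall d, height (nb d j) - height d = (-1) ^+ odd j * wt d j) ->
    forall d, height (nb d (j + 3)) - height d = (-1) ^+ odd (j + 3) * wt d (j + 3).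
  move=> hj d; have := hj (nb d (j + 3)); rewrite nb_opp' => E.
  rewrite oddD addbT signrN mulNr.
  have := wt_opp (nb d (j + 3)) j; rewrite nb_opp' => ->.
  by rewrite -E; ring.
have wt_mod j k d : j = k %[mod 6] -> wt d j = wt d k.
  by move=> E; rewrite /wt (edge_mod d E) (nb_mod d E).
rewrite -(nb_mod c (modn_mod i 6)) -(wt_mod _ _ c (modn_mod i 6)) -(odd_mod6 i).
have h0 d : height (nb d 0) - height d = (-1) ^+ odd 0 * wt d 0.
  by rewrite height_nb0 mul1r.
have h1 d : height (nb d 1) - height d = (-1) ^+ odd 1 * wt d 1.
  by rewrite height_nb1 mulN1r.
have {}h2 d : height (nb d 2) - height d = (-1) ^+ odd 2 * wt d 2.
  by rewrite h2 mul1r.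
case: (i %% 6)%N (ltn_pmod i (isT : 0 < 6)%N) => [|[|[|[|[|[|]]]]]] // _.
- exact: (h3 0%N).
- exact: (h3 1%N).
- exact: (h3 2%N).
Qed.

Lemma height_row c : (B <= `|c.2|)%N -> height c = 0.
Proof.
move=> cB; have out k : ray0 c k \notin S.
  by apply/negP => /bounded/andP[_] /=; rewrite ltnNge cB.
by rewrite /height big1 ?oppr0 // => k _; rewrite wt_out ?ray0S.
Qed.

Lemma height_far c : (B + B <= `|c.1| + `|c.2|)%N -> height c = 0.
Proof.
case: c => [x y] /= cB; have [yB|yB] := leqP B `|y|; first exact: height_row.
have xB : (B <= `|x|)%N by lia.
have [x0|x0] := lerP 0 x.
  have out k : ray0 (x, y) k \notin S.
    by apply/negP => /bounded/andP[+ _]; rewrite /ray0 /=; lia.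
  by rewrite /height big1 ?oppr0 // => k _; rewrite wt_out ?ray0S.
(* A row ray starting left of [S] may cross it, so the height is carried along the column, which
   avoids [S], to a row beyond the bound. *)
have out k : (x, y + k%:Z) \notin S.
  by apply/negP => /bounded/andP[+ _] /=; rewrite ltnNge xB.
have up k : height (x, y + k%:Z) = height (x, y).
  elim: k => [|k IH]; first by rewrite addr0.
  rewrite -IH; apply/eqP; rewrite -subr_eq0.
  have E : (x, y + k.+1%:Z) = nb (x, y + k%:Z) 1.
    by apply: cell_eq; rewrite /= ?addr0 // -addrA -PoszD addn1.
  by rewrite E height_nb1 wt_out ?oppr0 // -E.
rewrite -(up (B + `|y|)%N); apply: height_row => /=; lia.
Qed.

(** The height is constant along paths outside [S], where [wt] vanishes, and absence of holes lets
    such a path reach the region of height 0. *)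
Lemma height_out c : c \notin S -> height c = 0.
Proof.
move=> cS; have [p /and3P[pp pS pN]] := nh cS (B + B).
suff -> : height c = height (last c p) by apply: height_far.
elim: p c cS pp pS {pN} => //= d p IH c cS /andP[/adjcP[i E] pp] /andP[dS pS].
rewrite -IH //; apply/eqP; rewrite eq_sym -subr_eq0 E height_nb wt_out ?mulr0 // -E //.
Qed.

End Bounded.

(** Both outer cells have height 0, and directions [i] and [i + 2] carry the same sign, so the two
    edges have equal weight. *)
Lemma odd_edges K i : K \in S -> nb K i \notin S -> nb K (i + 2) \notin S ->
  (edge K i \in M) = (edge K (i + 2) \in M).
Proof.
move=> KS iS jS; have [B bd] := cell_bound.
have u : (-1) ^+ odd i \is a @GRing.unit int by rewrite unitrX // unitrN1.
have := height_nb bd K i; rewrite (height_out bd iS) -(height_out bd jS) height_nb //.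
rewrite oddD addbF => /(mulrI u).
rewrite /wt KS (negbTE iS) (negbTE jS) => /addIr[].
by case: (edge K i \in M); case: (edge K (i + 2) \in M).
Qed.

End Height.

(** * Attaching a hexagon *)

(* Edges are numbered cyclically around [K], so that consecutive edges share a  *)
(* vertex and the edges of one parity form a perfect matching of [K].           *)
Definition evens (K : cell) (a : nat) : {fset {fset cell}} :=
  [fset edge K a; edge K (a + 2); edge K (a + 4)].
Definition odds (K : cell) (a : nat) : {fset {fset cell}} :=
  [fset edge K (a + 1); edge K (a + 3); edge K (a + 5)].
Definition glued S K a := evens K a `&` gedges (S `\ K).
Definition unglued S K a := evens K a `\` gedges (S `\ K).

Lemma mod6_even i a : [|| i == a %[mod 6], i == a + 2 %[mod 6] | i == a + 4 %[mod 6]]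
  = (odd i == odd a).
Proof.
rewrite -(odd_mod6 i) -(odd_mod6 a) -(modnDml a 2) -(modnDml a 4).
move: (ltn_pmod i (isT : 0 < 6)%N) (ltn_pmod a (isT : 0 < 6)%N).
by case: (i %% 6)%N => [|[|[|[|[|[|]]]]]] //; case: (a %% 6)%N => [|[|[|[|[|[|]]]]]].
Qed.

Lemma evens_edge K a i : (edge K i \in evens K a) = (odd i == odd a).
Proof. by rewrite !inE -orbA !edge_eq mod6_even. Qed.

Lemma odds_edge K a i : (edge K i \in odds K a) = (odd i != odd a).
Proof.
rewrite !inE -orbA !edge_eq; have := mod6_even i (a + 1).
rewrite -!addnA => ->; rewrite oddD addbT.
by case: (odd i); case: (odd a).
Qed.

Lemma in_evens K a e : e \in evens K a -> exists2 i, e = edge K i & odd i = odd a.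
Proof.
move=> eE; suff [i E] : exists i, e = edge K i.
  by exists i => //; apply/eqP; rewrite -(evens_edge K) -E.
by move: eE; rewrite !inE -orbA => /or3P[]/eqP->; eexists.
Qed.

Lemma in_odds K a e : e \in odds K a -> exists2 i, e = edge K i & odd i != odd a.
Proof.
move=> eE; suff [i E] : exists i, e = edge K i.
  by exists i => //; rewrite -(odds_edge K) -E.
by move: eE; rewrite !inE -orbA => /or3P[]/eqP->; eexists.
Qed.

Lemma evens_odds K a e : e \in evens K a -> e \notin odds K a.
Proof. by move=> /in_evens[i -> ia]; rewrite odds_edge ia eqxx. Qed.

Lemma center_edge K i : K \in edge K i.
Proof. by rewrite !inE eqxx. Qed.

Lemma gedgesD1_edge S K i : (edge K i \in gedges (S `\ K)) = (nb K i \in S).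
Proof. by rewrite gedges_edge !inE eqxx nb_neq. Qed.

Lemma corner K a i : exists x o, [/\ vert K i = [fset K; nb K x; nb K o],
  odd x = odd a, odd o != odd a,
  forall j, odd j = odd a -> edge K j `<=` vert K i -> edge K j = edge K x &
  forall j, odd j != odd a -> edge K j `<=` vert K i -> edge K j = edge K o].
Proof.
have par j k : j = k %[mod 6] -> odd j = odd k by rewrite -(odd_mod6 j) -(odd_mod6 k) => ->.
have [ia|ia] := eqVneq (odd i) (odd a).
  exists i, i.+1; split=> //; first by rewrite /= ia; case: (odd a).
  - move=> j ja; rewrite edge_sub_vert => /orP[]/eqP; first exact: edge_mod.
    by move/par; rewrite /= ja ia; case: (odd a).
  - move=> j ja; rewrite edge_sub_vert => /orP[]/eqP; last exact: edge_mod.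
    by move/par=> E; rewrite E ia eqxx in ja.
exists i.+1, i; split=> //.
- by apply/fsetP => d; rewrite !inE -!orbA; congr (_ || _); rewrite orbC.
- by move: ia => /=; case: (odd i); case: (odd a).
- move=> j ja; rewrite edge_sub_vert => /orP[]/eqP; last exact: edge_mod.
  by move/par=> E; rewrite -E ja eqxx in ia.
- move=> j ja; rewrite edge_sub_vert => /orP[]/eqP; first exact: edge_mod.
  by move/par => E; move: ia ja; rewrite E /=; case: (odd i); case: (odd a).
Qed.

Section AddHexagon.
Variables (S : {fset cell}) (K : cell) (a : nat).
Hypotheses (cata : catacondensed S) (nh : no_holes S) (KS : K \in S).
Hypothesis free : forall i, odd i != odd a -> nb K i \notin S.
Let S' := S `\ K.
Let Q := glued S K a.
Let U := unglued S K a.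
Let O := odds K a.

Let center e : [|| e \in Q, e \in U | e \in O] -> K \in e.
Proof.
by case/or3P=> [/fsetIP[/in_evens[i -> _] _]|/fsetDP[/in_evens[i -> _] _]|/in_odds[i -> _]];
  exact: center_edge.
Qed.

Let sub_cell e v : e `<=` v -> [|| e \in Q, e \in U | e \in O] -> K \in v.
Proof. by move=> /fsubsetP sub /center/sub. Qed.

Let O_out e : e \in O -> e \notin gedges S'.
Proof. by move=> /in_odds[i -> /free]; rewrite gedgesD1_edge. Qed.

Let gedgesE e : (e \in gedges S) = [|| e \in gedges S', e \in U | e \in O].
Proof.
apply/idP/or3P => [/in_gedges[c cS [i ->]]|].
  have [->{c cS}|cK] := eqVneq c K; last by apply: Or31; rewrite gedges_edge !inE cK cS.
  have [iO|iO] := boolP (odd i != odd a); first by apply: Or33; rewrite odds_edge.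
  have [iE|iE] := boolP (edge K i \in gedges S'); [exact: Or31|apply: Or32].
  by rewrite in_fsetD iE evens_edge -[_ == _]negbK.
case=> [/in_gedges[c + [i ->]]|/fsetDP[/in_evens[i -> _] _]|/in_odds[i -> _]].
- by rewrite gedges_edge !inE => /andP[_ ->].
- by rewrite gedges_edge KS.
- by rewrite gedges_edge KS.
Qed.

Let gverts_off v : K \notin v -> (v \in gverts S) = (v \in gverts S').
Proof.
move=> Kv; apply/idP/idP => /gvertsP[c [i [E]]] => [cS|]; rewrite E gverts_vert.
  rewrite !inE cS andbT (_ : c != K) //; apply: contraNneq Kv => <-.
  by rewrite E !inE eqxx.
by rewrite !inE => /andP[_ ->].
Qed.

(** At a corner of [K] exactly one even edge [x] and one odd edge [o] of [K] meet. Either [x] is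
    glued and the corner survives in [S'], or [x] is new and no edge of [S'] reaches the corner. *)
Let cornerP v : K \in v -> v \in gverts S -> exists x o,
  [/\ x \in evens K a, o \in O, (x `<=` v) && (o `<=` v),
      (forall e, e \in Q -> e `<=` v -> e = x) /\ (forall e, e \in U -> e `<=` v -> e = x) /\
      (forall e, e \in O -> e `<=` v -> e = o) &
      (x \in Q) && (v \in gverts S') \/
      [/\ x \in U, v \notin gverts S' & forall e, e \in gedges S' -> ~~ (e `<=` v)]].
Proof.
move=> Kv /gvertsP[c [i0 [E _]]]; have [i {c i0}E] : exists i, v = vert K i.
  by move: Kv; rewrite E => /in_vert.
have [x [o [vE xa oa ux uo]]] := corner K a i.
exists (edge K x), (edge K o); split.
- by rewrite evens_edge xa.
- by rewrite odds_edge.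
- by rewrite !edge_sub E vE !inE !eqxx ?orbT.
- split=> [e /fsetIP[/in_evens[j -> ja] _]|]; first by rewrite E; exact: ux.
  split=> e; first by move=> /fsetDP[/in_evens[j -> ja] _]; rewrite E; exact: ux.
  by move=> /in_odds[j -> ja]; rewrite E; exact: uo.
have inS' d : (d \in v) && (d \in S') = (d == nb K x) && (nb K x \in S).
  rewrite E vE !inE; have [->|dx] := eqVneq d (nb K x); first by rewrite nb_neq orbT.
  have [->|_] := eqVneq d K; first by rewrite /= ?andbF.
  by have [->|] := eqVneq d (nb K o); rewrite // (negbTE (free oa)) andbF.
have [xS|xS] := boolP (nb K x \in S); [left|right].
  rewrite in_fsetI evens_edge xa eqxx gedgesD1_edge xS /=.
  have := inS' (nb K x); rewrite eqxx xS => /andP[xv xS'].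
  move: xv; rewrite E => /in_vert[j ->]; by rewrite gverts_vert xS'.
split.
- by rewrite in_fsetD evens_edge xa eqxx gedgesD1_edge xS.
- apply/negP => /gvertsP[d [j [E' dS']]]; have := inS' d.
  by rewrite dS' E' !inE eqxx (negbTE xS) andbF.
- move=> e /in_gedges[d dS' [j ->]]; rewrite edge_sub; have := inS' d.
  by rewrite dS' (negbTE xS) andbF andbT => ->.
Qed.

Let UQ e : e \in U -> e \notin Q.
Proof. by move=> /fsetDP[_ eS]; apply: contraNN eS => /fsetIP[]. Qed.

Lemma odds_all_or_none M : M \in pms S -> O `<=` M \/ (forall e, e \in O -> e \notin M).
Proof.
move=> MS.
have f k : odd k -> nb K (a + k) \notin S.
  by move=> ok; apply: free; rewrite oddD ok; case: (odd a).
have E1 := odd_edges cata nh MS KS (f 1%N isT).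
rewrite -addnA in E1; have {}E1 := E1 (f 3 isT).
have E2 := odd_edges cata nh MS KS (f 3 isT).
rewrite -addnA in E2; have {}E2 := E2 (f 5 isT).
have [m|m] := boolP (edge K (a + 1) \in M); [left|right].
  by apply/fsubsetP => e; rewrite !inE -orbA => /or3P[]/eqP->; rewrite -?E2 -?E1.
by move=> e; rewrite !inE -orbA => /or3P[]/eqP->; rewrite -?E2 -?E1.
Qed.

Let pms_none M : M \in pms S -> (forall e, e \in O -> e \notin M) ->
  [/\ U `<=` M & M `\` U \in pms S'].
Proof.
move=> /pmsP[/fsubsetP ME cov] none.
have UM : U `<=` M.
  apply/fsubsetP => u uU; have [v vS uv] : exists2 v, v \in gverts S & u `<=` v.
    by apply: gedges_gverts; rewrite gedgesE uU orbT.
  have Kv : K \in v by apply: sub_cell uv _; rewrite uU orbT.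
  have [x [o [xE oO _ [qx [ux _]] alt]]] := cornerP Kv vS.
  have xu := ux _ uU uv; rewrite -xu in qx ux alt.
  have [e /andP[eM ev] _] := cov _ vS; suff <- : e = u by [].
  have [_ _ no] : [/\ u \in U, v \notin gverts S' & forall e, e \in gedges S' -> ~~ (e `<=` v)].
    by case: alt => // /andP[]; rewrite (negbTE (UQ uU)).
  have := ME _ eM; rewrite gedgesE => /or3P[/no|eU|/none]; rewrite ?ev ?eM //.
  by rewrite (ux _ eU ev).
split=> //; apply/pmsP; split.
  apply/fsubsetP => e; rewrite in_fsetD => /andP[eU eM].
  by have := ME _ eM; rewrite gedgesE (negbTE eU) /= => /orP[//|/none]; rewrite eM.
move=> v vS'; have vS : v \in gverts S.
  have [c [i [-> cS']]] := gvertsP _ _ vS'; rewrite gverts_vert.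
  by move: cS'; rewrite !inE => /andP[_ ->].
have [e /andP[eM ev] uni] := cov _ vS; exists e; last first.
  by move=> e'; rewrite in_fsetD => /andP[_ eM']; apply: uni.
rewrite in_fsetD eM ev !andbT; apply/negP => eU.
have Kv : K \in v by apply: sub_cell ev _; rewrite eU orbT.
have [x [o [xE oO _ [qx [ux _]] alt]]] := cornerP Kv vS.
by case: alt => [/andP[]|[_]]; rewrite ?vS' // -(ux _ eU ev) (negbTE (UQ eU)).
Qed.

Let pms_all M : M \in pms S -> O `<=` M ->
  [/\ forall e, e \in evens K a -> e \notin M & (M `\` O) `|` Q \in pms S'].
Proof.
move=> /pmsP[/fsubsetP ME cov] OM.
have noE e : e \in evens K a -> e \notin M.
  move=> eE; have [i E ia] := in_evens eE; have eS : e \in gedges S.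
    by rewrite E gedges_edge KS.
  have [v vS ev] := gedges_gverts eS.
  have Kv : K \in v by apply: (fsubsetP ev); rewrite E center_edge.
  have [x [o [xE oO /andP[_ ov] _ _]]] := cornerP Kv vS.
  apply/negP => eM; have [e1 _ uni] := cov _ vS.
  have := uni _ eM ev; rewrite -(uni o) ?(fsubsetP OM) // => eo.
  by have := evens_odds eE; rewrite eo oO.
split=> //; apply/pmsP; split.
  apply/fsubsetP => e; rewrite inE => /orP[|/fsetIP[]//]; rewrite in_fsetD => /andP[eO eM].
  have := ME _ eM; rewrite gedgesE (negbTE eO) orbF => /orP[//|/fsetDP[/noE]].
  by rewrite eM.
move=> v vS'; have vS : v \in gverts S.
  have [c [i [-> cS']]] := gvertsP _ _ vS'; rewrite gverts_vert.
  by move: cS'; rewrite !inE => /andP[_ ->].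
have [e /andP[eM ev] uni] := cov _ vS.
have [Kv|Kv] := boolP (K \in v); last first.
  exists e.
    rewrite ev in_fsetU in_fsetD eM !andbT; apply/orP; left.
    by apply: contraNN Kv => eO; apply: sub_cell ev _; rewrite eO !orbT.
  move=> e'; rewrite in_fsetU in_fsetD => /orP[/andP[_ eM']|eQ] ev'; first exact: uni.
  by case/negP: Kv; apply: sub_cell ev' _; rewrite eQ.
have [x [o [xE oO /andP[xv ov] [qx [_ ox]] alt]]] := cornerP Kv vS.
have xQ : x \in Q by case: alt => [/andP[]|[_]] //; rewrite vS'.
exists x; first by rewrite xv in_fsetU xQ orbT.
move=> e'; rewrite in_fsetU in_fsetD => /orP[/andP[eO' eM']|eQ] ev'; last exact: qx.
have := uni _ eM' ev'; rewrite -(uni o) ?(fsubsetP OM) // => eo.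
by rewrite eo oO in eO'.
Qed.

Let pms_even N : N \in pms S' -> N `|` U \in pms S.
Proof.
move=> /pmsP[/fsubsetP NE cov]; apply/pmsP; split.
  apply/fsubsetP => e; rewrite inE gedgesE => /orP[/NE->//|->]; by rewrite orbT.
move=> v vS; have [Kv|Kv] := boolP (K \in v); last first.
  have [e /andP[eN ev] uni] := cov v (etrans (esym (gverts_off Kv)) vS).
  exists e; first by rewrite in_fsetU eN.
  move=> e'; rewrite in_fsetU => /orP[eN'|eU'] ev'; first exact: uni.
  by case/negP: Kv; apply: sub_cell ev' _; rewrite eU' orbT.
have [x [o [xE oO /andP[xv ov] [qx [ux ox]] [/andP[xQ vS']|[xU _ no]]]]] := cornerP Kv vS.
  have [e /andP[eN ev] uni] := cov v vS'.
  exists e; first by rewrite in_fsetU eN.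
  move=> e'; rewrite in_fsetU => /orP[eN'|eU'] ev'; first exact: uni.
  by have := UQ eU'; rewrite (ux _ eU' ev') xQ.
exists x; first by rewrite in_fsetU xU orbT.
move=> e'; rewrite in_fsetU => /orP[/NE/no/negbTE->//|]; exact: ux.
Qed.

Let pms_odd N : N \in pms S' -> Q `<=` N -> (N `\` Q) `|` O \in pms S.
Proof.
move=> /pmsP[/fsubsetP NE cov] /fsubsetP QN; apply/pmsP; split.
  apply/fsubsetP => e; rewrite in_fsetU in_fsetD gedgesE.
  by case/orP=> [/andP[_ /NE->]//|->]; rewrite !orbT.
move=> v vS; have [Kv|Kv] := boolP (K \in v); last first.
  have [e /andP[eN ev] uni] := cov v (etrans (esym (gverts_off Kv)) vS).
  exists e.
    rewrite in_fsetU in_fsetD eN ev !andbT; apply/orP; left.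
    by apply: contraNN Kv => eQ; apply: sub_cell ev _; rewrite eQ.
  move=> e'; rewrite in_fsetU in_fsetD => /orP[/andP[_ eN']|eO'] ev'; first exact: uni.
  by case/negP: Kv; apply: sub_cell ev' _; rewrite eO' !orbT.
have [x [o [xE oO /andP[xv ov] [qx [ux ox]] alt]]] := cornerP Kv vS.
exists o; first by rewrite in_fsetU oO orbT.
move=> e'; rewrite in_fsetU in_fsetD => /orP[/andP[eQ' eN']|]; last exact: ox.
case: alt => [/andP[xQ vS']|[_ _ no]] ev'; last by have := no _ (NE _ eN'); rewrite ev'.
have [e1 _ uni] := cov v vS'.
by have := uni _ eN' ev'; rewrite -(uni x) ?QN // => E; rewrite E xQ in eQ'.
Qed.

(** Without odd edges, the corners absent from [S'] force all of [U], and removing [U] leaves a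
    matching of [S']. With all odd edges, no even edge is used, and exchanging the odd ones for [Q]
    covers the glued corners again. *)
Lemma pms_flip : pms S = flip (pms S') Q U O.
Proof.
apply/fsetP => M; apply/idP/flipP => [MS|[[N NS' ->]|[N /andP[NS' QN] ->]]]; last first.
- exact: pms_odd.
- exact: pms_even.
have [OM|none] := odds_all_or_none MS; [right|left].
  have [noE NS] := pms_all MS OM; exists ((M `\` O) `|` Q); first by rewrite NS fsubsetUr.
  apply/fsetP => e; apply/idP/fsetUP => [eM|[/fsetDP[/fsetUP[/fsetDP[]//|eQ]]|/(fsubsetP OM)//]].
    have [eO|eO] := boolP (e \in O); [by right|left].
    apply/fsetDP; split; first by apply/fsetUP; left; apply/fsetDP.
    by apply/negP => /fsetIP[/noE]; rewrite eM.
  by rewrite eQ.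
have [UM NS] := pms_none MS none; exists (M `\` U) => //.
by rewrite fsetUC fsetUDl fsetDv fsetD0; apply/esym/fsetUidPr.
Qed.

Lemma pms_fresh : U != fset0 -> fresh (pms S') Q U O.
Proof.
move=> U0; split.
- exact: pms_clutter.
- move=> N e /pmsP[/fsubsetP NE _] /NE eS'.
  by rewrite in_fsetD eS' /=; apply: contraL eS'; exact: O_out.
- by move=> e /fsetDP[/evens_odds].
- move=> e eQ; have /fsetIP[/evens_odds-> _] := eQ.
  by rewrite andbT; apply: contraL eQ; exact: UQ.
- by split=> //; apply/fset0Pn; exists (edge K (a + 1)); rewrite !inE eqxx.
Qed.

End AddHexagon.

(** * Straight chains *)

Definition walk (c : cell) (i k : nat) : cell := iter k (fun d => nb d i) c.
Definition run (c : cell) (i n : nat) : {fset cell} := [fset walk c i k.+1 | k in iota 0 n].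

Lemma walkS c i k : walk c i k.+1 = nb (walk c i k) i. Proof. by []. Qed.

Lemma walkSr c i k : walk c i k.+1 = walk (nb c i) i k.
Proof. exact: iterSr. Qed.

Lemma walkE c i k : walk c i k = (c.1 + k%:Z * (dir i).1, c.2 + k%:Z * (dir i).2).
Proof.
elim: k => [|k IH]; first by apply: cell_eq; rewrite /= mul0r addr0.
by rewrite walkS IH; apply: cell_eq; rewrite /= -[in RHS]addn1 PoszD; ring.
Qed.

Lemma walk_mod c i j k : i = j %[mod 6] -> walk c i k = walk c j k.
Proof. by move=> E; elim: k => //= k ->; apply: nb_mod. Qed.

Lemma walk_inj c i : injective (walk c i).
Proof.
move=> k l; rewrite !walkE => -[/addrI E1 /addrI E2].
have [d1|d2] : ((dir i).1 != 0) \/ ((dir i).2 != 0).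
  have := dir_neq0 i; case: (dir i) => x y; rewrite xpair_eqE negb_and => /orP[]; by [left|right].
- by have := mulIf d1 E1 => -[].
- by have := mulIf d2 E2 => -[].
Qed.

Lemma walk_back c i k : nb (walk c i k.+1) (i + 3) = walk c i k.
Proof. by rewrite walkS nb_opp. Qed.

Lemma runP c i n d :
  reflect (exists2 k, (0 < k <= n)%N & d = walk c i k) (d \in run c i n).
Proof.
apply: (iffP idP) => [/imfsetP[k kn ->]|[[//|k] kn ->]].
  have : k \in iota 0 n by exact: kn.
  by rewrite mem_iota => kn'; exists k.+1.
have kI : k \in iota 0 n by rewrite mem_iota.
by apply/imfsetP; exists k; first exact: kI.
Qed.

Lemma walk_run c i n k : (walk c i k \in run c i n) = (0 < k <= n)%N.
Proof. by apply/runP/idP => [[l ln /walk_inj->]//|kn]; exists k. Qed.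

Lemma run0 c i : run c i 0 = fset0.
Proof. by apply/fsetP => d; rewrite inE; apply/runP => -[[|k]]. Qed.

Lemma runS c i n : run c i n.+1 = nb c i |` run (nb c i) i n.
Proof.
apply/fsetP => d; rewrite in_fset1U; apply/runP/orP => [[[//|[|k]] kn ->]|].
- by left.
- by right; apply/runP; exists k.+1; rewrite // walkSr.
- by case=> [/eqP->|/runP[k /andP[_ kn] ->]]; [exists 1%N | exists k.+1; rewrite ?walkSr].
Qed.

Lemma center_run c i n : c \notin run c i n.
Proof. by rewrite -[c in c \notin _]/(walk c i 0) walk_run. Qed.

Lemma mod6_add_neq j k : (0 < k < 6)%N -> (j + k == j %[mod 6]) = false.
Proof.
by case/andP=> k0 k6; rewrite -{2}[j]addn0 eqn_modDl mod0n modn_small // eqn0Ngt k0.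
Qed.

Lemma mod6_cases i b : [|| i == b %[mod 6], i == b + 1 %[mod 6], i == b + 2 %[mod 6],
  i == b + 3 %[mod 6], i == b + 4 %[mod 6] | i == b + 5 %[mod 6]].
Proof.
rewrite -!(modnDml b).
move: (ltn_pmod i (isT : 0 < 6)%N) (ltn_pmod b (isT : 0 < 6)%N).
by case: (i %% 6)%N => [|[|[|[|[|[|]]]]]] //; case: (b %% 6)%N => [|[|[|[|[|[|]]]]]].
Qed.

Lemma glued1 S K j : (forall i, nb K i \in S -> i = j %[mod 6]) -> nb K j \in S ->
  [/\ glued S K j = [fset edge K j], edge K (j + 2) \in unglued S K j &
      forall i, odd i != odd j -> nb K i \notin S].
Proof.
move=> only jS; split.
- apply/fsetP => e; rewrite in_fsetI in_fset1; apply/andP/eqP => [[/in_evens[i -> _]]|->].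
    by rewrite gedgesD1_edge => /only/edge_mod.
  by rewrite evens_edge eqxx gedgesD1_edge.
- rewrite in_fsetD evens_edge oddD addbF eqxx andbT gedgesD1_edge.
  by apply/negP => /only/eqP; rewrite mod6_add_neq.
- move=> i ij; apply/negP => /only E; case/negP: ij.
  by rewrite -(odd_mod6 i) -(odd_mod6 j) E.
Qed.

Lemma pms_flip1 S K j : catacondensed S -> no_holes S -> K \in S ->
    (forall i, nb K i \in S -> i = j %[mod 6]) -> nb K j \in S ->
  pms S = flip (pms (S `\ K)) [fset edge K j] (unglued S K j) (odds K j) /\
  fresh (pms (S `\ K)) [fset edge K j] (unglued S K j) (odds K j).
Proof.
move=> cata nh KS only jS; have [E uU free] := glued1 only jS; rewrite -E; split.
  exact: pms_flip.
by apply: pms_fresh free _; apply/fset0Pn; exists (edge K (j + 2)).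
Qed.

(* [is_branch S h a m]: the straight chain of [m] hexagons leaving [h] in       *)
(* direction [a] meets the rest of [S] only in [h].                            *)
Definition is_branch (S : {fset cell}) h a m : Prop :=
  (forall k, (k <= m)%N -> walk h a k \in S) /\
  (forall k i, (0 < k <= m)%N -> nb (walk h a k) i \in S ->
     i = a + 3 %[mod 6] \/ i = a %[mod 6] /\ (k < m)%N).

Lemma is_branch_sub S S' h a m : S' `<=` S -> (forall k, (k <= m)%N -> walk h a k \in S') ->
  is_branch S h a m -> is_branch S' h a m.
Proof.
by move=> /fsubsetP sub all [_ H]; split=> // k i km /sub; apply: H.
Qed.

Lemma is_branch_tail S h a m : is_branch S h a m.+1 -> is_branch S (nb h a) a m.
Proof.
move=> [H1 H2]; split=> [k km|k i /andP[k0 km]]; rewrite -walkSr; first exact: H1.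
by move=> /H2[]; [rewrite ltnS|left|right].
Qed.

Lemma pms_ladder m S h a : catacondensed S -> no_holes S -> is_branch S h a m ->
  ladder (pms (S `\` run h a m)) (edge h a) m (pms S).
Proof.
elim: m h => [|m IH] h cata nh br; first by rewrite run0 fsetD0; left.
have [inS only] := br.
set K := nb h a; set B' := S `\` run K a m.
have BE : S `\` run h a m.+1 = B' `\ K.
  by apply/fsetP => d; rewrite runS !inE negb_or andbA.
have sub : B' `<=` S by exact: fsubsetDl.
have cataB := cata_sub sub cata; have nhB := no_holes_sub sub cata nh.
have KB : K \in B' by rewrite in_fsetD center_run (inS 1%N).
have hK : nb K (a + 3) = h by rewrite nb_opp.
have hB : nb K (a + 3) \in B'.
  rewrite hK in_fsetD (inS 0%N) // andbT; apply/runP => -[k _].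
  by rewrite -walkSr -[h in h = _]/(walk h a 0) => /walk_inj.
have nbK i : nb K i \in B' -> i = a + 3 %[mod 6].
  rewrite in_fsetD => /andP[nr /(only 1%N)[]//[Ei m1]].
  case/negP: nr; rewrite (nb_mod _ Ei) -[nb K a]/(walk K a 1) walk_run //.
have [FE fr] := pms_flip1 cataB nhB KB nbK hB.
rewrite BE; have Ee : edge K (a + 3) = edge h a by exact: edge_opp.
rewrite Ee in FE fr.
(* Both [a] and [a + 2] have parity opposite to [a + 3], so both edges belong to [O]: the next
   hexagon is glued along the first, and the second is its twin. *)
apply: (LadderS (e' := edge K a) (g := edge K (a + 2)) fr).
- by rewrite odds_edge oddD addbT; case: (odd a).
- by rewrite odds_edge !oddD addbF addbT; case: (odd a).
- by rewrite edge_eq mod6_add_neq.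
- by rewrite -FE; apply: IH => //; apply: is_branch_tail.
Qed.

(* A matching using the first edge [edge D b] crossing a straight chain is       *)
(* forced along the whole chain. *)
Lemma chain_removal n S D b : catacondensed (D |` S) -> no_holes S -> D \notin S ->
    (forall k, (0 < k <= n.+1)%N -> walk D b k \in S) -> walk D b n.+2 \notin S ->
  exists W, (forall e, e \in W -> e \notin gedges (S `\` run D b n.+1)) /\
    restr (pms S) [fset edge D b] = [fset N `|` W | N in pms (S `\` run D b n.+1)].
Proof.
elim: n S D => [|n IH] S D cata nh DS inS out; set K := nb D b.
all: have KS : K \in S by exact: (inS 1%N).
all: have cataS := cata_sub (fsubsetU1 D S) cata.
all: have back : nb K (b + 3) = D by rewrite nb_opp.
all: have KD : K \in D |` S by rewrite in_fset1U KS orbT.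
all: have DD : nb K (b + 3) \in D |` S by rewrite back fset1U1.
all: have b4 : nb K (b + 4) \notin S
  by have := cata_nb cata KD DD; rewrite in_fset1U negb_or -addnS => /andP[].
all: have b2 : nb K (b + 2) \notin S
  by have := cata_nb' cata KD DD; rewrite in_fset1U negb_or
     (@nb_mod _ (b + 3 + 5) (b + 2)) => [/andP[]//|]; rewrite -addnA -[(3+5)%N]/(2 + 6)%N addnA modnDr.
(* The last hexagon of the chain may have neighbours in directions [b + 1] and [b + 5]. The entering
   edge is then an unglued even edge, and prescribing it forces the unswitched form. *)
- have free i : odd i != odd (b + 3) -> nb K i \notin S.
    move=> ib; have : odd i == odd b by move: ib; rewrite oddD addbT; case: (odd i); case: (odd b).
    by rewrite -mod6_even => /or3P[]/eqP/(nb_mod K)->.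
  have eU : edge D b \in unglued S K (b + 3).
    by rewrite -edge_opp -/K in_fsetD evens_edge eqxx gedgesD1_edge back DS.
  have fr : fresh (pms (S `\ K)) (glued S K (b + 3)) (unglued S K (b + 3)) (odds K (b + 3)).
    by apply: pms_fresh free _; apply/fset0Pn; exists (edge D b).
  have RE : S `\` run D b 1 = S `\ K by rewrite runS run0 fsetU0.
  rewrite RE; exists (unglued S K (b + 3)); split; first by move=> e /fsetDP[].
  by rewrite (pms_flip cataS nh KS free) (restr_flip_even fr).
(* An inner hexagon has its only neighbour straight ahead. The entering edge is now odd, so the
   switch is forced and the matching of the rest must use the next edge across the chain. *)
- have b0 : nb K b \in S by exact: (inS 2%N).
  have only i : nb K i \in S -> i = b %[mod 6].
    move=> iS; have := mod6_cases i b; rewrite !orbA => /orP[|/eqP E]; last first.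
      by have := cata_nb' cataS KS b0; rewrite -(nb_mod K E) iS.
    rewrite -!orbA => /or4P[|||/orP[]] /eqP E //.
    - by have := cata_nb cataS KS b0; rewrite -addn1 -(nb_mod K E) iS.
    - by rewrite -(nb_mod K E) iS in b2.
    - by rewrite (nb_mod K E) back (negbTE DS) in iS.
    - by rewrite -(nb_mod K E) iS in b4.
  have [FE fr] := pms_flip1 cataS nh KS only b0.
  have eO : edge D b \in odds K b.
    by rewrite -edge_opp -/K odds_edge oddD addbT; case: (odd b).
  rewrite FE (restr_flip_odd fr eO).
  have [|||k kn||W [WS ->]] := IH (S `\ K) K.
  + by apply: cata_sub cataS; apply/fsubsetP => d; rewrite !inE => /orP[/eqP->|/andP[]].
  + exact: no_holes_sub (fsubsetDl _ _) cataS nh.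
  + by rewrite !inE eqxx.
  + rewrite !inE -walkSr inS ?andbT; last by case/andP: kn => _ ?; rewrite ltnS.
    by rewrite -[K in _ != K]/(walk D b 1) (inj_eq (@walk_inj D b)); case: k kn.
  + by rewrite !inE -walkSr (negbTE out) andbF.
  have RE : S `\` run D b n.+2 = (S `\ K) `\` run K b n.+1.
    by apply/fsetP => d; rewrite (runS D) !inE negb_or andbCA andbA.
  rewrite RE; exists (W `\` [fset edge K b] `|` odds K b); split.
    move=> e; rewrite in_fsetU in_fsetD => /orP[/andP[_ /WS//]|/in_odds[i -> ib]].
    rewrite -RE gedges_edge !in_fsetD (_ : nb K i \in S = false) ?andbF ?orbF.
      by rewrite -[K]/(walk D b 1) walk_run.
    by apply/negP => /only E; rewrite -(odd_mod6 i) -(odd_mod6 b) E eqxx in ib.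
  have eN N : N \in pms (S `\ K `\` run K b n.+1) -> edge K b \notin N.
    move=> /pmsP[/fsubsetP NE _]; apply/negP => /NE; rewrite gedges_edge !in_fsetD.
    by rewrite -[nb K b]/(walk K b 1) walk_run !inE eqxx andbF.
  apply/fsetP => M; apply/imfsetP/imfsetP => -[N] /=.
    move=> /imfsetP[N' /= N'S ->] ->; exists N' => //; rewrite fsetDUl fsetUA.
    by congr (_ `|` _ `|` _); apply/fsetDidPl; rewrite fdisjointX1 eN.
  move=> NS ->; exists (N `|` W); first by apply/imfsetP; exists N.
  rewrite fsetDUl fsetUA; congr (_ `|` _ `|` _).
  by apply/esym/fsetDidPl; rewrite fdisjointX1 eN.
Qed.

(** The empty set encodes an absent chain, which imposes no condition on the matching. *)
Definition gate (S : {fset cell}) (D : cell) (b : nat) : {fset {fset cell}} :=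
  if nb D b \in S then [fset edge D b] else fset0.

Lemma chain_gate n S D b : catacondensed (D |` S) -> no_holes S -> D \notin S ->
    (forall k, (0 < k <= n)%N -> walk D b k \in S) -> walk D b n.+1 \notin S ->
  exists W, (forall e, e \in W -> e \notin gedges (S `\` run D b n)) /\
    restr (pms S) (gate S D b) = [fset N `|` W | N in pms (S `\` run D b n)].
Proof.
case: n => [|n] cata nh DS inS out; last first.
  have [W [WS E]] := chain_removal cata nh DS inS out; exists W; split=> //.
  by rewrite /gate [nb D b \in S](inS 1%N).
exists fset0; split=> [e|]; first by rewrite inE.
rewrite /gate [nb D b \in S](negbTE out) restr0 run0 fsetD0.
apply/fsetP => M; apply/idP/imfsetP => [MS|[N /= NS ->]]; last by rewrite fsetU0.
by exists M; rewrite ?fsetU0.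
Qed.

Lemma gedges_sub S S' : S' `<=` S -> gedges S' `<=` gedges S.
Proof.
move=> /fsubsetP sub; apply/fsubsetP => e /in_gedges[c /sub cS E].
by apply/in_gedges; exists c.
Qed.

Lemma Af_chain n S D b : catacondensed (D |` S) -> no_holes S -> D \notin S ->
    (forall k, (0 < k <= n)%N -> walk D b k \in S) -> walk D b n.+1 \notin S ->
  afsum (restr (pms S) (gate S D b)) = Af (S `\` run D b n).
Proof.
move=> cata nh DS inS out; have [W [WS ->]] := chain_gate cata nh DS inS out.
rewrite Af_afsum afsum_translate //; first exact: pms_clutter.
by move=> N e /pmsP[/fsubsetP NE _] /NE eS; apply: contraL eS; apply: WS.
Qed.

Lemma Af_two_chains n m S D b c : catacondensed (D |` S) -> no_holes S -> D \notin S ->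
    (forall k, (0 < k <= n)%N -> walk D b k \in S) -> walk D b n.+1 \notin S ->
    (forall k, (0 < k <= m)%N -> walk D c k \in S `\` run D b n) ->
    walk D c m.+1 \notin S `\` run D b n ->
    nb D c \notin run D b n ->
  afsum (restr (pms S) (gate S D b `|` gate S D c)) = Af (S `\` run D b n `\` run D c m).
Proof.
move=> cata nh DS inS out inS' out' cb.
have [W1 [W1S E1]] := chain_gate cata nh DS inS out.
have sub : S `\` run D b n `<=` S by exact: fsubsetDl.
have sub' : D |` (S `\` run D b n) `<=` D |` S by exact: fsetUS.
have DS' : D \notin S `\` run D b n by apply: contraNN DS => /(fsubsetP sub).
have [W2 [W2S E2]] := chain_gate (cata_sub sub' cata)
  (no_holes_sub sub (cata_sub (fsubsetU1 D S) cata) nh) DS' inS' out'.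
have gE : gate S D c = gate (S `\` run D b n) D c by rewrite /gate in_fsetD cb.
rewrite restrU E1.
have -> : restr [fset N `|` W1 | N in pms (S `\` run D b n)] (gate S D c) =
          [fset N `|` (W2 `|` W1) | N in pms (S `\` run D b n `\` run D c m)].
  have gW N : (gate S D c `<=` N `|` W1) = (gate S D c `<=` N).
    rewrite gE /gate; case: ifP => cS; last by rewrite !fsub0set.
    rewrite !fsub1set inE; apply: orb_idr => /W1S.
    by rewrite gedges_edge cS orbT.
  apply/fsetP => M; rewrite in_restr; apply/andP/imfsetP => /= [[/imfsetP[N /= NS ->]]|].
    rewrite gW gE => gN; have : N \in restr (pms (S `\` run D b n)) (gate (S `\` run D b n) D c).
      by rewrite in_restr NS.
    by rewrite E2 => /imfsetP[N' /= NS' ->]; exists N'; rewrite // fsetUA.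
  case=> N NS ->; rewrite fsetUA gW.
  have : N `|` W2 \in restr (pms (S `\` run D b n)) (gate (S `\` run D b n) D c).
    by rewrite E2; apply/imfsetP; exists N.
  rewrite in_restr -gE => /andP[NW ->]; split=> //.
  by apply/imfsetP; exists (N `|` W2).
rewrite Af_afsum afsum_translate //; first exact: pms_clutter.
move=> N e /pmsP[/fsubsetP NE _] /NE eS; rewrite inE negb_or; apply/andP; split.
  by apply: contraL eS; apply: W2S.
by apply: contraL (fsubsetP (gedges_sub (fsubsetDl _ _)) _ eS); apply: W1S.
Qed.

(** * Tails at a hexagon with a missing neighbour *)

Section SingleTail.
Variables (S : {fset cell}) (h : cell) (a c m : nat).
Hypotheses (cata : catacondensed S) (nh : no_holes S) (br : is_branch S h a m.+1).
Hypothesis free : forall i, odd i != odd a -> nb h i \notin S.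
Hypotheses (ca : odd c = odd a) (c_a : c != a %[mod 6]) (cS : nb h c \notin S).
Let B := S `\` run h a m.+1.

(** The missing neighbour in direction [c] makes [edge h c] unglued, which supplies the twin of the
    edge [edge h a] where the tail starts. *)
Lemma Af_single_tail : let P3 := afsum (restr (pms (B `\ h)) (glued B h a)) in
  Af S = 'X * Af (B `\ h) + 'X * P3
       + ('X * Af B + m%:R * 'X^2 * Af (B `\ h) - 'X^2 * P3).
Proof.
have sub : B `<=` S by exact: fsubsetDl.
have hB : h \in B by rewrite in_fsetD center_run (br.1 0%N).
have freeB i : odd i != odd a -> nb h i \notin B.
  by move=> /free; apply: contraNN; apply: (fsubsetP sub).
have aU : edge h a \in unglued B h a.
  by rewrite in_fsetD evens_edge eqxx gedgesD1_edge -[nb h a]/(walk h a 1) in_fsetD walk_run.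
have cU : edge h c \in unglued B h a.
  rewrite in_fsetD evens_edge ca eqxx gedgesD1_edge andbT.
  by apply: contraNN cS; apply: (fsubsetP sub).
have BE := pms_flip (cata_sub sub cata) (no_holes_sub sub cata nh) hB freeB.
have fr : fresh (pms (B `\ h)) (glued B h a) (unglued B h a) (odds h a).
  by apply: pms_fresh freeB _; apply/fset0Pn; exists (edge h a).
have lad := pms_ladder cata nh br; rewrite -/B BE in lad.
rewrite !Af_afsum BE (afsum_single_tail fr aU cU _ lad) //.
by rewrite edge_eq eq_sym.
Qed.

End SingleTail.

(** * Branched hexagons *)

Lemma mod6_three a b c i : odd b = odd a -> odd c = odd a -> b != a %[mod 6] -> c != a %[mod 6] ->
  c != b %[mod 6] -> odd i = odd a -> [|| i == a %[mod 6], i == b %[mod 6] | i == c %[mod 6]].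
Proof.
have /allP H : all (fun a => all (fun b => all (fun c => all (fun i =>
    [&& odd b == odd a, odd c == odd a, b != a, c != a, c != b & odd i == odd a] ==>
    [|| i == a, i == b | i == c]) (iota 0 6)) (iota 0 6)) (iota 0 6)) (iota 0 6) by [].
have mI j : (j %% 6)%N \in iota 0 6 by rewrite mem_iota ltn_pmod.
rewrite -(odd_mod6 a) -(odd_mod6 b) -(odd_mod6 c) -(odd_mod6 i) => ba ca nba nca ncb ia.
have /allP/(_ _ (mI b))/allP/(_ _ (mI c))/allP/(_ _ (mI i)) := H _ (mI a).
by rewrite ba ca ia nba nca ncb !eqxx.
Qed.

(** Entering the branch along [d] would give one of its cells a neighbour in [S] off the line of the
    branch. *)
Lemma branch_avoid S h a d m l : is_branch S h a m -> odd d = odd a -> d != a %[mod 6] ->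
  walk h d l \in S -> walk h d l.+1 \notin run h a m.
Proof.
move=> [_ only] da d_a dS; apply/runP => -[k km E].
have /(only _ _ km) : nb (walk h a k) (d + 3) \in S by rewrite -E walk_back.
case=> [/eqP|[/(congr1 odd)]]; first by rewrite eqn_modDr (negbTE d_a).
by rewrite !odd_mod6 oddD da addbT; case: (odd a).
Qed.

Lemma unglued1 S K j : (forall i, nb K i \in S -> i = j %[mod 6]) -> nb K j \in S ->
  unglued S K j = [fset edge K (j + 2); edge K (j + 4)].
Proof.
move=> only jS; apply/fsetP => e; rewrite in_fsetD.
apply/andP/fset2P => [[eS]|].
  move=> /in_evens[i E ij]; move: eS; rewrite E gedgesD1_edge => iS.
  have : odd i == odd j by rewrite ij.
  rewrite -mod6_even => /or3P[]/eqP H; [|by left; apply: edge_mod|by right; apply: edge_mod].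
  by rewrite (nb_mod K H) jS in iS.
by case=> ->; rewrite gedgesD1_edge evens_edge oddD addbF eqxx; split=> //;
  apply/negP => /only/eqP; rewrite mod6_add_neq.
Qed.

Lemma in_side K j e : e \in [fset edge K (j + 2); edge K (j + 4)] -> K \in e.
Proof. by move=> /fset2P[]->; exact: center_edge. Qed.

Section DoubleTail.
Variables (S : {fset cell}) (h : cell) (a c d m1 m2 : nat).
Hypotheses (cata : catacondensed S) (nh : no_holes S).
Hypotheses (br1 : is_branch S h a m1.+1) (br2 : is_branch S h c m2.+1).
Hypothesis free : forall i, odd i != odd a -> nb h i \notin S.
Hypotheses (ca : odd c = odd a) (da : odd d = odd a).
Hypotheses (c_a : c != a %[mod 6]) (d_a : d != a %[mod 6]) (d_c : d != c %[mod 6]).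
Hypothesis dS : nb h d \in S.
Let B := S `\` run h a m1.+1 `\` run h c m2.+1.
Let K := nb h c.
Let U3 := [fset edge K (c + 3 + 2); edge K (c + 3 + 4)].
Let O3 := odds K (c + 3).

Let hS : h \in S. Proof. exact: (br1.1 0%N). Qed.
Let subB : B `<=` S.
Proof. exact: fsubset_trans (fsubsetDl _ _) (fsubsetDl _ _). Qed.
Let hB : h \in B. Proof. by rewrite !in_fsetD !center_run. Qed.

Let avoid_c k : (k <= m2.+1)%N -> walk h c k \notin run h a m1.+1.
Proof.
case: k => [|k] km; first exact: center_run.
by apply: (branch_avoid br1) => //; apply: br2.1; exact: ltnW.
Qed.

Let avoid_a k : (k <= m1.+1)%N -> walk h a k \notin run h c m2.+1.
Proof.
case: k => [|k] km; first exact: center_run.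
apply: (branch_avoid br2); rewrite 1?eq_sym //; apply: br1.1; exact: ltnW.
Qed.

Let dB : nb h d \in B.
Proof.
rewrite !in_fsetD dS (branch_avoid (l := 0) br1) // (branch_avoid (l := 0) br2) //.
by rewrite ca.
Qed.

Let freeB i : odd i != odd a -> nb h i \notin B.
Proof. by move=> /free; apply: contraNN; apply: (fsubsetP subB). Qed.

Let onlyB i : nb h i \in B -> i = d %[mod 6].
Proof.
move=> iB; have [ia|/freeB] := eqVneq (odd i) (odd a); last by rewrite iB.
case/or3P: (mod6_three ca da c_a d_a d_c ia) => /eqP E; last by [];
  move: iB; rewrite (nb_mod h E) !in_fsetD.
- by rewrite -[nb h a]/(walk h a 1) walk_run /= andbF.
- by rewrite -[nb h c]/(walk h c 1) walk_run.
Qed.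

Let U1E : unglued B h a = [fset edge h a; edge h c].
Proof.
apply/fsetP => e; rewrite in_fsetD; apply/andP/fset2P => [[eB /in_evens[i E ia]]|].
  case/or3P: (mod6_three ca da c_a d_a d_c ia) => /eqP H; rewrite ?E ?(edge_mod h H);
    [by left|by right|].
  by move: eB; rewrite E gedgesD1_edge (nb_mod h H) dB.
case=> ->; rewrite gedgesD1_edge evens_edge ?ca eqxx; split=> //; apply/negP => /onlyB/eqP;
  by rewrite eq_sym ?(negbTE d_a) ?(negbTE d_c).
Qed.

Let Q1E : glued B h a = [fset edge h d].
Proof.
apply/fsetP => e; rewrite in_fsetI in_fset1; apply/andP/eqP => [[/in_evens[i -> _]]|->].
  by rewrite gedgesD1_edge => /onlyB/edge_mod.
by rewrite evens_edge da eqxx gedgesD1_edge.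
Qed.

Lemma double_tail_pms : pms B = flip (pms (B `\ h)) [fset edge h d] [fset edge h a; edge h c] (odds h a).
Proof.
rewrite -U1E -Q1E; apply: pms_flip => //; first exact: cata_sub subB cata.
exact: no_holes_sub subB cata nh.
Qed.

Lemma double_tail_fresh :
  fresh (pms (B `\ h)) [fset edge h d] [fset edge h a; edge h c] (odds h a).
Proof.
rewrite -U1E -Q1E; apply: pms_fresh => //; rewrite U1E; apply/fset0Pn; exists (edge h a).
by rewrite !inE eqxx.
Qed.

(** The attachment of [K], with the same [U3] and [O3] whether or not the first tail is present;
    this allows the two tails to be built in either order. *)
Let neck S0 : S0 `<=` S -> h \in S0 -> K \in S0 -> ((0 < m2)%N -> nb K c \notin S0) ->
  pms S0 = flip (pms (S0 `\ K)) [fset edge h c] U3 O3 /\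
  fresh (pms (S0 `\ K)) [fset edge h c] U3 O3.
Proof.
move=> sub h0 K0 out.
have only i : nb K i \in S0 -> i = c + 3 %[mod 6].
  move=> i0; have [//|[E]] := br2.2 1%N i isT (fsubsetP sub _ i0).
  by rewrite ltnS => /out; rewrite -(nb_mod K E) i0.
have back : nb K (c + 3) \in S0 by rewrite nb_opp.
have := pms_flip1 (cata_sub sub cata) (no_holes_sub sub cata nh) K0 only back.
by rewrite (unglued1 only back) edge_opp.
Qed.

Lemma Af_double_tail (beta : {poly int}) :
    (forall U2 O2, let V := flip (pms B) [fset edge h c] U3 O3 in
       fresh (pms B) [fset edge h c] U3 O3 -> fresh V [fset edge h a] U2 O2 ->
       \sum_(N <- restr (pms (B `\ h)) [fset edge h d])
         'X^(tau (flip V [fset edge h a] U2 O2) (star (odds h a) U2 U3 (edge h d) N)) = beta) ->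
  Af S = beta + 'X^2 * Af B
    + (3 * 'X^2 + 2 * (m1 + m2)%:R * 'X^3 + (m1 * m2)%:R * 'X^4) * Af (B `\ h)
    - 'X^3 * afsum (restr (pms (B `\ h)) [fset edge h d]).
Proof.
move=> betaE.
(* [X] keeps only the hexagon [K] of the second tail, [V] is [X] without the first tail, and [Y] is
   [S] without the whole second tail. *)
pose X := S `\` run K c m2; pose V := X `\` run h a m1.+1; pose Y := S `\` run h c m2.+1.
have KX : K \in X by rewrite in_fsetD center_run (br2.1 1%N).
have hX : h \in X.
  rewrite in_fsetD hS andbT; apply/runP => -[k _]; rewrite -walkSr.
  by rewrite -[h in h = _]/(walk h c 0) => /walk_inj.
have KV : K \in V by rewrite in_fsetD KX andbT (avoid_c (k := 1)).
have hV : h \in V by rewrite in_fsetD hX center_run.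
have YE : Y = X `\ K.
  apply/fsetP => e; rewrite /Y /X (runS h c) !(in_fsetD, in_fset1U, in_fset1).
  by rewrite -/K; case: (e == K); case: (e \in run K c m2).
have BE : B = V `\ K.
  apply/fsetP => e; rewrite /B /V /X (runS h c) !(in_fsetD, in_fset1U, in_fset1).
  by rewrite -/K; case: (e == K); case: (e \in run K c m2); case: (e \in run h a m1.+1).
have subX : X `<=` S by exact: fsubsetDl.
have subV : V `<=` S by exact: fsubset_trans (fsubsetDl _ _) subX.
have subY : Y `<=` S by exact: fsubsetDl.
have outX : (0 < m2)%N -> nb K c \notin X.
  by move=> m0; rewrite in_fsetD -[nb K c]/(walk K c 1) walk_run m0.
have outV : (0 < m2)%N -> nb K c \notin V by move/outX; apply: contraNN => /fsetDP[].
have [XE frY] := neck subX hX KX outX; have [VE frB] := neck subV hV KV outV.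
rewrite -YE in XE frY; rewrite -BE in VE frB.
have brX : is_branch X h a m1.+1.
  apply: is_branch_sub br1 => // k km; rewrite in_fsetD (br1.1 _ km) andbT.
  by apply: contraNN (avoid_a km) => kr; rewrite runS in_fset1U kr orbT.
have brY : is_branch Y h a m1.+1.
  by apply: is_branch_sub br1 => // k km; rewrite in_fsetD (br1.1 _ km) avoid_a.
have ladX := pms_ladder (cata_sub subX cata) (no_holes_sub subX cata nh) brX.
have ladY := pms_ladder (cata_sub subY cata) (no_holes_sub subY cata nh) brY.
have YB : Y `\` run h a m1.+1 = B.
  by apply/fsetP => e; rewrite !in_fsetD andbCA.
rewrite YB in ladY; rewrite -/V VE in ladX.
have ladG := pms_ladder cata nh (is_branch_tail br2).
rewrite -/K -/X in ladG.
have Ka : K \notin edge h a.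
  by rewrite !inE (negbTE (nb_neq h c)) nb_eq c_a.
have aU : edge h a \in [fset edge h a; edge h c] by rewrite !inE eqxx.
have cU : edge h c \in [fset edge h a; edge h c] by rewrite !inE eqxx orbT.
have ac : edge h a != edge h c by rewrite edge_eq eq_sym.
have aU3 : edge h a \notin U3 by apply: contraNN Ka => /in_side.
have aO3 : edge h a \notin O3 by apply: contraNN Ka => /in_odds[i -> _]; exact: center_edge.
rewrite double_tail_pms in frB VE ladY.
have eO : edge K c \in O3 by rewrite odds_edge oddD addbT; case: (odd c).
have gO : edge K (c + 2) \in O3 by rewrite odds_edge !oddD addbT addbF; case: (odd c).
have ge : edge K (c + 2) != edge K c by rewrite edge_eq mod6_add_neq.
rewrite double_tail_pms in ladX.
rewrite !Af_afsum double_tail_pms; apply: (afsum_double_tail double_tail_fresh aU cU ac frB aU3 aO3 ladX ladY frY XE eO gO ge ladG).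
by move=> U2 O2 fr2; rewrite -double_tail_pms in frB fr2 *; apply: betaE.
Qed.

End DoubleTail.

(** * The two shapes of the third chain *)

Lemma cross_dir i j : cross (dir i) (dir j) = 0 -> i = j %[mod 6] \/ i = j + 3 %[mod 6].
Proof.
rewrite -(dir_mod i) -(dir_mod j) -(modnDml j).
move: (ltn_pmod i (isT : 0 < 6)%N) (ltn_pmod j (isT : 0 < 6)%N).
by case: (i %% 6)%N => [|[|[|[|[|[|]]]]]] //; case: (j %% 6)%N => [|[|[|[|[|[|]]]]]] // _ _ H;
  solve [by left | by right | by []].
Qed.

Lemma walk_cross c i j k l : (0 < k)%N -> walk c i k = walk c j l ->
  i = j %[mod 6] \/ i = j + 3 %[mod 6].
Proof.
move=> k0; rewrite !walkE => -[/addrI E1 /addrI E2]; apply: cross_dir.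
have kn0 : k%:Z != 0 by case: k k0 {E1 E2}.
apply: (mulfI kn0); rewrite mulr0 /cross mulrBr !mulrA E1 E2; ring.
Qed.

Lemma step_avoid S h a m x e : is_branch S h a m -> x \in S -> x != h -> x \notin run h a m ->
  nb x e \notin run h a m.
Proof.
move=> [_ only] xS xh xr; apply/runP => -[l lm E].
have xE : nb (walk h a l) (e + 3) = x by rewrite -E nb_opp.
have /(only _ _ lm) : nb (walk h a l) (e + 3) \in S by rewrite xE.
case=> [/(nb_mod (walk h a l))|[/(nb_mod (walk h a l))]]; rewrite xE => xE'.
  case: l lm xE' {E xE} => [//|l] lm; rewrite walk_back => xE'.
  case: l lm xE' => [|l] lm xE'; first by rewrite xE' eqxx in xh.
  by case/negP: xr; rewrite xE' walk_run /= ltnW.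
by move=> lm'; case/negP: xr; rewrite xE' -[nb _ a]/(walk h a l.+1) walk_run.
Qed.

Section DoubleTailCases.
Variables (S : {fset cell}) (h : cell) (a c d m1 m2 : nat).
Hypotheses (cata : catacondensed S) (nh : no_holes S).
Hypotheses (br1 : is_branch S h a m1.+1) (br2 : is_branch S h c m2.+1).
Hypothesis free : forall i, odd i != odd a -> nb h i \notin S.
Hypotheses (ca : odd c = odd a) (da : odd d = odd a).
Hypotheses (c_a : c != a %[mod 6]) (d_a : d != a %[mod 6]) (d_c : d != c %[mod 6]).
Hypothesis dS : nb h d \in S.
Let B := S `\` run h a m1.+1 `\` run h c m2.+1.
Let H2 := B `\ h.
Let C := nb h d.

Let hS : h \in S. Proof. exact: (br1.1 0%N). Qed.
Let subH2 : H2 `<=` S.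
Proof.
by do 2!(apply: fsubset_trans (fsubsetDl _ _) _); exact: fsubsetDl.
Qed.
Let cataH2 := cata_sub subH2 cata.
Let nhH2 := no_holes_sub subH2 cata nh.

Let in_H2 k : walk h d k.+1 \in S -> walk h d k \in S -> walk h d k.+1 \in H2.
Proof.
move=> kS kS'; rewrite in_fsetD1 !in_fsetD kS (branch_avoid br1) // (branch_avoid br2) ?ca //.
by rewrite -[h in _ != h]/(walk h d 0) (inj_eq (@walk_inj h d)).
Qed.

Let CH2 : C \in H2. Proof. exact: (in_H2 (k := 0)). Qed.
Let back : nb C (d + 3) = h. Proof. exact: nb_opp. Qed.
Let hH2 : h \notin H2. Proof. by rewrite !inE eqxx. Qed.
Let C4 : nb C (d + 4) \notin S.
Proof.
by have := cata_nb cata (i := d + 3) dS; rewrite -addnS; apply; rewrite back.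
Qed.
Let C2 : nb C (d + 2) \notin S.
Proof.
have := cata_nb' cata (i := d + 3) dS; rewrite back => /(_ hS).
by rewrite (@nb_mod C (d + 3 + 5) (d + 2)) // -addnA -[(3 + 5)%N]/(2 + 6)%N addnA modnDr.
Qed.
Let x4E : edge C (d + 3) = edge h d. Proof. exact: edge_opp. Qed.

Lemma afsum_third_tail n : (forall k, (0 < k <= n)%N -> walk h d k \in S) ->
    walk h d n.+1 \notin S -> (0 < n)%N ->
  afsum (restr (pms H2) [fset edge h d]) = Af (H2 `\` run h d n).
Proof.
move=> inS out n0; have -> : [fset edge h d] = gate H2 h d by rewrite /gate -/C CH2.
apply: Af_chain => //.
- apply: cata_sub cata; apply/fsubsetP => e; rewrite in_fset1U => /orP[/eqP->//|].
  exact: (fsubsetP subH2).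
- move=> [//|k] kn; apply: in_H2; first exact: inS.
  by case: k kn => [_|k /andP[_ kn]]; [exact: hS | apply: inS; exact: ltnW].
- by apply: contraNN out; apply: (fsubsetP subH2).
Qed.

Let formula beta := beta + 'X^2 * Af B
    + (3 * 'X^2 + 2 * (m1 + m2)%:R * 'X^3 + (m1 * m2)%:R * 'X^4) * Af H2
    - 'X^3 * afsum (restr (pms H2) [fset edge h d]).

Let ac : edge h a != edge h c. Proof. by rewrite edge_eq eq_sym. Qed.
Let aU : edge h a \in [fset edge h a; edge h c]. Proof. by rewrite !inE eqxx. Qed.
Let cU : edge h c \in [fset edge h a; edge h c]. Proof. by rewrite !inE eqxx orbT. Qed.
Let fr1 : fresh (pms H2) [fset edge h d] [fset edge h a; edge h c] (odds h a).
Proof. exact: double_tail_fresh. Qed.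

(** [C] continues straight, so [edge h d] is an odd edge of [C] and switching [C] back removes it
    without touching anything else, as [star_sum_far] demands. *)
Lemma Af_double_far : nb C d \in S ->
  Af S = formula ('X^2 * afsum (restr (pms H2) [fset edge h d])).
Proof.
move=> CdS; apply: Af_double_tail => // U2 O2 V frB fr2.
have C1 : nb C (d + 1) \notin S by have := cata_nb cata dS CdS; rewrite -addn1.
have C5 : nb C (d + 5) \notin S by exact: cata_nb' cata dS CdS.
have only i : nb C i \in H2 -> i = d %[mod 6].
  move=> iH; have iS := fsubsetP subH2 _ iH.
  have := mod6_cases i d; rewrite !orbA => /orP[|/eqP E]; last by rewrite (nb_mod C E) (negbTE C5) in iS.
  rewrite -!orbA => /or4P[|||/orP[]] /eqP E //; rewrite (nb_mod C E) in iS iH.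
  - by rewrite iS in C1.
  - by have := C2; rewrite iS.
  - by rewrite back (negbTE hH2) in iH.
  - by have := C4; rewrite iS.
have CdH : nb C d \in H2 by apply: (in_H2 (k := 1)).
have [FE fr] := pms_flip1 cataH2 nhH2 CH2 only CdH.
have eO : edge h d \in odds C d by rewrite -x4E odds_edge oddD addbT; case: (odd d).
have pB : pms B = flip (pms H2) [fset edge h d] [fset edge h a; edge h c] (odds h a).
  exact: double_tail_pms.
move: frB fr2; rewrite /V pB => frB fr2.
apply: (star_sum_far fr1 aU cU ac frB fr2 erefl) => N; rewrite FE => NF xN.
exact: flip_far fr eO _ NF xN.
Qed.

(** [C] ends the third chain, so [edge h d] is an even edge of [C] and [edge C d] an odd one: every
    matching of [H2] uses exactly one of them. The matchings through [edge C d] are forced along the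
    chains leaving [C] sideways. *)
Lemma Af_double_near n1 n2 : nb C d \notin S ->
    (forall k, (0 < k <= n1)%N -> walk C (d + 1) k \in S) -> walk C (d + 1) n1.+1 \notin S ->
    (forall k, (0 < k <= n2)%N -> walk C (d + 5) k \in S) -> walk C (d + 5) n2.+1 \notin S ->
  Af S = formula ('X * Af H2 -
    'X^2 * Af (H2 `\ C `\` run C (d + 1) n1 `\` run C (d + 5) n2)).
Proof.
move=> CdS in1 out1 in2 out2.
pose H3 := H2 `\ C.
have freeC i : odd i != odd (d + 3) -> nb C i \notin H2.
  move=> id; have : odd i == odd d by move: id; rewrite oddD addbT; case: (odd i); case: (odd d).
  rewrite -mod6_even => /or3P[]/eqP/(nb_mod C)->; apply: contraNN (fsubsetP subH2 _) _ => //.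
have FE := pms_flip cataH2 nhH2 CH2 freeC.
have uU : edge h d \in unglued H2 C (d + 3).
  by rewrite -x4E in_fsetD evens_edge eqxx gedgesD1_edge back hH2.
have fr : fresh (pms H3) (glued H2 C (d + 3)) (unglued H2 C (d + 3)) (odds C (d + 3)).
  by apply: pms_fresh freeC _; apply/fset0Pn; exists (edge h d).
have vO : edge C d \in odds C (d + 3).
  by rewrite odds_edge oddD addbT; case: (odd d).
have inH3 i : (nb C i \in H3) = (nb C i \in H2) by rewrite in_fsetD1 nb_neq.
have glueE : glued H2 C (d + 3) = gate H3 C (d + 1) `|` gate H3 C (d + 5).
  have gateP e i : (e \in gate H3 C i) = (e == edge C i) && (nb C i \in H2).
    by rewrite /gate inH3; case: ifP; rewrite inE ?andbT ?andbF.
  have d7 : d + 3 + 4 = d + 1 %[mod 6] by rewrite -addnA -[(3 + 4)%N]/(1 + 6)%N addnA modnDr.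
  apply/fsetP => e; rewrite in_fsetU !gateP in_fsetI; apply/andP/orP => [[/in_evens[i -> iP]]|].
    rewrite gedgesD1_edge => iH; have : odd i == odd (d + 3) by rewrite iP.
    rewrite -mod6_even => /or3P[]/eqP E.
    - by rewrite (nb_mod C E) back (negbTE hH2) in iH.
    - have {}E : i = d + 5 %[mod 6] by rewrite E -addnA.
      by right; rewrite (edge_mod C E) eqxx -(nb_mod C E).
    - by left; rewrite (edge_mod C (etrans E d7)) eqxx -(nb_mod C (etrans E d7)).
  by case=> /andP[/eqP-> iH]; rewrite evens_edge gedgesD1_edge iH !oddD !addbT ?addbF.
(* The side chains stay off [h] and off both tails, so they survive in [H3]. *)
have side e k : e != d + 3 %[mod 6] -> e != d + 3 + 3 %[mod 6] ->
    (forall l, (0 < l <= k)%N -> walk C e l \in S) -> (0 < k)%N -> walk C e k \in H3.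
  move=> e3 e6 inS k0.
  have nh' l : walk C e l != h.
    apply/eqP; rewrite -back; case: l => [/eqP|l E]; first by rewrite eq_sym (negbTE (nb_neq _ _)).
    by have [|/eqP|/eqP] := @walk_cross C e (d + 3) l.+1 1 _ E; rewrite ?(negbTE e3) ?(negbTE e6).
  have inS' l : (l <= k)%N -> walk C e l \in S by case: l => [_|l lk]; [exact: dS | exact: inS].
  have off m b : is_branch S h b m -> C \notin run h b m ->
      forall l, (l <= k)%N -> walk C e l \notin run h b m.
    move=> br Cb; elim=> [//|l IH] lk; apply: (step_avoid _ br); rewrite ?nh' ?inS' ?IH // ltnW //.
  have [Ca Cc] : C \notin run h a m1.+1 /\ C \notin run h c m2.+1.
    by have := CH2; rewrite in_fsetD1 !in_fsetD => /and4P[].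
  rewrite !in_fsetD1 !in_fsetD nh' inS' // (off _ _ br1) // (off _ _ br2) //.
  by rewrite -[C in _ != C]/(walk C e 0) (inj_eq (@walk_inj C e)) -lt0n k0.
have subH3 : H3 `<=` S by exact: fsubset_trans (fsubsetDl _ _) subH2.
have side1 := side (d + 1)%N; rewrite -addnA !eqn_modDl in side1.
have side5 := side (d + 5)%N; rewrite -addnA !eqn_modDl in side5.
have disj k l : (0 < k)%N -> walk C (d + 5) k != walk C (d + 1) l.
  by move=> k0; apply/eqP => /(walk_cross k0)[]/eqP; rewrite -?addnA eqn_modDl.
have two : afsum (restr (pms H3) (glued H2 C (d + 3))) =
    Af (H3 `\` run C (d + 1) n1 `\` run C (d + 5) n2).
  rewrite glueE; apply: Af_two_chains.
  - apply: cata_sub cata; apply/fsubsetP => e; rewrite in_fset1U => /orP[/eqP->//|].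
    exact: (fsubsetP subH3).
  - exact: no_holes_sub subH3 cata nh.
  - by rewrite !inE eqxx.
  - move=> k /andP[k0 kn]; apply: side1 => // l /andP[l0 lk]; apply: in1.
    by rewrite l0 (leq_trans lk).
  - by apply: contraNN out1; apply: (fsubsetP subH3).
  - move=> k /andP[k0 kn]; rewrite in_fsetD; apply/andP; split.
      by apply/runP => -[l _ /eqP]; rewrite (negbTE (disj _ _ k0)).
    by apply: side5 => // l /andP[l0 lk]; apply: in2; rewrite l0 (leq_trans lk).
  - by rewrite in_fsetD negb_and; apply/orP; right; apply: contraNN out2; apply: (fsubsetP subH3).
  - by apply/runP => -[l _ /eqP]; rewrite (negbTE (disj 1%N _ isT)).
apply: Af_double_tail => // U2 O2 V frB fr2; rewrite -two.
have pB : pms B = flip (pms H2) [fset edge h d] [fset edge h a; edge h c] (odds h a).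
  exact: double_tail_pms.
move: frB fr2; rewrite /V pB => frB fr2.
rewrite (star_sum_near fr1 aU cU ac frB fr2 erefl (v := edge C d)); last first.
  by move=> N; rewrite FE; apply: flip_even_or_odd fr uU vO N.
by rewrite Af_afsum FE (sum_flip_odd fr vO) mulrA.
Qed.
End DoubleTailCases.

(** * Maximal linear chains *)

Definition chain (h : cell) (i n : nat) : seq cell := [seq walk h i k | k <- iota 0 n].

Lemma size_chain h i n : size (chain h i n) = n.
Proof. by rewrite size_map size_iota. Qed.

Lemma chain_mod h i j n : i = j %[mod 6] -> chain h i n = chain h j n.
Proof. by move=> E; apply: eq_map => k; apply: walk_mod. Qed.

Lemma chainP h i n d : reflect (exists2 k, (k < n)%N & d = walk h i k) (d \in chain h i n).
Proof.
by apply: (iffP mapP) => -[k kn ->]; exists k; rewrite // mem_iota in kn *.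
Qed.

Lemma chainS h i n : chain h i n.+1 = h :: chain (nb h i) i n.
Proof.
rewrite /chain /= -[1%N]/(1 + 0)%N iotaDl -map_comp; congr (_ :: _).
by apply: eq_map => k /=; rewrite -walkSr.
Qed.

Lemma last_chain d h i n : last d (chain h i n.+1) = walk h i n.
Proof. by rewrite (last_nth d) size_chain /= (nth_map 0%N) ?size_iota // nth_iota. Qed.

Lemma hexset_chain h i n : hexset (chain h i n.+1) = h |` run h i n.
Proof.
apply/fsetP => d; rewrite in_fset1U in_fset; apply/chainP/orP => [[[|k] kn ->]|].
- by left.
- by right; rewrite walk_run.
- by case=> [/eqP->|/runP[k /andP[_ kn] ->]]; [exists 0%N | exists k].
Qed.

Lemma subc_walk h i k j : subc (nb (walk h i k) j) h = addc (k%:Z * (dir i).1, k%:Z * (dir i).2) (dir j).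
Proof. by rewrite walkE; apply: cell_eq; rewrite /=; ring. Qed.

(** Collinearity leaves only the current direction or its opposite, and the opposite would revisit
    the previous cell. *)
Lemma path_walk x i k t : path adjc (walk x i k.+1) t ->
    walk x i k \notin t -> uniq (walk x i k.+1 :: t) ->
    (forall z, z \in t -> cross (dir i) (subc z x) = 0) ->
  t = [seq walk x i l | l <- iota k.+2 (size t)].
Proof.
elim: t k => [//|z t IH] k /andP[/adjcP[j zE] pt] + /andP[+ /andP[zt ut]] col.
rewrite !inE !negb_or => /andP[zk _] /andP[_ kt].
have : cross (dir i) (dir j) = 0.
  have := col z; rewrite inE eqxx => /(_ isT); rewrite zE subc_walk => <-.
  by rewrite /cross /=; ring.
case/cross_dir => E; last first.
  by case/eqP: zk; rewrite zE -(nb_mod _ (_ : i + 3 = j %[mod 6])) ?walk_back // -modnDml E modnDml -addnA modnDr.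
have {}zE : z = walk x i k.+2 by rewrite walkS zE; apply: nb_mod.
have {}IH := IH k.+1; rewrite -zE in IH; rewrite {1}zE; congr (_ :: _); apply: IH => //.
- by rewrite /= zt.
- by move=> y yt; apply: col; rewrite inE yt orbT.
Qed.

Lemma linchain_walk S s : linchain S s ->
  exists i, s = chain (head c0 s) i (size s) /\ forall k, (k < size s)%N -> walk (head c0 s) i k \in S.
Proof.
case: s => [//|x s] /and4P[us /allP inS ps col].
suff [i E] : exists i, x :: s = chain x i (size s).+1.
  exists i; split=> // k ks; apply: inS; rewrite E; apply/chainP; by exists k.
case: s us ps col {inS} => [|y t] us ps col; first by exists 0%N.
move: ps; rewrite /= => /andP[/adjcP[i yE] pt]; exists i.
have col' z : z \in t -> cross (dir i) (subc z x) = 0.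
  move=> zt; move/allP: col => /(_ x); rewrite inE eqxx => /(_ isT)/allP/(_ y).
  rewrite !inE eqxx orbT => /(_ isT)/allP/(_ z); rewrite !inE zt !orbT => /(_ isT)/eqP.
  by rewrite yE (subc_walk x i 0 i); congr (cross _ _ = _); apply: cell_eq; rewrite /= mul0r add0r.
rewrite chainS /= chainS -yE; congr [:: _, _ & _].
have := @path_walk x i 0 t; rewrite -[walk x i 1]/(nb x i) -yE => H.
rewrite {1}H //.
- rewrite /chain -[2%N]/(2 + 0)%N iotaDl -map_comp; apply: eq_map => k /=.
  by rewrite yE -!walkSr.
- by move: us; rewrite /= inE negb_or => /andP[/andP[]].
- by move: us => /andP[].
Qed.

Lemma chain_linchain S h i n : (forall k, (k <= n)%N -> walk h i k \in S) ->
  linchain S (chain h i n.+1).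
Proof.
move=> inS; have -> : linchain S (chain h i n.+1) = [&& uniq (chain h i n.+1),
    all (fun c => c \in S) (chain h i n.+1), path adjc h (chain (nb h i) i n) &
    collinear (chain h i n.+1)] by rewrite chainS.
apply/and4P; split.
- by rewrite map_inj_uniq ?iota_uniq //; apply: walk_inj.
- by apply/allP => d /chainP[k kn ->]; apply: inS.
- elim: n h {inS} => [//|n IH] h; rewrite chainS; apply/andP; split; last exact: IH.
  exact: adjc_nb.
- apply/allP => x /chainP[p _ ->]; apply/allP => y /chainP[q _ ->].
  by apply/allP => z /chainP[r _ ->]; rewrite !walkE /cross /=; apply/eqP; ring.
Qed.

(** Two cells fix the direction, and maximality says that neither end can be prolonged. *)
Lemma maxchain_walk S s h : maxchain S s -> head h s = h -> (1 < size s)%N ->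
  exists i, [/\ s = chain h i (size s), forall k, (k < size s)%N -> walk h i k \in S,
                walk h i (size s) \notin S & nb h (i + 3) \notin S].
Proof.
move=> [lin max] hs s1; have [i [E inS]] := linchain_walk lin.
have hE : head c0 s = h by case: s hs s1 {lin max E inS}.
rewrite hE in E inS; exists i; split=> //.
- apply/negP => out; have := max (chain h i (size s).+1).
  rewrite size_chain ltnn => H; suff : false by []; apply: H.
    by apply: chain_linchain => k; rewrite leq_eqVlt => /predU1P[->//|]; apply: inS.
  by move=> d; rewrite {1}E => /chainP[k ks ->]; apply/chainP; exists k; rewrite // ltnW.
- apply/negP => out; have := max (chain (nb h (i + 3)) i (size s).+1).
  rewrite size_chain ltnn => H; suff : false by []; apply: H.
    by apply: chain_linchain => -[//|k] ks; rewrite walkSr nb_opp'; apply: inS.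
  move=> d; rewrite {1}E => /chainP[k ks ->]; apply/chainP; exists k.+1 => //.
  by rewrite walkSr nb_opp'.
Qed.

Lemma line_nb h a k l i : nb (walk h a k) i = walk h a l ->
  i = a %[mod 6] /\ l = k.+1 \/ i = a + 3 %[mod 6] /\ k = l.+1.
Proof.
move=> E; have : cross (dir a) (dir i) = 0.
  move: (E); rewrite !walkE => -[E1 E2].
  have {}E1 : (dir i).1 = (l%:Z - k%:Z) * (dir a).1.
    by apply: (addrI (h.1 + k%:Z * (dir a).1)); rewrite E1; ring.
  have {}E2 : (dir i).2 = (l%:Z - k%:Z) * (dir a).2.
    by apply: (addrI (h.2 + k%:Z * (dir a).2)); rewrite E2; ring.
  by rewrite /cross E1 E2; ring.
case/cross_dir => ai; [left|right].
  split; first exact: esym ai.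
  by apply: (@walk_inj h a); rewrite -E walkS; apply: nb_mod.
have {}ai : i = a + 3 %[mod 6] by rewrite -[in RHS]modnDml ai modnDml -addnA modnDr.
by split=> //; apply: (@walk_inj h a); rewrite walkS -E (nb_mod _ ai) nb_opp'.
Qed.

(** An inner cell has both line neighbours, and catacondensation excludes all others; the last cell
    is terminal, so its predecessor is its only neighbour. *)
Lemma branch_of_chain S h a m : catacondensed S ->
    (forall k, (k <= m.+1)%N -> walk h a k \in S) -> terminal S (walk h a m.+1) ->
  is_branch S h a m.+1.
Proof.
move=> cata inS term; split=> // -[//|k] i /andP[_ km] iS.
have back : nb (walk h a k.+1) (a + 3) \in S by rewrite walk_back inS // ltnW.
have kS : walk h a k.+1 \in S by exact: inS.
move: km; rewrite leq_eqVlt => /predU1P[E|km]; last first.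
  have next : nb (walk h a k.+1) a \in S by exact: (inS k.+2).
  have := mod6_cases i a; rewrite !orbA => /orP[|/eqP E]; last first.
    by have := cata_nb' cata kS next; rewrite -(nb_mod _ E) iS.
  rewrite -!orbA => /or4P[|||/orP[]] /eqP E.
  - by right.
  - by have := cata_nb cata kS next; rewrite -[a.+1]addn1 -(nb_mod _ E) iS.
  - have := cata_nb' cata kS back; rewrite (@nb_mod _ (a + 3 + 5) i) ?iS //.
    by rewrite E -addnA -[(3 + 5)%N]/(2 + 6)%N addnA modnDr.
  - by left.
  - by have := cata_nb cata kS back; rewrite -addnS -(nb_mod _ E) iS.
rewrite -E in term; left; case/andP: term => _ /orP[/cardfs1P[x xE]|/eqP SE].
  have mem j : nb (walk h a k.+1) j \in S -> nb (walk h a k.+1) j = x.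
    by move=> jS; apply/fset1P; rewrite -xE !inE jS adjc_nb.
  by apply: (@nb_inj (walk h a k.+1)); rewrite (mem _ iS) (mem _ back).
by move: back; rewrite [in X in X -> _]SE inE (negbTE (nb_neq _ _)).
Qed.

Lemma branch_of_line h a m : is_branch (h |` run h a m) h a m.
Proof.
have inP d : reflect (exists2 k, (k <= m)%N & d = walk h a k) (d \in h |` run h a m).
  apply: (iffP (fset1UP _ _ _)) => [[->|/runP[k /andP[_ km] ->]]|[[|k] km ->]].
  - by exists 0%N.
  - by exists k.
  - by left.
  - by right; rewrite walk_run.
split=> [k km|k i km /inP[l lm /line_nb[[? E]|[? E]]]]; first by apply/inP; exists k.
- by right; rewrite -E.
- by left.
Qed.

Lemma walk_rev h a p k : (k <= p)%N -> walk (walk h a p) (a + 3) k = walk h a (p - k).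
Proof.
elim: k => [|k IH] kp; first by rewrite subn0.
by rewrite walkS IH 1?ltnW // -(subnSK kp) walk_back.
Qed.

Lemma chain_rev h a p : rev (chain h a p.+1) = chain (walk h a p) (a + 3) p.+1.
Proof.
apply: (@eq_from_nth _ c0) => [|k]; rewrite size_rev !size_chain // => kp.
have pk : (p - k < p.+1)%N by rewrite ltnS leq_subr.
rewrite nth_rev ?size_chain // subSS /chain !(nth_map 0%N) ?size_iota //.
by rewrite !nth_iota // walk_rev.
Qed.

Lemma hexset_rev s : hexset (rev s) = hexset s.
Proof. by apply/fsetP => d; rewrite !in_fset mem_rev. Qed.

Lemma run_length (S : {fset cell}) C j : exists n,
  (forall k, (0 < k <= n)%N -> walk C j k \in S) /\ walk C j n.+1 \notin S.
Proof.
have [n out] : exists n, walk C j n.+1 \notin S.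
  have [/allP all|/allPn[d /chainP[k _ ->] dS]] :=
    boolP (all (fun d => d \in S) (chain (nb C j) j #|` S|.+1)); last first.
    by exists k; rewrite walkSr.
  have := uniq_leq_size _ all; rewrite size_chain ltnn => H.
  by suff: false by []; apply: H; rewrite map_inj_uniq ?iota_uniq //; apply: walk_inj.
have ex : exists n, walk C j n.+1 \notin S by exists n.
exists (ex_minn ex); case: ex_minnP => m mS min; split=> // -[//|k] /andP[_ km].
by apply: contraT => /min; rewrite leqNgt km.
Qed.

(** As the cell opposite to [j] is missing, [C] is an end of [l]; the list may be written from
    either end, hence the two cases. *)
Lemma maxchain_through S l C j n : maxchain S l -> C \in l -> nb C j \in l ->
    nb C (j + 3) \notin S -> (forall k, (0 < k <= n)%N -> walk C j k \in S) ->
    walk C j n.+1 \notin S ->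
  hexset l = C |` run C j n.
Proof.
move=> max Cl jl back inS out.
have l1 : (1 < size l)%N.
  case: l Cl jl {max} => [//|x [|//]]; rewrite !inE => /eqP-> /eqP E.
  by have := nb_neq x j; rewrite E eqxx.
have [x xE] : exists x, head x l = x by case: l Cl {max jl l1} => [//|x l] _; exists x.
have [i [lE lS lout lback]] := maxchain_walk max xE l1.
move: (size l) l1 lE lS lout => N N1 lE lS lout.
move: Cl jl; rewrite lE => /chainP[p pN CE] /chainP[q qN]; rewrite CE => /line_nb[[ji qE]|[ji pE]].
  have p0 : p = 0%N.
    case: p pN CE qE => // p pN CE _; case/negP: back.
    by rewrite CE (@nb_mod _ (j + 3) (i + 3)) ?walk_back ?lS // 1?ltnW // -modnDml ji modnDml.
  rewrite p0 /= in CE; rewrite p0 /= -CE.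
  have wE k : walk C j k = walk x i k by rewrite CE; apply: walk_mod.
  have NE : N = n.+1.
    apply/eqP; rewrite eqn_leq; apply/andP; split; rewrite leqNgt; apply/negP => lt.
      by case/negP: out; rewrite wE lS.
    by case/negP: lout; rewrite -wE inS // (ltnW N1) /=.
  rewrite NE hexset_chain; congr (_ |` _).
  by apply/fsetP => d; apply/runP/runP => -[k kn ->]; exists k => //; apply/walk_mod.
have ij : i = j + 3 %[mod 6] by rewrite -modnDml ji modnDml -addnA modnDr.
have pN' : N = p.+1.
  apply/eqP; rewrite eqn_leq pN andbT leqNgt; apply/negP => lt; case/negP: back.
  by rewrite CE -(nb_mod _ ij); apply: (lS p.+1).
have wE k : (k <= p)%N -> walk C j k = walk x i (p - k).
  by move=> kp; rewrite CE (walk_mod _ _ ji) walk_rev.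
have pn : p = n.
  apply/eqP; rewrite eqn_leq; apply/andP; split; rewrite leqNgt; apply/negP => lt.
    by case/negP: out; rewrite wE // lS // pN' ltnS leq_subr.
  case/negP: lback; have := inS p.+1; rewrite lt => /(_ isT); rewrite walkS wE // subnn.
  by rewrite (nb_mod _ ji).
rewrite pN' -hexset_rev chain_rev -CE hexset_chain pn; congr (_ |` _).
by apply/fsetP => d; apply/runP/runP => -[k kn ->]; exists k => //; apply/walk_mod; rewrite ji.
Qed.

Lemma free_dirs S h i : catacondensed S -> h \in S -> nb h i \in S -> nb h (i + 3) \notin S ->
  forall k, odd k != odd i -> nb h k \notin S.
Proof.
move=> cata hS iS back k ki; have : odd k == odd (i + 1).
  by rewrite oddD addbT; case: (odd k) (odd i) ki => [] [].
rewrite -mod6_even -!addnA => /or3P[]/eqP/(nb_mod h)->.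
- by have := cata_nb cata hS iS; rewrite -[i.+1]addn1.
- exact: back.
- exact: cata_nb' cata hS iS.
Qed.

Lemma ray_dirs S h i j n1 n2 : catacondensed S -> h \in S ->
    (forall k, (k < n1.+2)%N -> walk h i k \in S) -> walk h i n1.+2 \notin S ->
    (forall k, (k < n2.+2)%N -> walk h j k \in S) -> walk h j n2.+2 \notin S ->
    nb h (i + 3) \notin S -> chain h i n1.+2 <> chain h j n2.+2 ->
  odd j = odd i /\ j != i %[mod 6].
Proof.
move=> cata hS iS iout jS jout back ne; split.
  apply/eqP; apply: contraT => ji; have := free_dirs cata hS (iS 1%N isT) back ji.
  by rewrite [nb h j \in S](jS 1%N).
apply/eqP => E; apply: ne; rewrite (chain_mod h _ E); congr chain.
apply/eqP; rewrite eqn_leq; apply/andP; split; rewrite leqNgt; apply/negP => lt.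
  by case/negP: jout; rewrite (walk_mod h _ E) iS.
by case/negP: iout; rewrite -(walk_mod h _ E) jS.
Qed.

Lemma third_dir a b : odd b = odd a -> b != a %[mod 6] ->
  exists c, [/\ odd c = odd a, c != a %[mod 6] & c != b %[mod 6]].
Proof.
move=> ba b_a; have : odd b == odd a by rewrite ba.
rewrite -mod6_even (negbTE b_a) /= => /orP[]/eqP E.
  by exists (a + 4)%N; rewrite oddD addbF mod6_add_neq // E eqn_modDl.
by exists (a + 2)%N; rewrite oddD addbF mod6_add_neq // E eqn_modDl.
Qed.

(** * Formulas for kinks, lines and a single hexagon *)

Lemma Af_kink S h a b c m n : catacondensed S -> no_holes S -> is_branch S h a m.+1 ->
    (forall i, odd i != odd a -> nb h i \notin S) ->
    odd b = odd a -> odd c = odd a -> b != a %[mod 6] -> c != a %[mod 6] -> c != b %[mod 6] ->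
    nb h c \notin S ->
    (forall k, (k < n.+2)%N -> walk h b k \in S) -> walk h b n.+2 \notin S ->
  let B := S `\` run h a m.+1 in let A3 := Af (B `\ h `\` run h b n.+1) in
  Af S = 'X * Af (B `\ h) + 'X * A3
       + ('X * Af B + m%:R * 'X^2 * Af (B `\ h) - 'X^2 * A3).
Proof.
move=> cata nh br free ba ca b_a c_a c_b cS bS bout B A3.
have sub : B `<=` S by exact: fsubsetDl.
have sub' : B `\ h `<=` S by exact: fsubset_trans (fsubsetDl _ _) sub.
have hS : h \in S by exact: (br.1 0%N).
have off k : (k < n.+1)%N -> walk h b k.+1 \in B `\ h.
  move=> kn; rewrite in_fsetD1 in_fsetD bS // (branch_avoid br) ?bS // ?ltnS 1?ltnW //.
  by rewrite -[h in _ != h]/(walk h b 0) (inj_eq (@walk_inj h b)).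
have glueE : glued B h a = gate (B `\ h) h b.
  rewrite /gate [nb h b \in _](off 0%N) //.
  apply/fsetP => e; rewrite in_fsetI in_fset1; apply/andP/eqP => [[/in_evens[i -> ia]]|->].
    rewrite gedgesD1_edge => iB; apply: edge_mod.
    case/or3P: (mod6_three ba ca b_a c_a c_b ia) => /eqP E //; move: iB; rewrite (nb_mod h E).
      by rewrite in_fsetD -[nb h a]/(walk h a 1) walk_run.
    by move/(fsubsetP sub); rewrite (negbTE cS).
  rewrite evens_edge ba eqxx gedgesD1_edge; split=> //.
  by have := off 0%N isT; rewrite in_fsetD1 => /andP[].
rewrite (Af_single_tail cata nh br free ca c_a cS) glueE -/B (@Af_chain n.+1) //.
- apply: cata_sub cata; apply/fsubsetP => e; rewrite in_fset1U => /orP[/eqP->//|].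
  exact: (fsubsetP sub').
- exact: no_holes_sub sub' cata nh.
- by rewrite !inE eqxx.
- by move=> [//|k] kn; apply: off.
- by apply: contraNN bout; apply: (fsubsetP sub').
Qed.

Lemma Af_line h a m : let S := h |` run h a m.+1 in catacondensed S -> no_holes S ->
  Af S = 'X * Af fset0 + 'X * Af fset0
       + ('X * Af [fset h] + m%:R * 'X^2 * Af fset0 - 'X^2 * Af fset0).
Proof.
move=> S cata nh; have br : is_branch S h a m.+1 by exact: branch_of_line.
have only i : nb h i \in S -> i = a %[mod 6].
  rewrite /S in_fset1U (negbTE (nb_neq h i)) => /runP[k km E].
  by have := @line_nb h a 0 k i E; case=> [[]|[_]].
have aS : nb h a \in S by rewrite in_fset1U -[nb h a]/(walk h a 1) walk_run orbT.
have free i : odd i != odd a -> nb h i \notin S.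
  by move=> ia; apply/negP => /only E; rewrite -(odd_mod6 i) E odd_mod6 eqxx in ia.
have cS : nb h (a + 2) \notin S by apply/negP => /only/eqP; rewrite mod6_add_neq.
have BE : S `\` run h a m.+1 = [fset h].
  apply/fsetP => d; rewrite in_fsetD in_fset1U in_fset1; have [->|] := eqVneq d h.
    by rewrite center_run.
  by case: (d \in run h a m.+1).
have ca : odd (a + 2) = odd a by rewrite oddD addbF.
have c_a : a + 2 != a %[mod 6] by rewrite mod6_add_neq.
rewrite (Af_single_tail cata nh br free ca c_a cS) BE fsetDv.
suff -> : glued [fset h] h a = fset0 by rewrite restr0 -Af_afsum.
apply/fsetP => e; rewrite in_fsetI fsetDv [in RHS]inE andbC.
by apply/negP => /andP[/in_gedges[d]]; rewrite inE.
Qed.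

Lemma Af_hexagon h : no_holes [fset h] -> Af [fset h] = 'X * Af fset0 + 'X * Af fset0.
Proof.
move=> nh; have cata : catacondensed [fset h].
  by move=> c1 c2 c3 v /fset1P-> /fset1P->; rewrite eqxx.
have free i : odd i != odd 0 -> nb h i \notin [fset h].
  by rewrite inE nb_neq.
have glueE : glued [fset h] h 0 = fset0.
  apply/fsetP => e; rewrite in_fsetI fsetDv [in RHS]inE andbC.
  by apply/negP => /andP[/in_gedges[d]]; rewrite inE.
have hS : h \in [fset h] by rewrite inE.
have fr : fresh (pms ([fset h] `\ h)) (glued [fset h] h 0) (unglued [fset h] h 0) (odds h 0).
  apply: pms_fresh free _; apply/fset0Pn; exists (edge h 0).
  by rewrite in_fsetD evens_edge eqxx gedgesD1_edge inE nb_neq.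
rewrite !Af_afsum (pms_flip cata nh hS free) (afsum_flip_all fr) ?fsetDv; first by ring.
by move=> N _; rewrite glueE fsub0set.
Qed.

(** The vertical edge of [C] away from [h] is [edge C d]; the edges touching it are those at [d + 1]
    and [d + 5]. *)
Lemma u_sharedP S h d u K' : let C := nb h d in u_shared S [:: h; C] u K' ->
  exists2 j, j = (d + 1)%N \/ j = (d + 5)%N & nb C j \in S /\ K' = nb C j.
Proof.
move=> C; rewrite /u_shared /chain_end /=.
case=> v [vv _ hv [uC uv /hasP[t tC /andP[ut vt]]] [K'S K'C uK']].
have vE : v = edge C d.
  move: vv hv => /fset2P[->|->] //; rewrite !inE /chain_step /=.
    by rewrite /edge /nb /C; move=> _; congr [fset _; addc _ _]; apply: cell_eq; rewrite /= addrAC subrr add0r.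
  rewrite (_ : subc C (subc C h) = h) ?eqxx ?orbT //.
  by apply: cell_eq; rewrite /= opprB addrCA subrr addr0.
have [j uE] := in_hexedges _ _ uC; have [i tE] := in_hexverts _ _ tC.
have K'E : K' = nb C j.
  have [k kE] := in_hexedges _ _ uK'; have : K' \in u by rewrite kE center_edge.
  by rewrite uE !inE (negbTE K'C) => /eqP.
rewrite {}uE {}vE {}tE in uv ut vt *; rewrite !edge_sub_vert in ut vt; rewrite edge_eq in uv.
suff [E|E] : j = d + 1 %[mod 6] \/ j = d + 5 %[mod 6].
- by exists (d + 1)%N; [left | rewrite -(nb_mod C E) -K'E].
- by exists (d + 5)%N; [right | rewrite -(nb_mod C E) -K'E].
have S1 x : x.+1 = x + 1 %[mod 6] by rewrite addn1.
case/orP: ut => /eqP ji; case/orP: vt => /eqP di.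
- by case/eqP: uv; rewrite ji di.
- right; rewrite ji -modnDml di modnDml addSn -addnS modnDr //.
- left; rewrite ji -(modnDml d) di modnDml addn1 //.
- by case/eqP: uv; rewrite ji di.
Qed.

Lemma u_shared_edge S h d j : let C := nb h d in j = (d + 1)%N \/ j = (d + 5)%N ->
  nb C j \in S -> u_shared S [:: h; C] (edge C j) (nb C j).
Proof.
move=> C jd jS; rewrite /u_shared /chain_end /=; exists (edge C d); split.
- apply/fset2P; left; rewrite /edge /nb /chain_step /=; congr [fset _; addc _ _].
  by apply: cell_eq; rewrite /= addrAC subrr add0r.
- by apply/in_hexedges; exists d.
- rewrite !inE eq_sym (negbTE (nb_neq _ _)) /=; apply/eqP => E.
  have := @line_nb h d 1 0 d (esym E); case=> [[_ //]|[/eqP]].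
  by rewrite eq_sym mod6_add_neq.
- split; first by apply/in_hexedges; exists j.
    by rewrite edge_eq; case: jd => ->; rewrite mod6_add_neq.
  apply/hasP; case: jd => ->.
    exists (vert C d); first by apply/in_hexverts; exists d.
    by rewrite !edge_sub_vert addn1 !eqxx orbT.
  exists (vert C (d + 5)); first by apply/in_hexverts; exists (d + 5)%N.
  by rewrite !edge_sub_vert eqxx -addnS modnDr eqxx orbT.
- split=> //; first exact: nb_neq.
  by apply/in_hexedges; exists (j + 3)%N; rewrite edge_opp.
Qed.

(** * Tails *)

(** Each L_i starts at [C], since the cells opposite to its direction are missing, so by
    [maxchain_through] deleting it amounts to deleting a run. [C] itself has already been
    deleted. *)
Lemma H4_eq S h d H2 n1 n2 T1 T2 H4 : let C := nb h d in
    H3T S T1 T2 [:: h; C] = H2 `\ C ->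
    nb C (d + 2) \notin S -> nb C (d + 4) \notin S ->
    (forall k, (0 < k <= n1)%N -> walk C (d + 1) k \in S) -> walk C (d + 1) n1.+1 \notin S ->
    (forall k, (0 < k <= n2)%N -> walk C (d + 5) k \in S) -> walk C (d + 5) n2.+1 \notin S ->
    is_H4 S T1 T2 [:: h; C] H4 ->
  H4 = H2 `\ C `\` run C (d + 1) n1 `\` run C (d + 5) n2.
Proof.
move=> C H3E C2 C4 in1 out1 in2 out2 [Ls [LsP cover ->]]; rewrite H3E.
have CE : chain_end [:: h; C] = C by [].
rewrite CE in LsP cover.
have thru l j : j = (d + 1)%N \/ j = (d + 5)%N -> maxchain S l -> C \in l -> nb C j \in l ->
    hexset l = C |` run C j (if j == (d + 1)%N then n1 else n2).
  case=> -> max Cl jl; apply: maxchain_through max Cl jl _ _ _; rewrite ?eqxx //.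
  - by rewrite -addnA.
  - by rewrite (@nb_mod C (d + 5 + 3) (d + 2)) // -addnA -[(5 + 3)%N]/(2 + 6)%N addnA modnDr.
  - by rewrite eqn_add2l.
  - by rewrite eqn_add2l.
have covers_run j n d' : j = (d + 1)%N \/ j = (d + 5)%N -> n = (if j == (d + 1)%N then n1 else n2) ->
    (forall k, (0 < k <= n)%N -> walk C j k \in S) -> d' \in run C j n ->
    d' \in \bigcup_(l <- Ls) hexset l.
  move=> jd nE inS dr; have jS : nb C j \in S.
    apply: (inS 1%N); case/runP: dr => k /andP[k0 kn] _; exact: leq_trans k0 kn.
  have [l lLs [max Cl jl]] := cover _ _ (u_shared_edge jd jS).
  by apply/bigfcupP; exists l; rewrite ?lLs // (thru _ _ jd) // in_fset1U -nE dr orbT.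
apply/fsetP => e; rewrite !in_fsetD in_fset1.
have [->|eC] := eqVneq e C; first by rewrite !andbF.
suff -> : (e \in \bigcup_(l <- Ls) hexset l) = (e \in run C (d + 1) n1) || (e \in run C (d + 5) n2).
  by rewrite negb_or -andbA andbCA.
apply/idP/orP => [/bigfcupP[l /andP[lLs _] el]|[er|er]].
- have [u [K' [ush max Cl K'l]]] := LsP _ lLs.
  have [j jd [jS K'E]] := u_sharedP ush; rewrite K'E in K'l.
  move: el; rewrite (thru _ _ jd max Cl K'l) in_fset1U (negbTE eC) /=.
  by case: jd => ->; rewrite ?eqxx ?eqn_add2l; [left|right].
- by apply: (covers_run (d + 1)%N n1) er => //; [left|rewrite eqxx].
- by apply: (covers_run (d + 5)%N n2) er => //; [right|rewrite eqn_add2l].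
Qed.

Lemma tail_sets S h (R1 R2 R3 : {fset cell}) T1 T2 T3 :
    hexset T1 = h |` R1 -> hexset T2 = h |` R2 -> hexset T3 = h |` R3 ->
    h \notin R1 -> h \notin R2 ->
  [/\ H1T S h T1 T2 T3 = S `\` R1 `\` R2, H2T S T1 T2 T3 = S `\` R1 `\` R2 `\ h &
      H3T S T1 T2 T3 = S `\` R1 `\` R2 `\ h `\` R3].
Proof.
move=> E1 E2 E3 h1 h2; rewrite /H1T /H2T /H3T E1 E2 E3.
split; apply/fsetP => e; rewrite !(in_fsetD, in_fsetU, in_fset1); have [->|_] := eqVneq e h;
  rewrite ?(negbTE h1) ?(negbTE h2) //=; case: (e \in R1); case: (e \in R2); case: (e \in R3);
  by rewrite ?andbT ?andbF.
Qed.

Lemma polyC_int n : (n%:Z)%:P = n%:R :> {poly int}.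
Proof. by rewrite -[n%:Z]natz rmorph_nat. Qed.

Lemma size_tail (s : seq cell) (t : int) : 0 <= t -> (size s)%:Z = t + 2 ->
  exists2 m, t = m%:Z & size s = m.+2.
Proof. by case: t => // m _ E; exists m => //; move: E; lia. Qed.

Lemma tail_chain S h s m : maxchain S s -> head h s = h -> size s = m.+2 ->
  exists i, [/\ s = chain h i m.+2, forall k, (k < m.+2)%N -> walk h i k \in S,
                walk h i m.+2 \notin S & nb h (i + 3) \notin S].
Proof. by move=> max hs sE; have [|i] := maxchain_walk max hs; rewrite sE // => H; exists i. Qed.

Lemma notin0 (h : cell) : h \notin (fset0 : {fset cell}).
Proof. by rewrite inE. Qed.

Lemma chain1 h i : [:: h] = chain h i 1. Proof. by []. Qed.

Lemma card_nbrs S h (l : seq nat) : (forall i, i \in l -> nb h i \in S) -> uniq [seq nb h i | i <- l] ->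
  (size l <= #|` nbrs S h|)%N.
Proof.
move=> lS ul; rewrite -(size_map (nb h)); apply: uniq_leq_size ul _ => d /mapP[i il ->].
by rewrite !inE adjc_nb lS.
Qed.

Theorem theorem3p2 (S : {fset cell}) (h : cell) (T1 T2 T3 : seq cell)
    (t1 t2 t3 : int) :
  hexagonal_system S -> catacondensed S -> is_tail S h T1 T2 T3 t1 t2 t3 ->
  let x : {poly int} := 'X in
  let A1 := Af (H1T S h T1 T2 T3) in
  let A2 := Af (H2T S T1 T2 T3) in
  let A3 := Af (H3T S T1 T2 T3) in
  (* (1) t2 = -1 *)
  (t2 = -1 -> t1 = -1 -> Af S = x * A2 + x * A3) /\
  (t2 = -1 -> 0 <= t1 ->
     Af S = x * A2 + x * A3 + (x * A1 + t1%:P * x ^+ 2 * A2 - x ^+ 2 * A3)) /\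
  (* (2) t2 >= 0 *)
  (0 <= t2 -> t3 = 0 -> forall H4, is_H4 S T1 T2 T3 H4 ->
     Af S = x ^+ 2 * A1
            + (3%:P * x ^+ 2 + (2 * (t1 + t2))%:P * x ^+ 3 + (t1 * t2)%:P * x ^+ 4) * A2
            - x ^+ 3 * A3 + (x * A2 - x ^+ 2 * Af H4)) /\
  (0 <= t2 -> 1 <= t3 ->
     Af S = x ^+ 2 * A1
            + (3%:P * x ^+ 2 + (2 * (t1 + t2))%:P * x ^+ 3 + (t1 * t2)%:P * x ^+ 4) * A2
            - x ^+ 3 * A3 + x ^+ 2 * A3).
Proof.
move=> [_ [_ nh]] cata tail x A1 A2 A3.
have in_chain i n k : S = hexset (chain h i n) -> (k < n)%N -> walk h i k \in S.
  by move=> -> kn; rewrite in_fset; apply/chainP; exists k.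
case: tail => [[[lin SE term] T2E T3E [t1m sT1 t2E t3E]]|[]].
- have hS : h \in S by case/andP: term.
  have SE' : hexset T1 = S by rewrite SE.
  have setD1 R : (h |` R) `\` R `\` fset0 `\ h = fset0.
    by apply/fsetP => e; rewrite !inE; case: (e == h); case: (e \in R).
  have hx0 (s : seq cell) : s = [:: h] -> hexset s = h |` fset0.
    by move=> ->; rewrite (chain1 h 0) hexset_chain run0.
  split=> [_ t1E|]; last split; last by rewrite t2E.
    have s1 : size T1 = 1%N by move: sT1; rewrite t1E; lia.
    have T1E : T1 = [:: h].
      case: (T1) s1 SE' hS => [|y []] // _ <-.
      by rewrite in_fset inE => /eqP->.
    have [_ E2 E3] := tail_sets S (hx0 _ T1E) (hx0 _ T2E) (hx0 _ T3E) (notin0 h) (notin0 h).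
    have {}SE : S = [fset h] by rewrite -SE' (hx0 _ T1E) fsetU0.
    rewrite /A2 /A3 E2 E3 SE !fsetD0 fsetDv; apply: Af_hexagon; by rewrite -SE.
  move=> _ t10; have [m t1E sE] := size_tail t10 sT1.
  (* [T1] may list the line from either end. Were [h] strictly inside, it would have two neighbours
     and not be terminal. *)
  have [a Sa] : exists a, S = h |` run h a m.+1.
    have [i [T1E inS]] := linchain_walk lin.
    move: (head c0 T1) T1E inS => y; rewrite sE => T1E inS.
    have SE2 : S = hexset (chain y i m.+2) by rewrite -SE' T1E.
    have [p pm hp] : exists2 p, (p < m.+2)%N & h = walk y i p.
      by apply/chainP; move: hS; rewrite SE2 in_fset.
    have [p0|p0] := posnP p.
      by exists i; rewrite SE2 hexset_chain hp p0.
    have [pE|pE] := eqVneq p m.+1.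
      exists (i + 3)%N; by rewrite SE2 -hexset_rev chain_rev hexset_chain hp pE.
    case/andP: term => _ /orP[/eqP n1|/eqP Sh]; last first.
      have := inS 0%N isT; rewrite Sh inE hp (inj_eq (@walk_inj y i)) => /eqP p0'.
      by rewrite -p0' in p0.
    have := @card_nbrs S h [:: i; i + 3]%N; rewrite n1 => H; suff : false by []; apply: H.
      move=> j; rewrite !inE hp => /orP[]/eqP->.
        by apply: (inS p.+1); rewrite ltnS ltn_neqAle pE -ltnS.
      by rewrite -(prednK p0) walk_back inS // prednK // ltnW.
    by rewrite /= inE nb_eq eq_sym mod6_add_neq.
  have hx1 : hexset T1 = h |` run h a m.+1 by rewrite SE'.
  have [E1 E2 E3] := tail_sets S hx1 (hx0 _ T2E) (hx0 _ T3E) (center_run _ _ _) (notin0 h).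
  have BE : S `\` run h a m.+1 = [fset h].
    rewrite Sa; apply/fsetP => e; rewrite in_fsetD in_fset1U in_fset1; have [->|_] := eqVneq e h.
      by rewrite center_run.
    by case: (e \in run h a m.+1).
  rewrite /A1 /A2 /A3 E1 E2 E3 BE !fsetD0 fsetDv t1E polyC_int Sa.
  by apply: Af_line; rewrite -Sa.
- case=> [[kinkS _] T2E [max1 h1 term1] [max3 h3 T31] [t2E t10 t30 sT1 sT3]].
  have [m1 t1E s1] := size_tail t10 sT1; have [m3 t3E s3] := size_tail t30 sT3.
  have [a [T1E aS aout aback]] := tail_chain max1 h1 s1.
  have [b [T3E bS bout bback]] := tail_chain max3 h3 s3.
  have hS : h \in S by exact: (aS 0%N).
  have [ba b_a] : odd b = odd a /\ b != a %[mod 6].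
    by apply: (ray_dirs cata hS aS aout bS bout aback) => E; apply: T31; rewrite T1E T3E.
  have [c [ca c_a c_b]] := third_dir ba b_a.
  have free := free_dirs cata hS (aS 1%N isT) aback.
  (* A kink has exactly two neighbours, those in directions [a] and [b]. *)
  have cS : nb h c \notin S.
    apply/negP => cS; case/and3P: kinkS => _ /eqP n2 _.
    have := @card_nbrs S h [:: a; b; c]; rewrite n2 => H; suff : false by []; apply: H.
      by move=> i; rewrite !inE => /or3P[]/eqP-> //; [exact: (aS 1%N)|exact: (bS 1%N)].
    by rewrite /= !inE !nb_eq negb_or !andbT !(eq_sym (a %% 6)%N) b_a c_a eq_sym c_b.
  have br : is_branch S h a m1.+1.
    apply: branch_of_chain => //; move: term1; rewrite T1E /chain_end last_chain //.
  have hx1 : hexset T1 = h |` run h a m1.+1 by rewrite T1E hexset_chain.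
  have hx2 : hexset T2 = h |` run h a 0 by rewrite T2E (chain1 h a) hexset_chain.
  have hx3 : hexset T3 = h |` run h b m3.+1 by rewrite T3E hexset_chain.
  have [E1 E2 E3] := tail_sets S hx1 hx2 hx3 (center_run _ _ _) (center_run _ _ _).
  rewrite t1E t2E; split=> //; split=> // _ _.
  rewrite /A1 /A2 /A3 E1 E2 E3 run0 fsetD0 polyC_int.
  exact: (Af_kink cata nh br free ba ca b_a c_a c_b cS bS bout).
- case=> [[_ _] [max1 h1 term1] [max2 h2 term2] [max3 h3 T12 T13 T23]].
  case=> t10 t20 t30 [sT1 sT2 sT3].
  have [m1 t1E s1] := size_tail t10 sT1; have [m2 t2E s2] := size_tail t20 sT2.
  have [m3 t3E s3] := size_tail t30 sT3.
  have [a [T1E aS aout aback]] := tail_chain max1 h1 s1.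
  have [c [T2E cS cout cback]] := tail_chain max2 h2 s2.
  have [d [T3E dS dout dback]] := tail_chain max3 h3 s3.
  have hS : h \in S by exact: (aS 0%N).
  have [ca c_a] : odd c = odd a /\ c != a %[mod 6].
    by apply: (ray_dirs cata hS aS aout cS cout aback) => E; apply: T12; rewrite T1E T2E.
  have [da d_a] : odd d = odd a /\ d != a %[mod 6].
    by apply: (ray_dirs cata hS aS aout dS dout aback) => E; apply: T13; rewrite T1E T3E.
  have [_ d_c] : odd d = odd c /\ d != c %[mod 6].
    by apply: (ray_dirs cata hS cS cout dS dout cback) => E; apply: T23; rewrite T2E T3E.
  have free := free_dirs cata hS (aS 1%N isT) aback.
  have br1 : is_branch S h a m1.+1.
    by apply: branch_of_chain => //; move: term1; rewrite T1E /chain_end last_chain.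
  have br2 : is_branch S h c m2.+1.
    by apply: branch_of_chain => //; move: term2; rewrite T2E /chain_end last_chain.
  have hx1 : hexset T1 = h |` run h a m1.+1 by rewrite T1E hexset_chain.
  have hx2 : hexset T2 = h |` run h c m2.+1 by rewrite T2E hexset_chain.
  have hx3 : hexset T3 = h |` run h d m3.+1 by rewrite T3E hexset_chain.
  have [E1 E2 E3] := tail_sets S hx1 hx2 hx3 (center_run _ _ _) (center_run _ _ _).
  have hd : nb h d \in S by exact: (dS 1%N).
  have P3 : afsum (restr (pms (S `\` run h a m1.+1 `\` run h c m2.+1 `\ h)) [fset edge h d])
      = Af (S `\` run h a m1.+1 `\` run h c m2.+1 `\ h `\` run h d m3.+1).
    by apply: (afsum_third_tail (a := a)) => // k /andP[_ km]; apply: dS.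
  split; first by rewrite t2E.
  split; first by rewrite t2E.
  rewrite t1E t2E t3E; split=> _.
    (* For t3 = 0 the chain T3 consists of [h] and [nb h d], so the neighbour of [h] in direction
       [d] is the hexagon K of the definition of H4. *)
    case: m3 {t3E} s3 dS dout T3E hx3 E3 P3 => // s3 dS dout T3E hx3 E3 P3 _ H4 H4P.
    have Cd : nb (nb h d) d \notin S by exact: dout.
    have [n1 [in1 out1]] := run_length S (nb h d) (d + 1).
    have [n2 [in2 out2]] := run_length S (nb h d) (d + 5).
    have C24 : nb (nb h d) (d + 2) \notin S /\ nb (nb h d) (d + 4) \notin S.
      have back : nb (nb h d) (d + 3) \in S by rewrite nb_opp.
      split; last by rewrite addnS; exact: cata_nb back.
      have := cata_nb' cata hd back.
      by rewrite (@nb_mod _ (d + 3 + 5) (d + 2)) // -addnA -[(3 + 5)%N]/(2 + 6)%N addnA modnDr.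
    have [C2 C4] := C24.
    have run1 : run h d 1 = [fset nb h d] by rewrite runS run0 fsetU0.
    rewrite run1 in E3 P3.
    have E3' : H3T S T1 T2 [:: h; nb h d] = H2T S T1 T2 T3 `\ nb h d.
      by rewrite -[X in H3T _ _ _ X]T3E E3 E2.
    rewrite T3E in H4P.
    rewrite (H4_eq E3' C2 C4 in1 out1 in2 out2 H4P) /A1 /A2 /A3 E1 E2 E3 -P3.
    rewrite (Af_double_near cata nh br1 br2 free ca da c_a d_a d_c hd Cd in1 out1 in2 out2).
    rewrite !(polyCM, polyCD) !polyC_int /x natrM natrD; ring.
  case: m3 {t3E} s3 dS dout T3E hx3 E3 P3 => // m3 s3 dS dout T3E hx3 E3 P3 _.
  have Cd : nb (nb h d) d \in S by exact: (dS 2%N).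
  rewrite /A1 /A2 /A3 E1 E2 E3 -P3.
  rewrite (Af_double_far cata nh br1 br2 free ca da c_a d_a d_c hd Cd).
  rewrite !(polyCM, polyCD) !polyC_int /x natrM natrD; ring.
Qed.
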